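(* Suppose the standing assumptions on $(X,Y,f,F)$ and the stochastic oracle assumption of the context hold. Let $\varepsilon>0$, fix a known bound $\overline B\ge B$ independent of $\varepsilon$ and $\tau$, let $C_\star=140$, and set $$\tau_{\rm os}:=\min\left\{L,\frac{\varepsilon^2}{16LD_Y^2}\right\},\qquad K_\varepsilon^{\rm os}:=\max\left\{1,\frac{4LD_Y}{\varepsilon}\right\}.$$ Choose $h,\alpha,k,\beta$ as in the context with $\tau=\tau_{\rm os}$, and let $z_{\rm out}:=z_J$. (a) Run SPDE with $$T=\max\left\{1,\left\lceil\frac{64L\overline B}{\beta\varepsilon^2}\right\rceil\right\},\qquad m=\max\left\{1,\left\lceil\frac{19200\sigma^2}{\beta\varepsilon^2}\right\rceil\right\}.$$ Then $\mathbb E[\mathcal S_{\rm OS}(z_{\rm out})^2]\le\varepsilon^2$ and the number of SFO calls satisfies $$N_{{\rm os},{\rm ncc}}\le3\left(1+\frac{64L\overline B}{\beta\varepsilon^2}\right)\left(1+\frac{19200\sigma^2}{\beta\varepsilon^2}\right)=O\!\left(1+\frac{(L\overline B+\sigma^2)K_\varepsilon^{\rm os}}{\varepsilon^2}+\frac{L\overline B\sigma^2(K_\varepsilon^{\rm os})^2}{\varepsilon^4}\right).$$ For fixed problem data, $\overline B$, and $\sigma>0$, this gives $T=O(\varepsilon^{-3})$, $m=O(\varepsilon^{-3})$ and $N_{{\rm os},{\rm ncc}}=O(\varepsilon^{-6})$. (b) If the paired-oracle assumption also holds, run VR-SPDE with $$T=\max\left\{1,\left\lceil\frac{128L\overline B}{\beta\varepsilon^2}\right\rceil\right\},\quad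 B_{\rm r}=\max\left\{1,\left\lceil\frac{768C_\star\sigma^2}{\beta^2\varepsilon^2}\right\rceil\right\},\quad A_{{\rm os},{\rm ncc}}:=\frac{16C_\star\chi^2}{\beta^2},$$ $$q=\max\left\{1,\left\lfloor\sqrt{B_{\rm r}/A_{{\rm os},{\rm ncc}}}\right\rfloor\right\},\qquad b=\lceil A_{{\rm os},{\rm ncc}}q\rceil.$$ Then $\mathbb E[\mathcal S_{\rm OS}(z_{\rm out})^2]\le\varepsilon^2$ and the number of SFO calls satisfies $$N_{{\rm os},{\rm vr},{\rm ncc}}\le B_{\rm r}+18T\min\left\{B_{\rm r},\sqrt{A_{{\rm os},{\rm ncc}}B_{\rm r}}\right\}=O(\varepsilon^{-4}+\chi\varepsilon^{-6})=O(\varepsilon^{-6}),$$ the orders being for fixed positive problem data, $\sigma$, and $\chi$. (c) If $\sigma=0$, both methods use $O(\varepsilon^{-3})$ SFO calls.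
   Context: **Standing assumptions.** All norms are Euclidean. $X\subseteq\mathbb R^n$ is nonempty, closed, convex; $Y\subseteq\mathbb R^p$ is nonempty, compact, convex with $D_Y:=\max_{y\in Y}\|y\|>0$. $\omega\sim\mathcal D$ is random and $F(x,y)=\mathbb E_{\omega\sim\mathcal D}[f(x,y;\omega)]$. For almost every $\omega$, $f(\cdot,\cdot;\omega)$ is differentiable on a neighborhood of $X\times Y$. $F$ is continuously differentiable on a neighborhood of $X\times Y$ and $\nabla F$ is $L$-Lipschitz on $X\times Y$ for some $L>0$. For every $x\in X$, $F(x,\cdot)$ is concave on $Y$. $\phi(x):=\max_{y\in Y}F(x,y)$ and $\phi_{\inf}:=\inf_{x\in X}\phi(x)>-\infty$. $\Pi_C$ denotes Euclidean projection onto a closed convex set $C$. **Stochastic oracle.** There is a constant $\sigma\ge0$ (independent of query point, iteration and $\tau$) such that for every sigma-algebra $\mathcal A$ of pre-query information and every $\mathcal A$-measurable $u\in X\times Y$, a fresh sample $\omega\sim\mathcal D$ independent of $\mathcal A$ satisfies $\mathbb E[\nabla f(u;\omega)\mid\mathcal A]=\nabla F(u)$ and $\mathbb E[\|\nabla f(u;\omega)-\nabla F(u)\|^2\mid\mathcal A]\le\sigma^2$. Samples within a batch are independent draws from $\mathcal D$, independent of all information available before the batch is drawn. Each evaluation of $\nabla f(u;\omega)$ at one point is one stochastic first-order oracle (SFO) call. **Paired oracle.** $\nabla f(u;\omega)$ and $\nabla f(u';\omega)$ can be evaluated with the same sample (cost: two SFO calls), and there is $\ell\ge L$ such that for every pre-query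 $\mathcal A$ and $\mathcal A$-measurable $u,u'\in X\times Y$, a fresh $\omega\sim\mathcal D$ independent of $\mathcal A$ satisfies $\mathbb E[\|\nabla f(u;\omega)-\nabla f(u';\omega)\|^2\mid\mathcal A]\le\ell^2\|u-u'\|^2$. Set $\chi:=\ell/L\ge1$. **Optimization stationarity.** For $z\in\mathbb R^n$, $p_0(z):=\min_{x\in X}\{\phi(x)+L\|x-z\|^2\}$, with unique minimizer $x_0^\star(z)$; $p_0$ is continuously differentiable with $\nabla p_0(z)=2L(z-x_0^\star(z))$, and $\mathcal S_{\rm OS}(z):=\|\nabla p_0(z)\|$. **Iteration.** Given deterministic $x_0\in X$, $y_0\in Y$ and parameters $\tau,h,\alpha,k,\beta$, set $z_0=x_0$, $\xi_0=0$, $n_0=v_0=0$. For $t=0,\dots,T-1$, with gradient estimates $\widehat g^{(r)}_t=(\widehat g^{(r)}_{x,t},\widehat g^{(r)}_{y,t})$, $r=0,1,2$, at the points $(x_t,y_t)$, $(\widetilde x_t,\widetilde y_t)$, $(x_{t+1},y_{t+1})$ respectively, computed sequentially: (1) $\widetilde x_t=\Pi_X(x_t-h(\widehat g^{(0)}_{x,t}+2L(x_t-z_t)+\xi_t))$, $\widetilde y_t=\Pi_Y(y_t+h(\widehat g^{(0)}_{y,t}-\tau y_t-n_t+v_t))$. (2) $\bar v_t=\alpha v_t+k(\widehat g^{(1)}_{y,t}-\tau\widetilde y_t)$; $x_{t+1}=\Pi_X(x_t-h(\widehat g^{(1)}_{x,t}+2L(\widetilde x_t-z_t)))$; $\xi_{t+1}=\frac{x_t-x_{t+1}}h-\widehat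 g^{(1)}_{x,t}-2L(\widetilde x_t-z_t)$; $y_{t+1}=\Pi_Y(y_t+h(\widehat g^{(1)}_{y,t}-\tau\widetilde y_t+\bar v_t))$; $n_{t+1}=\frac1{1+k}\left(\frac{y_t-y_{t+1}}h+\widehat g^{(1)}_{y,t}-\tau\widetilde y_t+\bar v_t\right)$. (3) $v_{t+1}=\alpha v_t+k(\widehat g^{(2)}_{y,t}-\tau y_{t+1}-n_{t+1})$; $z_{t+1}=z_t+\beta(x_{t+1}-z_t)$. $J\sim\operatorname{Unif}\{0,\dots,T-1\}$ is drawn independently of all oracle samples. *SPDE*: each $\widehat g^{(r)}_t$ is the average of $\nabla f(\cdot;\omega)$ over a fresh batch of $m$ samples at its point (total at most $3mT$ SFO calls). *VR-SPDE*: with $u_{3t}=(x_t,y_t)$, $u_{3t+1}=(\widetilde x_t,\widetilde y_t)$, $u_{3t+2}=(x_{t+1},y_{t+1})$, $\widehat g^{(r)}_t=\mathsf g_{3t+r}$, where $\mathsf g_j=\frac1{B_{\rm r}}\sum_{i=1}^{B_{\rm r}}\nabla f(u_j;\omega_{j,i})$ if $j\equiv0\pmod q$ and $\mathsf g_j=\mathsf g_{j-1}+\frac1b\sum_{i=1}^b[\nabla f(u_j;\omega_{j,i})-\nabla f(u_{j-1};\omega_{j,i})]$ otherwise, with fresh samples at each request drawn after the query point is determined (a refresh costs $B_{\rm r}$ SFO calls, any other request at most $2b$). **Parameters.** $s=\sqrt{2L\tau}$, $h=\frac1{64(3L+\tau)}$, $\alpha=(1+hs/16)^{-1}$, $k=\frac{h(8L-s)}{16+hs}$,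 $\beta=\frac{hs}{4096}$. **Initial quantity.** $B:=\phi(x_0)-\phi_{\inf}+2D_Y\|\nabla_yF(x_0,y_0)\|+\frac{\|\nabla_xF(x_0,y_0)\|^2+2\|\nabla_yF(x_0,y_0)\|^2}{L}+\left(3+\frac1{64}\right)LD_Y^2$. **Asymptotic notation.** $O(\cdot)$ suppresses constants independent of $\varepsilon$ and of parameters whose dependence is displayed explicitly; orders in $\varepsilon$ without additive $1$ are for $\varepsilon\downarrow0$. *)

(* Defs.v *)
(* MathComp world, with MathComp-Analysis. *)
From HB Require Import structures.
From mathcomp Require Import all_boot all_order all_algebra.
From mathcomp Require Import all_classical all_reals all_analysis.
Set Implicit Arguments.
Unset Strict Implicit.
Unset Printing Implicit Defensive.
Import Order.TTheory GRing.Theory Num.Theory.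
Import numFieldNormedType.Exports.
Local Open Scope classical_set_scope.
Local Open Scope ring_scope.

(* The library norm on 'rV[R]_n is the sup norm; it induces the same topology
   (hence the same open sets and Frechet derivatives) as the Euclidean norm,
   but every quantitative norm below has to be one of the next two. *)
Section Euclidean.
Context {R : realType}.

Definition enorm n (u : 'rV[R]_n) : R := Num.sqrt (\sum_i u 0 i ^+ 2).

Definition enorm2 n p (u : 'rV[R]_n * 'rV[R]_p) : R :=
  Num.sqrt (enorm u.1 ^+ 2 + enorm u.2 ^+ 2).

Definition proj n (C : set 'rV[R]_n) (z : 'rV[R]_n) : 'rV[R]_n :=
  get [set c | C c /\ forall c', C c' -> enorm (z - c) <= enorm (z - c')].

Definition grad n (g : 'rV[R]_n -> R^o) (z : 'rV[R]_n) : 'rV[R]_n :=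
  \row_i 'D_(delta_mx 0 i) g z.

Definition grad2 n p (g : 'rV[R]_n * 'rV[R]_p -> R^o) (z : 'rV[R]_n * 'rV[R]_p) :
    'rV[R]_n * 'rV[R]_p :=
  (\row_i 'D_((delta_mx 0 i, 0) : 'rV[R]_n * 'rV[R]_p) g z,
   \row_j 'D_((0, delta_mx 0 j) : 'rV[R]_n * 'rV[R]_p) g z).

End Euclidean.

Section Probability.
Context {R : realType} {d : measure_display} {Omega : measurableType d}.
Variable P : probability Omega R.

Definition sub_sigma_algebra (A : set (set Omega)) :=
  sigma_algebra setT A /\ A `<=` measurable.

Definition measurable_wrt (A : set (set Omega)) (W : Omega -> R) :=
  forall B : set R, measurable B -> A (W @^-1` B).

Definition measurable_vec_wrt (A : set (set Omega)) n p
    (u : Omega -> 'rV[R]_n * 'rV[R]_p) :=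
  (forall i, measurable_wrt A (fun o => (u o).1 0 i)) /\
  (forall j, measurable_wrt A (fun o => (u o).2 0 j)).

(* W is a version of E[Z | A].  Z is only required to be integrable on each
   piece of a countable A-measurable cover of Omega: when X is unbounded, Z may
   be the stochastic gradient at an A-measurable point with no first moment.
   If Z is integrable, this is the usual notion (take E n = setT). *)
Definition is_condexp (A : set (set Omega)) (Z W : Omega -> R) :=
  measurable_wrt A W /\
  exists E : nat -> set Omega,
    [/\ forall k, A (E k),
        \bigcup_k E k = setT,
        forall k, P.-integrable (E k) (EFin \o Z) &
        forall k (G : set Omega), A G ->
          (\int[P]_(o in G `&` E k) (Z o)%:E = \int[P]_(o in G `&` E k) (W o)%:E)%E].

(* E[Z | A] <= V almost surely *)
Definition condexp_le (A : set (set Omega)) (Z V : Omega -> R) :=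
  exists W, is_condexp A Z W /\ {ae P, forall o, W o <= V o}.

Context {dS : measure_display} {S : measurableType dS}.

Definition indep_of (A : set (set Omega)) (w : Omega -> S) :=
  forall (E : set Omega) (B : set S), A E -> measurable B ->
    (P (E `&` w @^-1` B) = P E * P (w @^-1` B))%E.

Definition has_law (D : probability S R) (w : Omega -> S) :=
  measurable_fun setT w /\ forall B : set S, measurable B -> P (w @^-1` B) = D B.

Definition fresh_sample (D : probability S R) (A : set (set Omega))
    (w : Omega -> S) :=
  has_law D w /\ indep_of A w.

(* the variables w a, for a in I, are independent with law D *)
Definition iid_samples (D : probability S R) (I : set (nat * nat))
    (w : nat * nat -> Omega -> S) :=
  (forall a, I a -> has_law D (w a)) /\
  forall (s : seq (nat * nat)) (B : nat * nat -> set S),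
    uniq s -> (forall a, a \in s -> I a) -> (forall a, measurable (B a)) ->
    (P (\bigcap_(a in [set` s]) w a @^-1` B a)
     = \prod_(a <- s) P (w a @^-1` B a))%E.

Definition sample_sigma (I : set (nat * nat)) (w : nat * nat -> Omega -> S) :
    set (set Omega) :=
  <<s [set E | exists a (B : set S), [/\ I a, measurable B & E = w a @^-1` B]] >>.

End Probability.

(* J ~ Unif {0, ..., T - 1}, independent of the sigma-algebra A *)
Definition unif_index {R : realType} {d : measure_display}
    {Omega : measurableType d} (P : probability Omega R) (T : nat)
    (A : set (set Omega)) (J : Omega -> nat) :=
  [/\ measurable_fun setT J,
      forall t, (t < T)%N -> P (J @^-1` [set t]) = (T%:R^-1)%:E &
      indep_of P A J].

Section Problem.
Context {R : realType} {n p : nat}.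
Notation pt := ('rV[R]_n * 'rV[R]_p)%type.
Variables (X : set 'rV[R]_n) (Y : set 'rV[R]_p).
Context {dS : measure_display} {S : measurableType dS}.
Variable D : probability S R.
Variable f : pt -> S -> R^o.
(* gradf z s is the value returned by the oracle for grad f(z; s).  It agrees
   with the gradient of f(.; s) for almost every s; on the exceptional null set
   of samples its values on X x Y are arbitrary. *)
Variable gradf : pt -> S -> pt.
Variable L : R.

Definition objective (z : pt) : R^o := Rintegral D setT (f z).

Definition phi (x : 'rV[R]_n) : R := sup [set objective (x, y) | y in Y].

Definition phi_inf : R := inf (phi @` X).

Definition max_norm : R := sup (@enorm R p @` Y).

Definition moreau (z : 'rV[R]_n) : R^o :=
  inf [set phi x + L * enorm (x - z) ^+ 2 | x in X].

Definition S_OS (z : 'rV[R]_n) : R := enorm (grad moreau z).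

Notation borel := (g_sigma_algebraType (@open pt)).

Definition jointly_measurable_grad :=
  (forall i, measurable_fun (((X `*` Y) : set borel) `*` [set: S])
     (fun q : borel * S => (gradf q.1 q.2).1 0 i)) /\
  (forall j, measurable_fun (((X `*` Y) : set borel) `*` [set: S])
     (fun q : borel * S => (gradf q.1 q.2).2 0 j)).

Record standing_assumptions : Prop := StandingAssumptions {
  X_nonempty : X !=set0;
  X_closed : closed X;
  X_convex : convex_set X;
  Y_nonempty : Y !=set0;
  Y_compact : compact Y;
  Y_convex : convex_set Y;
  max_norm_gt0 : 0 < max_norm;
  L_gt0 : 0 < L;
  f_differentiable : {ae D, forall s, exists2 U : set pt,
    open U /\ X `*` Y `<=` U & forall z, U z -> differentiable (f^~ s) z};
  gradf_is_gradient : {ae D, forall s, forall z, (X `*` Y) z ->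
    gradf z s = grad2 (f^~ s) z};
  gradf_measurable : jointly_measurable_grad;
  objective_C1 : exists2 U : set pt, open U /\ X `*` Y `<=` U & forall z, U z ->
    [/\ D.-integrable setT (EFin \o f z),
        differentiable objective z &
        {for z, continuous (grad2 objective)}];
  grad_lipschitz : forall z z', (X `*` Y) z -> (X `*` Y) z' ->
    enorm2 (grad2 objective z - grad2 objective z') <= L * enorm2 (z - z');
  objective_concave : forall x, X x ->
    convex_function Y (fun y => - objective (x, y));
  phi_bounded_below : has_lbound (phi @` X)
}.

Definition stochastic_oracle {d : measure_display} {Omega : measurableType d}
    (P : probability Omega R) (sigma : R) :=
  forall (A : set (set Omega)) (u : Omega -> pt) (w : Omega -> S),
    sub_sigma_algebra A -> measurable_vec_wrt A u ->
    (forall o, (X `*` Y) (u o)) -> fresh_sample P D A w ->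
    [/\ forall i, is_condexp P A (fun o => (gradf (u o) (w o)).1 0 i)
                                 (fun o => (grad2 objective (u o)).1 0 i),
        forall j, is_condexp P A (fun o => (gradf (u o) (w o)).2 0 j)
                                 (fun o => (grad2 objective (u o)).2 0 j) &
        condexp_le P A
          (fun o => enorm2 (gradf (u o) (w o) - grad2 objective (u o)) ^+ 2)
          (fun=> sigma ^+ 2)].

Definition paired_oracle {d : measure_display} {Omega : measurableType d}
    (P : probability Omega R) (ell : R) :=
  forall (A : set (set Omega)) (u u' : Omega -> pt) (w : Omega -> S),
    sub_sigma_algebra A ->
    measurable_vec_wrt A u -> (forall o, (X `*` Y) (u o)) ->
    measurable_vec_wrt A u' -> (forall o, (X `*` Y) (u' o)) ->
    fresh_sample P D A w ->
    condexp_le P A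
      (fun o => enorm2 (gradf (u o) (w o) - gradf (u' o) (w o)) ^+ 2)
      (fun o => ell ^+ 2 * enorm2 (u o - u' o) ^+ 2).

Definition initial_quantity (x0 : 'rV[R]_n) (y0 : 'rV[R]_p) : R :=
  let g := grad2 objective (x0, y0) in
  phi x0 - phi_inf + 2 * max_norm * enorm g.2
  + (enorm g.1 ^+ 2 + 2 * enorm g.2 ^+ 2) / L
  + (3 + 64^-1) * L * max_norm ^+ 2.

Record params := Params {
  tau_of : R; h_of : R; alpha_of : R; k_of : R; beta_of : R }.

Record state := State {
  x_of : 'rV[R]_n; y_of : 'rV[R]_p; z_of : 'rV[R]_n;
  xi_of : 'rV[R]_n; n_of : 'rV[R]_p; v_of : 'rV[R]_p;
  last_of : pt * pt  (* previous query point and the estimate returned there *)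
}.

(* An estimator [req j (u', g') u] returns the estimate of request number j at
   the query point u, where u' and g' are the query point and the estimate of
   request j - 1 (irrelevant for j = 0). *)
Definition estimator := nat -> pt * pt -> pt -> pt.

Definition init (x0 : 'rV[R]_n) (y0 : 'rV[R]_p) : state :=
  State x0 y0 x0 0 0 0 (0, 0).

Definition step (c : params) (req : estimator) (t : nat) (st : state) : state :=
  let: State x y z xi nu v last := st in
  let: Params tau h alpha k beta := c in
  let g0 := req (3 * t)%N last (x, y) in
  let xt := proj X (x - h *: (g0.1 + (2 * L) *: (x - z) + xi)) in
  let yt := proj Y (y + h *: (g0.2 - tau *: y - nu + v)) in
  let g1 := req (3 * t + 1)%N ((x, y), g0) (xt, yt) in
  let vbar := alpha *: v + k *: (g1.2 - tau *: yt) in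
  let x1 := proj X (x - h *: (g1.1 + (2 * L) *: (xt - z))) in
  let xi1 := h^-1 *: (x - x1) - g1.1 - (2 * L) *: (xt - z) in
  let y1 := proj Y (y + h *: (g1.2 - tau *: yt + vbar)) in
  let nu1 := (1 + k)^-1 *: (h^-1 *: (y - y1) + g1.2 - tau *: yt + vbar) in
  let g2 := req (3 * t + 2)%N ((xt, yt), g1) (x1, y1) in
  let v1 := alpha *: v + k *: (g2.2 - tau *: y1 - nu1) in
  let z1 := z + beta *: (x1 - z) in
  State x1 y1 z1 xi1 nu1 v1 ((x1, y1), g2).

Fixpoint run (c : params) (req : estimator) (x0 : 'rV[R]_n) (y0 : 'rV[R]_p)
    (t : nat) : state :=
  if t is t'.+1 then step c req t' (run c req x0 y0 t') else init x0 y0.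

Definition spde_req (m : nat) (w : nat * nat -> S) : estimator := fun j _ u =>
  m%:R^-1 *: \sum_(i < m) gradf u (w (j, val i)).

Definition vr_req (Br b q : nat) (w : nat * nat -> S) : estimator :=
  fun j last u =>
    if (q %| j)%N then Br%:R^-1 *: \sum_(i < Br) gradf u (w (j, val i))
    else last.2 + b%:R^-1 *:
      \sum_(i < b) (gradf u (w (j, val i)) - gradf last.1 (w (j, val i))).

End Problem.

(* Index (j, i) is the i-th sample of request j; a run of T iterations makes the
   requests j < 3 * T. *)
Definition spde_indices (T m : nat) : set (nat * nat) :=
  [set a | (a.1 < 3 * T)%N /\ (a.2 < m)%N].

Definition vr_indices (T Br b q : nat) : set (nat * nat) :=
  [set a | (a.1 < 3 * T)%N /\ (a.2 < if (q %| a.1)%N then Br else b)%N].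

(* Numbers of stochastic gradient evaluations, without reusing any of them. *)
Definition spde_calls (T m : nat) : nat := (\sum_(j < 3 * T) m)%N.

Definition vr_calls (T Br b q : nat) : nat :=
  (\sum_(j < 3 * T) if (q %| j)%N then Br else 2 * b)%N.

Section ParameterChoice.
Context {R : realType}.

(* g = O(h) as eps tends to 0 from above; the let is there because the notation
   only parses with an atomic filter *)
Definition bigO_right0 (g h : R -> R^o) : Prop :=
  let F := at_right (0 : R) in g =O_F h.

(* max {1, ceil r} and max {1, floor r} as natural numbers *)
Definition ceil1 (r : R) : nat := absz (Num.max 1 (Num.ceil r)).
Definition floor1 (r : R) : nat := absz (Num.max 1 (Num.floor r)).

(* L : smoothness constant, DY : largest norm in Y, Bb : bound on the initial
   quantity, sigma : oracle noise, ell : paired-oracle constant, eps : accuracy *)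
Implicit Types L DY Bb sigma ell eps tau : R.

Definition s_par L tau : R := Num.sqrt (2 * L * tau).
Definition h_par L tau : R := (64 * (3 * L + tau))^-1.
Definition alpha_par L tau : R := (1 + h_par L tau * s_par L tau / 16)^-1.
Definition k_par L tau : R :=
  h_par L tau * (8 * L - s_par L tau) / (16 + h_par L tau * s_par L tau).
Definition beta_par L tau : R := h_par L tau * s_par L tau / 4096.

Definition tau_os L DY eps : R := Num.min L (eps ^+ 2 / (16 * L * DY ^+ 2)).
Definition K_os L DY eps : R := Num.max 1 (4 * L * DY / eps).
Definition beta_os L DY eps : R := beta_par L (tau_os L DY eps).

Definition os_params L DY eps : @params R :=
  let tau := tau_os L DY eps in
  Params tau (h_par L tau) (alpha_par L tau) (k_par L tau) (beta_par L tau).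

Definition C_star : R := 140.

Definition T_spde L DY Bb eps : nat :=
  ceil1 (64 * L * Bb / (beta_os L DY eps * eps ^+ 2)).
Definition m_spde L DY sigma eps : nat :=
  ceil1 (19200 * sigma ^+ 2 / (beta_os L DY eps * eps ^+ 2)).
Definition N_spde L DY Bb sigma eps : nat :=
  spde_calls (T_spde L DY Bb eps) (m_spde L DY sigma eps).
Definition bound_spde L DY Bb sigma eps : R :=
  3 * (1 + 64 * L * Bb / (beta_os L DY eps * eps ^+ 2))
    * (1 + 19200 * sigma ^+ 2 / (beta_os L DY eps * eps ^+ 2)).

Definition T_vr L DY Bb eps : nat :=
  ceil1 (128 * L * Bb / (beta_os L DY eps * eps ^+ 2)).
Definition Br_vr L DY sigma eps : nat :=
  ceil1 (768 * C_star * sigma ^+ 2 / (beta_os L DY eps ^+ 2 * eps ^+ 2)).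
Definition A_vr L DY ell eps : R :=
  16 * C_star * (ell / L) ^+ 2 / beta_os L DY eps ^+ 2.
Definition q_vr L DY sigma ell eps : nat :=
  floor1 (Num.sqrt ((Br_vr L DY sigma eps)%:R / A_vr L DY ell eps)).
Definition b_vr L DY sigma ell eps : nat :=
  absz (Num.ceil (A_vr L DY ell eps * (q_vr L DY sigma ell eps)%:R)).
Definition N_vr L DY Bb sigma ell eps : nat :=
  vr_calls (T_vr L DY Bb eps) (Br_vr L DY sigma eps)
    (b_vr L DY sigma ell eps) (q_vr L DY sigma ell eps).
Definition bound_vr L DY Bb sigma ell eps : R :=
  let Br : R := (Br_vr L DY sigma eps)%:R in
  Br + 18 * (T_vr L DY Bb eps)%:R
       * Num.min Br (Num.sqrt (A_vr L DY ell eps * Br)).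

End ParameterChoice.

(* Main.v *)
Require Import Defs.
From HB Require Import structures.
From mathcomp Require Import all_boot all_order all_algebra finmap.
From mathcomp Require Import all_classical all_reals all_analysis.
From mathcomp Require Import measurable_realfun ring lra zify.
Import Order.TTheory GRing.Theory Num.Theory.
Import numFieldNormedType.Exports.
Local Open Scope classical_set_scope.
Local Open Scope ring_scope.
Set Implicit Arguments.
Unset Strict Implicit.
Unset Printing Implicit Defensive.

(** Why the theorem is true.

    For a center z put Phi z x y = F (x, y) - tau/2 |y|^2 + L |x - z|^2. As F is
    L-weakly convex in x and concave in y, Phi z is L-strongly convex in x and
    tau-strongly concave in y, so it has a saddle point w(z), with value p(z)
    (saddle_exists). For tau = 0 the value is the Moreau envelope of phi, whose
    gradient is 2 L (z - w(z).1) (envelopeE, derive_envelope), and turning tau on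
    displaces the primal part of the saddle point by at most sqrt (tau / (2 L))
    times the radius of Y (saddle_bias). Hence the squared stationarity at z is at
    most 8 L^2 |z - w(z).1|^2 + 4 L tau DY^2 (S_OS_le), and the choice of tau makes
    the last term at most eps^2 / 4. It remains to make the average over t of the
    expectation of |z_t - w(z_t).1|^2 small.

    The iteration is an extragradient step for Phi z_t with a momentum v on the
    dual side, followed by a small step of the center towards x_(t+1). Let R and G
    be the gradients of Phi corrected by the normal vectors xi and nu, and
    a = sqrt (2 L tau) / 16. The potential L p(z) + energy, with
      energy = |R|^2 / 2 + |G + v|^2 / 2 - |v|^2 / 2
               + 3/4 |v + a/2 (y - w.2)|^2 + 3/4 (L - a) (p(z) - Phi z x y),
    is bounded below because the energy is nonnegative (energy_ge0). With the
    center fixed, one step decreases the energy by fixed multiples of h L |G|^2,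
    h a |v|^2, h L times the squared primal step vector and h a times weighted
    squared distances to the saddle point, up to errors of the gradient estimates
    (energy_step). Moving the center
    decreases p and returns be L^2 |z - w.1|^2; what it costs in energy is be times
    quantities already dissipated, and be is a small multiple of h a (energy_drift).
    Together, potential_step bounds be L^2 |z_t - w(z_t).1|^2 and the squared
    displacements of the three query points of the step by the decrease of the
    potential plus the squared errors and one term linear in the last error.
    Summation over a run gives the pathwise bounds run_bound_unbiased and
    run_bound_recursive, and potential_init compares the initial potential with
    the initial quantity.

    With independent batches the linear term has mean zero: up to a multiple of the
    error, the factor in front of it is known before the batch is drawn
    (predictable_sq, mean_centered), and each squared error has mean at most
    sigma^2 / m (batch_mean). With the recursive estimator the errors are biased, so
    the linear term is absorbed into the dissipation at the price of a factor
    1 / be; an error is the error of the previous request plus a centered increment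
    of variance ell^2 / b times the squared displacement (batch_difference), so that
    a block of q requests contributes at most q ell^2 / b times the displacements
    (sum_blocks), which the dissipated displacements dominate by the choice of b.
    All of this needs every vector of the run to be square integrable and
    measurable with respect to the samples drawn so far: it is, since each one is a
    Lipschitz function of the previous ones and of the estimates (run_sq).

    Averaging over the random index (random_index_bound) and inserting the
    parameters gives the accuracy statements; the call counts follow from
    1 / be <= 256 * 4096 * K_os (inv_beta_le). *)

Local Notation proj := Defs.proj.
Local Notation ceil1 := Defs.ceil1.
Local Notation floor1 := Defs.floor1.

(** * Euclidean geometry, minimizers and projections *)

Section Dot.
Context {R : realType} {n : nat}.
Implicit Types (u v w : 'rV[R]_n) (a : R).

Definition dot u v : R := \sum_i u 0 i * v 0 i.

Lemma dotC u v : dot u v = dot v u.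
Proof. by apply: eq_bigr => i _; rewrite mulrC. Qed.

Lemma dotDl u v w : dot (u + v) w = dot u w + dot v w.
Proof. by rewrite -big_split; apply: eq_bigr => i _; rewrite !mxE mulrDl. Qed.

Lemma dotZl a u v : dot (a *: u) v = a * dot u v.
Proof. by rewrite mulr_sumr; apply: eq_bigr => i _; rewrite !mxE mulrA. Qed.

Lemma dotNl u v : dot (- u) v = - dot u v.
Proof. by rewrite -scaleN1r dotZl mulN1r. Qed.

Lemma dotDr u v w : dot u (v + w) = dot u v + dot u w.
Proof. by rewrite !(dotC u) dotDl. Qed.

Lemma dotZr a u v : dot u (a *: v) = a * dot u v.
Proof. by rewrite !(dotC u) dotZl. Qed.

Lemma dotNr u v : dot u (- v) = - dot u v.
Proof. by rewrite !(dotC u) dotNl. Qed.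

Lemma dot0l u : dot 0 u = 0.
Proof. by rewrite -(scale0r 0) dotZl mul0r. Qed.

Lemma dot0r u : dot u 0 = 0.
Proof. by rewrite dotC dot0l. Qed.

Definition dotE := (dotDl, dotDr, dotNl, dotNr, dotZl, dotZr, dot0l, dot0r).

Lemma dot_ge0 u : 0 <= dot u u.
Proof. by apply: sumr_ge0 => i _; rewrite -expr2 sqr_ge0. Qed.

Lemma coord_sq_le u i : u 0 i ^+ 2 <= dot u u.
Proof.
rewrite /dot (bigD1 i) //= -expr2 lerDl.
by apply: sumr_ge0 => j _; rewrite -expr2 sqr_ge0.
Qed.

Lemma dot_eq0 u : dot u u = 0 -> u = 0.
Proof.
move=> u0; apply/rowP => i; rewrite mxE; apply/eqP; rewrite -sqrf_eq0.
by rewrite eq_le sqr_ge0 andbT -u0 coord_sq_le.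
Qed.

Lemma enorm_ge0 u : 0 <= enorm u. Proof. exact: sqrtr_ge0. Qed.

Lemma enorm_sqr u : enorm u ^+ 2 = dot u u.
Proof.
rewrite /enorm sqr_sqrtr; last by apply: sumr_ge0 => i _; rewrite sqr_ge0.
by apply: eq_bigr => i _; rewrite expr2.
Qed.

Lemma young (t : R) u v : 0 < t -> dot u v <= t * dot u u + (4 * t)^-1 * dot v v.
Proof.
move=> t0; have := dot_ge0 (u - (2 * t)^-1 *: v); rewrite !dotE (dotC v u).
set p := dot u u; set q := dot u v; set r := dot v v => H.
have {}H : 0 <= t * (p + - ((2 * t)^-1 * q) + (- ((2 * t)^-1 * q) + - - ((2 * t)^-1 * ((2 * t)^-1 * r)))).
  by apply: mulr_ge0; [exact: ltW | lra].
suff E : t * (p + - ((2 * t)^-1 * q) + (- ((2 * t)^-1 * q) + - - ((2 * t)^-1 * ((2 * t)^-1 * r))))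
   = t * p + (4 * t)^-1 * r - q by rewrite E in H; lra.
by field; rewrite gt_eqF.
Qed.

Lemma youngN (t : R) u v :
  0 < t -> - dot u v <= t * dot u u + (4 * t)^-1 * dot v v.
Proof. by move=> t0; have := young u (- v) t0; rewrite !dotE opprK. Qed.

Lemma dot_add_le u v : dot (u + v) (u + v) <= 2 * dot u u + 2 * dot v v.
Proof. by have := dot_ge0 (u - v); rewrite !dotE (dotC v u); lra. Qed.

Lemma dot_sub_le u v : dot (u - v) (u - v) <= 2 * dot u u + 2 * dot v v.
Proof. by have := dot_ge0 (u + v); rewrite !dotE (dotC v u); lra. Qed.

Lemma CauchySchwarz u v : dot u v <= enorm u * enorm v.
Proof.
have [->|u0] := eqVneq u 0.
  by rewrite dot0l mulr_ge0 ?enorm_ge0.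
have [->|v0] := eqVneq v 0.
  by rewrite dot0r mulr_ge0 ?enorm_ge0.
have nz (w : 'rV[R]_n) : w != 0 -> 0 < enorm w.
  move=> w0; rewrite lt_def enorm_ge0 andbT; apply: contra w0 => /eqP w0.
  by apply/eqP/dot_eq0; rewrite -enorm_sqr w0 expr0n.
have := nz _ u0; have := nz _ v0 => nv nu.
have t0 : 0 < enorm v / (2 * enorm u) by rewrite divr_gt0 ?mulr_gt0.
apply: (le_trans (young u v t0)); rewrite -!enorm_sqr le_eqVlt; apply/orP; left.
by apply/eqP; field; rewrite !gt_eqF.
Qed.

Lemma enorm_add_le u v : enorm (u + v) <= enorm u + enorm v.
Proof.
rewrite -(ler_pXn2r (ltn0Sn 1)) ?nnegrE ?addr_ge0 ?enorm_ge0 //.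
rewrite enorm_sqr !dotE (dotC v u) sqrrD !enorm_sqr.
by have := CauchySchwarz u v; lra.
Qed.

Lemma enormN u : enorm (- u) = enorm u.
Proof. by rewrite /enorm; congr Num.sqrt; apply: eq_bigr => i _; rewrite mxE sqrrN. Qed.

Lemma enorm_le_sqrt u (r : R) : 0 <= r -> dot u u <= r ^+ 2 -> enorm u <= r.
Proof.
by move=> r0 H; rewrite -(ler_pXn2r (ltn0Sn 1)) ?nnegrE ?enorm_ge0// enorm_sqr.
Qed.

Lemma enorm_subC u v : enorm (u - v) = enorm (v - u).
Proof. by rewrite -enormN opprB. Qed.

End Dot.

(** With inner products generalized to scalars, linear arithmetic sees them as atoms. *)
Ltac absdot := repeat match goal with
  | |- context [@dot ?R ?n ?u ?v] => let r := fresh "r" in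
      set r := (@dot R n u v); clearbody r
  end.

(** First-order optimality arguments compare a point with points at distance of
    order t and divide by t; this lemma lets t tend to 0 at the end. *)
Lemma le_of_slack {R : realType} (a b c : R) :
  (forall t, 0 < t -> t < 1 -> a <= b + t * c) -> a <= b.
Proof.
move=> H; rewrite leNgt; apply/negP => ba.
have d0 : 0 < 2 * (`|c| + (a - b) + 1).
  by have := normr_ge0 c; lra.
set t := (a - b) / (2 * (`|c| + (a - b) + 1)).
have t0 : 0 < t by rewrite divr_gt0 // subr_gt0.
have t1 : t < 1 by rewrite ltr_pdivrMr // mul1r; have := normr_ge0 c; lra.
have := H t t0 t1; have : t * c <= t * `|c| by rewrite ler_wpM2l ?ler_norm// ltW.
have : t * `|c| <= (a - b) / 2.
  rewrite /t mulrAC ler_pdivrMr //.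
  have -> : (a - b) / 2 * (2 * (`|c| + (a - b) + 1)) =
            (a - b) * (`|c| + (a - b) + 1) by field.
  by rewrite ler_wpM2l; have := normr_ge0 c; lra.
lra.
Qed.

Section Topology.
Context {R : realType} {n : nat}.
Implicit Types (u v : 'rV[R]_n).

Lemma continuous_coord (i : 'I_n) : continuous (fun u : 'rV[R]_n => u 0 i).
Proof. exact: coord_continuous. Qed.

Lemma normr_le_enorm u : `|u| <= enorm u.
Proof.
rewrite [leLHS]/Num.norm /= mx_normrE; apply/bigmax_leP; split; first exact: enorm_ge0.
move=> [i j] _ /=; rewrite (ord1 i) -(ler_pXn2r (ltn0Sn 1)) ?nnegrE ?enorm_ge0//.
by rewrite real_normK ?num_real// enorm_sqr coord_sq_le.
Qed.

Lemma coord_le_normr u i : `|u 0 i| <= `|u|.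
Proof.
rewrite [leRHS]/Num.norm /= mx_normrE.
by apply/bigmax_geP; right; exists (0, i).
Qed.

Lemma dot_le_normr u : dot u u <= n%:R * `|u| ^+ 2.
Proof.
rewrite /dot; apply: (@le_trans _ _ (\sum_(i < n) `|u| ^+ 2)).
  apply: ler_sum => i _; rewrite -expr2 -real_normK ?num_real//.
  by rewrite ler_pXn2r ?nnegrE // coord_le_normr.
by rewrite sumr_const card_ord mulr_natl.
Qed.

Lemma continuous_dot (T : topologicalType) (f g : T -> 'rV[R]_n) (t : T) :
  {for t, continuous f} -> {for t, continuous g} ->
  {for t, continuous (fun s => dot (f s) (g s))}.
Proof.
move=> cf cg; rewrite /dot /continuous_at.
apply: cvg_big => [|i _]; first by move=> x; exact: add_continuous.
apply: cvgM; [apply: (cvg_comp f (fun u => u 0 i)) cf _|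
  apply: (cvg_comp g (fun u => u 0 i)) cg _]; exact: continuous_coord.
Qed.

End Topology.

Section Argmin.
Context {R : realType} {n : nat}.
Implicit Types (X : set 'rV[R]_n) (g : 'rV[R]_n -> R) (u v x z : 'rV[R]_n).

Lemma continuous_sqdist z : continuous (fun x => dot (x - z) (x - z)).
Proof.
move=> x; have cB : {for x, continuous (fun x => x - z)}.
  by apply: (@cvgB _ _ _ (nbhs x) _ id (cst z)); [exact: cvg_id|exact: cvg_cst].
exact: (continuous_dot cB cB).
Qed.

Lemma convex_segment X x x' (t : R) : convex_set X -> X x -> X x' ->
  0 <= t <= 1 -> X (x + t *: (x' - x)).
Proof.
move=> cX Xx Xx' /andP[t0 t1].
have := cX x' x (Itv01 t0 t1); rewrite !inE => /(_ Xx' Xx).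
suff -> : x + t *: (x' - x) = t *: x' + (1 - t) *: x by [].
by rewrite scalerBl scale1r scalerBr addrCA.
Qed.

Definition strongly_convex X g (mu : R) := forall x x' (t : R),
  X x -> X x' -> 0 <= t <= 1 ->
  g (x + t *: (x' - x)) <=
    (1 - t) * g x + t * g x' - mu / 2 * (t * (1 - t)) * dot (x' - x) (x' - x).

Lemma argmin_growth X g mu c x : convex_set X -> strongly_convex X g mu ->
  X c -> (forall x', X x' -> g c <= g x') -> X x ->
  g c + mu / 2 * dot (x - c) (x - c) <= g x.
Proof.
move=> cX sg Xc mc Xx; apply: (@le_of_slack _ _ _ (mu / 2 * dot (x - c) (x - c))).
move=> t t0 t1.
have t01 : 0 <= t <= 1 by rewrite !ltW.
have := le_trans (mc _ (convex_segment cX Xc Xx t01)) (sg c x t Xc Xx t01).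
set D := dot _ _; move=> H.
have {}H : t * (g c + mu / 2 * D) <= t * (g x + t * (mu / 2 * D)) by lra.
by rewrite ler_pM2l in H.
Qed.

(** Quadratic growth makes the sublevel set through x0 bounded, so a minimum over
    a compact set is enough although X itself may be unbounded. *)
Lemma argmin_exists X g (c delta : R) x1 : X !=set0 -> closed X ->
  {within X, continuous g} -> 0 < delta ->
  (forall x, X x -> c + delta * dot (x - x1) (x - x1) <= g x) ->
  exists2 m, X m & forall x, X x -> g m <= g x.
Proof.
move=> [x0 Xx0] clX cg d0 cog.
set r := (g x0 - c) / delta.
pose A := X `&` [set x | dot (x - x1) (x - x1) <= r].
have Ax0 : A x0.
  by split => //=; rewrite ler_pdivlMr // mulrC; have := cog _ Xx0; lra.
have clA : closed A.
  apply: closedI => //.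
  have -> : [set x | dot (x - x1) (x - x1) <= r] =
     (fun x => dot (x - x1) (x - x1)) @^-1` [set y | y <= r] by [].
  apply: closed_comp => [x _|]; [exact: continuous_sqdist | exact: closed_le].
have bA : bounded_set A.
  exists (Num.sqrt r + enorm x1); split; first exact: num_real.
  move=> M rM x [_ /= xr]; apply: le_trans (normr_le_enorm x) _.
  have -> : x = (x - x1) + x1 by rewrite subrK.
  apply: le_trans (enorm_add_le _ _) _; apply: le_trans (ltW rM).
  rewrite lerD2r; apply: enorm_le_sqrt; first exact: sqrtr_ge0.
  by rewrite sqr_sqrtr //; apply: le_trans xr; exact: dot_ge0.
have cA : {within A, continuous g}.
  by apply: continuous_subspaceW cg; exact: subIsetl.
have [m] := EVT_min_rV (ex_intro _ x0 Ax0) (bounded_closed_compact bA clA) cA.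
rewrite inE => -[Xm mr] mm; exists m => // x Xx.
have [xr|xr] := leP (dot (x - x1) (x - x1)) r; first by apply: mm; rewrite inE.
apply: le_trans (mm x0 _) _; first by rewrite inE.
have := cog _ Xx; rewrite ltr_pdivrMr // in xr; lra.
Qed.

Lemma sqdist_strongly_convex X z : strongly_convex X (fun x => dot (x - z) (x - z)) 2.
Proof.
move=> x x' t _ _ _; rewrite divff // mul1r le_eqVlt; apply/orP; left; apply/eqP.
by rewrite !dotE (dotC z x) (dotC x' x) (dotC z x'); ring.
Qed.

End Argmin.

Section Projection.
Context {R : realType} {n : nat} (X : set 'rV[R]_n).
Hypotheses (X0 : X !=set0) (clX : closed X) (cvX : convex_set X).
Implicit Types (x z c : 'rV[R]_n).

(** The chosen value is a nearest point because one exists, and quadratic growth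
    of the squared distance from a nearest point is the obtuse angle condition. *)
Lemma proj_spec z : X (proj X z) /\ forall c, X c -> dot (c - proj X z) (z - proj X z) <= 0.
Proof.
have [m Xm mm] : exists2 m, X m &
    forall x, X x -> dot (m - z) (m - z) <= dot (x - z) (x - z).
  apply: (@argmin_exists _ _ X (fun x => dot (x - z) (x - z)) 0 1 z) => //.
    by apply: continuous_subspaceT => x; exact: continuous_sqdist.
  by move=> x _; rewrite add0r mul1r.
set p := proj X z.
have [Xp pm] : [set c | X c /\ forall c', X c' -> enorm (z - c) <= enorm (z - c')] p.
  apply: getPex; exists m; split => // c Xc.
  rewrite !(enorm_subC z); apply: enorm_le_sqrt; first exact: enorm_ge0.
  by rewrite enorm_sqr mm.
split=> // c Xc.
have pm' c' : X c' -> dot (p - z) (p - z) <= dot (c' - z) (c' - z).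
  move=> Xc'; rewrite -!enorm_sqr ler_pXn2r ?nnegrE ?enorm_ge0//.
  by rewrite !(enorm_subC _ z); exact: pm.
have := argmin_growth cvX (@sqdist_strongly_convex _ _ X z) Xp pm' Xc.
rewrite !dotE (dotC c p) (dotC z p) (dotC z c); lra.
Qed.

Lemma proj_in z : X (proj X z). Proof. exact: (proj_spec z).1. Qed.

Lemma proj_normal z c : X c -> dot (c - proj X z) (z - proj X z) <= 0.
Proof. exact: (proj_spec z).2. Qed.

Lemma proj_nonexpansive z z' :
  dot (proj X z - proj X z') (proj X z - proj X z') <= dot (z - z') (z - z').
Proof.
have := proj_normal z (proj_in z'); have := proj_normal z' (proj_in z).
set p := proj X z; set p' := proj X z'.
have := dot_ge0 (z - z' - (p - p')).
rewrite !dotE (dotC z' z) (dotC p' p) (dotC z p) (dotC z p') (dotC z' p) (dotC z' p').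
lra.
Qed.

Lemma proj_id x : X x -> proj X x = x.
Proof.
move=> Xx; have := proj_normal x Xx; have := dot_ge0 (x - proj X x) => h1 h2.
by apply/esym/subr0_eq/dot_eq0/le_anti; rewrite h2 h1.
Qed.

(** The topology is that of the sup norm; the factor n in K compares its square
    with the squared Euclidean norm. *)
Lemma continuous_of_lipschitz m (k : R) (g : 'rV[R]_n -> 'rV[R]_m) :
  (forall x x', dot (g x - g x') (g x - g x') <= k * dot (x - x') (x - x')) ->
  continuous g.
Proof.
move=> gl x; apply/(@cvgrPdist_lt _ _ _ (nbhs x) (nbhs_filter x)) => e e0.
set K := Num.sqrt (`|k| * n%:R + 1).
have K0 : 0 < K by rewrite sqrtr_gt0 ltr_pwDr // mulr_ge0.
near=> y; apply: le_lt_trans (normr_le_enorm _) _.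
have xy : `|x - y| < e / K by near: y; apply: (@cvgr_dist_lt _ _ _ (nbhs x) (nbhs_filter x) id x (@cvg_id _ (nbhs x))); rewrite divr_gt0.
rewrite -(ltr_pXn2r (ltn0Sn 1)) ?nnegrE ?enorm_ge0 ?ltW// enorm_sqr.
apply: le_lt_trans (gl x y) _.
have h1 : k * dot (x - y) (x - y) <= `|k| * (n%:R * `|x - y| ^+ 2).
  apply: le_trans (_ : `|k| * dot (x - y) (x - y) <= _).
    by rewrite ler_wpM2r ?dot_ge0 ?ler_norm.
  by rewrite ler_wpM2l ?dot_le_normr.
apply: le_lt_trans h1 _; rewrite mulrA.
apply: le_lt_trans (_ : (`|k| * n%:R + 1) * `|x - y| ^+ 2 < _).
  by rewrite ler_wpM2r ?sqr_ge0// lerDl.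
rewrite -[X in X * _]sqr_sqrtr; last by rewrite addr_ge0 // mulr_ge0.
rewrite -exprMn -/K; apply: ltrXn2r => //.
  by rewrite mulr_ge0 // ltW.
by rewrite mulrC; rewrite ltr_pdivlMr in xy.
Unshelve. all: by end_near. Qed.

Lemma continuous_proj : continuous (proj X).
Proof.
by apply: (@continuous_of_lipschitz _ 1) => x x'; rewrite mul1r proj_nonexpansive.
Qed.

End Projection.

(** * Taylor bounds for the objective *)

Section Differential.
Context {R : realType} {n p : nat}.
Implicit Types (z d : 'rV[R]_n * 'rV[R]_p).

Lemma row_pair_basis d : d = \sum_i d.1 0 i *: ((delta_mx 0 i, 0) : 'rV[R]_n * 'rV[R]_p) +
                        \sum_j d.2 0 j *: ((0, delta_mx 0 j) : 'rV[R]_n * 'rV[R]_p).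
Proof.
case: d => d1 d2 /=.
have fst_sum (I : finType) (g : I -> 'rV[R]_n * 'rV[R]_p) :
    (\sum_i g i).1 = \sum_i (g i).1 by apply: (big_morph fst).
have snd_sum (I : finType) (g : I -> 'rV[R]_n * 'rV[R]_p) :
    (\sum_i g i).2 = \sum_i (g i).2 by apply: (big_morph snd).
apply/eqP; rewrite xpair_eqE !fst_sum !snd_sum /=; apply/andP; split; apply/eqP.
  rewrite [X in _ + X]big1 ?addr0; last by move=> i _; rewrite scaler0.
  exact: row_sum_delta.
rewrite [X in X + _]big1 ?add0r; last by move=> i _; rewrite scaler0.
exact: row_sum_delta.
Qed.

Lemma diff_grad2 (F : 'rV[R]_n * 'rV[R]_p -> R^o) z d : differentiable F z ->
  'd F z d = dot (grad2 F z).1 d.1 + dot (grad2 F z).2 d.2.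
Proof.
move=> dF; rewrite {1}(row_pair_basis d) linearD !linear_sum.
congr (_ + _); apply: eq_bigr => i _; rewrite linearZ /= mxE mulrC;
  by rewrite deriveE.
Qed.

Lemma is_derive_line (F : 'rV[R]_n * 'rV[R]_p -> R^o) z d (t : R) :
  differentiable F (z + t *: d) ->
  is_derive t 1 (fun s : R => F (z + s *: d))
    (dot (grad2 F (z + t *: d)).1 d.1 + dot (grad2 F (z + t *: d)).2 d.2).
Proof.
move=> dF.
have dl : is_diff t (fun s : R => z + s *: d) (fun s => s *: d).
  rewrite -[X in is_diff _ _ X](add0r (fun s => s *: d)).
  exact: (@is_diffD _ _ _ (cst z) (fun s : R => s *: d)).
have dF' : is_diff (z + t *: d) F ('d F (z + t *: d)) by exact: differentiableP.
have dc := is_diff_comp dl dF'.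
apply: DeriveDef; first by apply/derivable1_diffP; case: dc.
rewrite deriveE; last by case: dc.
case: dc => dc ->; rewrite /= scale1r; exact: diff_grad2.
Qed.

End Differential.

Section Smoothness.
Context {R : realType} {n p : nat}.
Notation pt := ('rV[R]_n * 'rV[R]_p)%type.
Context {X : set 'rV[R]_n} {Y : set 'rV[R]_p}.
Context {dS : measure_display} {S : measurableType dS} {D : probability S R}.
Context {f : pt -> S -> R^o} {gradf : pt -> S -> pt} {L : R}.
Hypothesis SA : standing_assumptions X Y D f gradf L.
Implicit Types (x : 'rV[R]_n) (y : 'rV[R]_p) (z d : pt).

Let F : pt -> R := objective D f.
Let gx z := (grad2 (objective D f) z).1.
Let gy z := (grad2 (objective D f) z).2.

Let L0 : 0 < L. Proof. exact: L_gt0 SA. Qed.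

Ltac clra := clear -SA L0 gx gy; lra.

Lemma objective_differentiable z : (X `*` Y) z -> differentiable (objective D f) z.
Proof. by move=> zXY; case: (objective_C1 SA) => U [_ sU] /(_ z (sU _ zXY))[]. Qed.

Lemma grad_lipschitz_sqr z z' : (X `*` Y) z -> (X `*` Y) z' ->
  dot (gx z - gx z') (gx z - gx z') + dot (gy z - gy z') (gy z - gy z') <=
  L ^+ 2 * (dot (z.1 - z'.1) (z.1 - z'.1) + dot (z.2 - z'.2) (z.2 - z'.2)).
Proof.
move=> zXY z'XY; have := grad_lipschitz SA zXY z'XY; rewrite /enorm2 !enorm_sqr => H.
have nn (u : pt) : 0 <= dot u.1 u.1 + dot u.2 u.2 by rewrite addr_ge0 ?dot_ge0.
rewrite -(sqr_sqrtr (nn (grad2 F z - grad2 F z'))) -(sqr_sqrtr (nn (z - z'))).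
by rewrite -exprMn ler_pXn2r ?nnegrE ?mulr_ge0 ?sqrtr_ge0// ltW.
Qed.

Lemma product_segment z z' (t : R) : (X `*` Y) z -> (X `*` Y) z' -> 0 <= t <= 1 ->
  (X `*` Y) (z + t *: (z' - z)).
Proof.
move=> [Xz Yz] [Xz' Yz'] t01; split => /=.
  exact: (convex_segment (X_convex SA)).
exact: (convex_segment (Y_convex SA)).
Qed.

(** Mean value theorem for the restriction of e F to the segment, from which the
    linear part and the quadratic L q t^2 / 2 are subtracted: its derivative is
    nonpositive because the gradient is L-Lipschitz. The sign e gives the upper and
    the lower estimate by the same computation. *)
Lemma taylor_signed (e : R) z z' : (e = 1 \/ e = -1) -> (X `*` Y) z -> (X `*` Y) z' ->
  e * (F z' - F z - (dot (gx z) (z' - z).1 + dot (gy z) (z' - z).2)) <=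
  L / 2 * (dot (z' - z).1 (z' - z).1 + dot (z' - z).2 (z' - z).2).
Proof.
move=> e1 zXY z'XY; set d := z' - z.
set q := dot d.1 d.1 + dot d.2 d.2; set l := dot _ d.1 + dot _ d.2.
have q0 : 0 <= q by rewrite addr_ge0 ?dot_ge0.
pose psi (t : R) : R := e * F (z + t *: d) - (e * l) * t - (L / 2 * q) * t ^+ 2.
pose dpsi (t : R) : R := e * (dot (gx (z + t *: d)) d.1 + dot (gy (z + t *: d)) d.2)
   - (e * l) - L * q * t.
have ee : e * e = 1 by case: e1 => ->; rewrite ?mulr1// mulrNN mulr1.
have dp (t : R) : 0 <= t <= 1 -> is_derive t 1 psi (dpsi t).
  move=> t01.
  have dF := is_derive_line (objective_differentiable (product_segment zXY z'XY t01)).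
  rewrite -/F -/d in dF.
  have d2 : is_derive t 1 (fun s : R => s) 1 by exact: is_derive_id.
  rewrite /psi.
  apply: is_derive_eq.
  change (e * (dot (gx (z + t *: d)) d.1 + dot (gy (z + t *: d)) d.2)
    - e * l * 1 - L / 2 * q * (t * 1 + t * 1) = dpsi t).
  by rewrite /dpsi; absdot; move: (e * l) => el; clra.
have [c + Ec] : exists2 c : R, c \in `[0, 1]%R & psi 1 - psi 0 = dpsi c * (1 - 0).
  apply: MVT_segment => //.
    by move=> t; rewrite in_itv => /andP[t0 t1]; apply: dp; rewrite !ltW.
  apply: continuous_in_subspaceT => t; rewrite inE /= in_itv => /dp dt.
  by apply: differentiable_continuous; apply/derivable1_diffP; case: dt.
rewrite in_itv => c01; have c0 : 0 <= c by case/andP: c01.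
have dc : dpsi c <= 0.
  have := grad_lipschitz_sqr (product_segment zXY z'XY c01) zXY.
  rewrite -/d /= (addrC z.1) (addrC z.2) !addrK !dotZl !dotZr.
  set w := z + c *: d => lw.
  have lw' : dot (gx w - gx z) (gx w - gx z) + dot (gy w - gy z) (gy w - gy z) <= (L * c) ^+ 2 * q.
    by apply: (le_trans lw); rewrite /q /d /=; lra.
  have [c00|cn0] := eqVneq c 0.
    by rewrite /dpsi -/w /w c00 mulr0 scale0r addr0 -/l subrr subr0.
  have t0 : 0 < (2 * (L * c))^-1 by rewrite invr_gt0 !mulr_gt0// lt_def cn0.
  have h1 := young (gx w - gx z) (e *: d.1) t0.
  have h2 := young (gy w - gy z) (e *: d.2) t0.
  have : (2 * (L * c))^-1 * (dot (gx w - gx z) (gx w - gx z) + dot (gy w - gy z) (gy w - gy z))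
      <= (L * c) / 2 * q.
    have -> : L * c / 2 * q = (2 * (L * c))^-1 * ((L * c) ^+ 2 * q).
      by field; rewrite cn0 gt_eqF.
    by rewrite ler_pM2l.
  have E4 : (4 * (2 * (L * c))^-1)^-1 = L * c / 2 by field; rewrite cn0 gt_eqF.
  have s1 : dot (gx w - gx z) d.1 = dot (gx w) d.1 - dot (gx z) d.1.
    by rewrite dotDl dotNl.
  have s2 : dot (gy w - gy z) d.2 = dot (gy w) d.2 - dot (gy z) d.2.
    by rewrite dotDl dotNl.
  move: h1 h2; rewrite E4 /dpsi -/w /l !dotZl !dotZr s1 s2.
  rewrite !(mulrA e e) ee !mul1r.
  by rewrite /q; absdot; clra.
have : psi 1 <= psi 0 by rewrite -subr_le0 Ec subr0 mulr1.
rewrite /psi scale0r scale1r addr0 (addrC z d) subrK -/l expr0n expr1n /= mulr0 mulr1.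
have : forall a b qq ll : R, e * a - e * ll - L / 2 * qq * 1 <= e * b - 0 - L / 2 * qq * 0 ->
  e * (a - b - ll) <= L / 2 * qq by move=> a b qq ll; clear -SA L0 gx gy e; lra.
by apply.
Qed.

Lemma objective_lower z z' : (X `*` Y) z -> (X `*` Y) z' ->
  F z + dot (gx z) (z'.1 - z.1) + dot (gy z) (z'.2 - z.2)
    - L / 2 * (dot (z'.1 - z.1) (z'.1 - z.1) + dot (z'.2 - z.2) (z'.2 - z.2)) <= F z'.
Proof.
move=> zXY z'XY; have := taylor_signed (or_intror erefl) zXY z'XY => /=.
by absdot; move: (F z') (F z) => a b; clra.
Qed.

Lemma objective_upper z z' : (X `*` Y) z -> (X `*` Y) z' ->
  F z' <= F z + dot (gx z) (z'.1 - z.1) + dot (gy z) (z'.2 - z.2)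
    + L / 2 * (dot (z'.1 - z.1) (z'.1 - z.1) + dot (z'.2 - z.2) (z'.2 - z.2)).
Proof.
move=> zXY z'XY; have := taylor_signed (or_introl erefl) zXY z'XY => /=.
by absdot; move: (F z') (F z) => a b; clra.
Qed.

Lemma objective_weakly_convex x x' y : X x -> X x' -> Y y ->
  F (x, y) + dot (gx (x, y)) (x' - x) - L / 2 * dot (x' - x) (x' - x) <= F (x', y).
Proof.
move=> Xx Xx' Yy.
have := @objective_lower (x, y) (x', y) (conj Xx Yy) (conj Xx' Yy).
rewrite /= subrr !dot0r; absdot.
by move: (F (x, y)) (F (x', y)) => a b; clra.
Qed.

Lemma objective_concave_segment x y y' (t : R) : X x -> Y y -> Y y' -> 0 <= t <= 1 ->
  (1 - t) * F (x, y) + t * F (x, y') <= F (x, y + t *: (y' - y)).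
Proof.
move=> Xx Yy Yy' /andP[t0 t1].
have := objective_concave SA Xx (Itv01 t0 t1); move/(_ y' y); rewrite !inE.
move=> /(_ Yy' Yy).
have -> : y + t *: (y' - y) = t *: y' + (1 - t) *: y.
  by rewrite scalerBl scale1r scalerBr addrCA.
rewrite convRE /= => H; rewrite -lerN2; apply: le_trans H _.
by rewrite le_eqVlt; apply/orP; left; apply/eqP; rewrite -/F; move: (F _) (F _) => a b; rewrite /unstable.onem; ring.
Qed.

(** Concavity only along chords; the tangent inequality follows by letting the
    chord shrink, with the Taylor bound controlling the remainder. *)
Lemma objective_concave_grad x y y' : X x -> Y y -> Y y' ->
  F (x, y') <= F (x, y) + dot (gy (x, y)) (y' - y).
Proof.
move=> Xx Yy Yy'.
apply: (@le_of_slack _ _ _ (L / 2 * dot (y' - y) (y' - y))) => t t0 t1.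
have t01 : 0 <= t <= 1 by rewrite !ltW.
have h := objective_concave_segment Xx Yy Yy' t01.
have Yt := convex_segment (Y_convex SA) Yy Yy' t01.
have := @objective_upper (x, y) (x, y + t *: (y' - y)) (conj Xx Yy) (conj Xx Yt).
rewrite /= subrr !dot0r (addrC y) addrK !dotZr !dotZl => h2.
rewrite -(ler_pM2l t0); rewrite (addrC y) in h.
move: h h2; absdot; move: (F _) (F _) (F _) => a b c; clra.
Qed.

End Smoothness.

(** * Saddle points of the proximal problem and the Moreau envelope *)

Lemma strongly_convex_of_grad {R : realType} m (X : set 'rV[R]_m) (g : 'rV[R]_m -> R)
    (dg : 'rV[R]_m -> 'rV[R]_m) (mu : R) : convex_set X ->
  (forall x x', X x -> X x' ->
     g x + dot (dg x) (x' - x) + mu / 2 * dot (x' - x) (x' - x) <= g x') ->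
  strongly_convex X g mu.
Proof.
move=> cX H x x' t Xx Xx' t01; have Xm := convex_segment cX Xx Xx' t01.
have := H _ _ Xm Xx; have := H _ _ Xm Xx'.
set d := x' - x; set w := x + t *: d.
have -> : x - w = - t *: d by rewrite /w opprD addrA subrr add0r scaleNr.
have -> : x' - w = (1 - t) *: d.
  by rewrite /w opprD addrA -/d scalerBl scale1r.
rewrite !dotZl !dotZr; move: (g w) (g x) (g x') => a b c.
absdot; case/andP: t01 => t0 t1 h1 h2.
have e1 : 0 <= 1 - t by rewrite subr_ge0.
have := ler_wpM2l t0 h1; have := ler_wpM2l e1 h2; clear -R; lra.
Qed.

Lemma continuous_comp_pair {R : realType} {n p : nat} (T : topologicalType)
    (a : T -> 'rV[R]_n) (b : T -> 'rV[R]_p) (G : 'rV[R]_n * 'rV[R]_p -> R) (t : T) :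
  {for t, continuous a} -> {for t, continuous b} -> {for (a t, b t), continuous G} ->
  {for t, continuous (fun s => G (a s, b s))}.
Proof.
move=> ca cb cG.
apply: (@cvg_comp _ _ _ (fun s => (a s, b s)) G (nbhs t) (nbhs (a t, b t))) => //.
exact: (cvg_pair ca cb).
Qed.

Section Saddle.
Context {R : realType} {n p : nat}.
Notation pt := ('rV[R]_n * 'rV[R]_p)%type.
Implicit Types (x : 'rV[R]_n) (y : 'rV[R]_p).

(** What the deterministic part of the argument uses of the objective. *)
Record smooth_saddle (X : set 'rV[R]_n) (Y : set 'rV[R]_p) (L : R)
    (F : pt -> R) (gx : pt -> 'rV[R]_n) (gy : pt -> 'rV[R]_p) : Prop := SmoothSaddle {
  ss_X0 : X !=set0; ss_clX : closed X; ss_cvX : convex_set X;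
  ss_Y0 : Y !=set0; ss_cpY : compact Y; ss_cvY : convex_set Y;
  ss_L0 : 0 < L;
  ss_cont : forall x y, X x -> Y y -> {for (x, y), continuous F};
  ss_lower : forall x x' y, X x -> X x' -> Y y ->
    F (x, y) + dot (gx (x, y)) (x' - x) - L / 2 * dot (x' - x) (x' - x) <= F (x', y);
  ss_upper : forall x x' y, X x -> X x' -> Y y ->
    F (x', y) <= F (x, y) + dot (gx (x, y)) (x' - x) + L / 2 * dot (x' - x) (x' - x);
  ss_concave : forall x y y', X x -> Y y -> Y y' ->
    F (x, y') <= F (x, y) + dot (gy (x, y)) (y' - y);
  ss_lip : forall x y x' y', X x -> Y y -> X x' -> Y y' ->
    dot (gx (x, y) - gx (x', y')) (gx (x, y) - gx (x', y'))
     + dot (gy (x, y) - gy (x', y')) (gy (x, y) - gy (x', y')) <=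
    L ^+ 2 * (dot (x - x') (x - x') + dot (y - y') (y - y'))
}.

Context (X : set 'rV[R]_n) (Y : set 'rV[R]_p) (L : R).
Context (F : pt -> R) (gx : pt -> 'rV[R]_n) (gy : pt -> 'rV[R]_p).
Hypothesis SS : smooth_saddle X Y L F gx gy.
Variable (tau : R).
Hypothesis tau0 : 0 <= tau.

(** The proximal term 2 (L/2) |x - z|^2 turns L-weak convexity in x into L-strong
    convexity; tau regularizes the concave side. *)
Definition Phi (z x : 'rV[R]_n) (y : 'rV[R]_p) : R :=
  F (x, y) - tau / 2 * dot y y + L * dot (x - z) (x - z).

Let L0 : 0 < L := ss_L0 SS.
Let clY : closed Y.
Proof. by apply: compact_closed (ss_cpY SS); exact: norm_hausdorff. Qed.

Ltac clra := clear -SS tau0 L0 clY; lra.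

Lemma Phi_lower z x x' y : X x -> X x' -> Y y ->
  Phi z x y + dot (gx (x, y) + (2 * L) *: (x - z)) (x' - x)
    + L / 2 * dot (x' - x) (x' - x) <= Phi z x' y.
Proof.
move=> Xx Xx' Yy; have := ss_lower SS Xx Xx' Yy.
rewrite /Phi; move: (gx _) (F _) (F _) => g a b.
rewrite !dotE (dotC x' x) (dotC z x') (dotC z x); absdot; clra.
Qed.

Lemma Phi_upper z x x' y : X x -> X x' -> Y y ->
  Phi z x' y <= Phi z x y + dot (gx (x, y) + (2 * L) *: (x - z)) (x' - x)
    + (2 * L) * dot (x' - x) (x' - x).
Proof.
move=> Xx Xx' Yy; have := ss_upper SS Xx Xx' Yy.
have := mulr_ge0 (ltW L0) (dot_ge0 (x' - x)).
rewrite /Phi; move: (gx _) (F _) (F _) => g a b.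
rewrite !dotE (dotC x' x) (dotC z x') (dotC z x); absdot; clra.
Qed.

Lemma Phi_concave z x y y' : X x -> Y y -> Y y' ->
  Phi z x y' <= Phi z x y + dot (gy (x, y) - tau *: y) (y' - y)
    - tau / 2 * dot (y' - y) (y' - y).
Proof.
move=> Xx Yy Yy'; have := ss_concave SS Xx Yy Yy'.
rewrite /Phi; move: (gy _) (F _) (F _) => g a b.
rewrite !dotE (dotC y' y); absdot; clra.
Qed.

Lemma Phi_strongly_convex z y : Y y -> strongly_convex X (fun x => Phi z x y) L.
Proof.
move=> Yy; apply: (@strongly_convex_of_grad _ _ _ _
   (fun x => gx (x, y) + (2 * L) *: (x - z)) _ (ss_cvX SS)).
by move=> x x' Xx Xx'; exact: Phi_lower.
Qed.

Lemma Phi_strongly_concave z x : X x -> strongly_convex Y (fun y => - Phi z x y) tau.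
Proof.
move=> Xx; apply: (@strongly_convex_of_grad _ _ _ _
   (fun y => - (gy (x, y) - tau *: y)) _ (ss_cvY SS)).
move=> y y' Yy Yy'; have := Phi_concave z Xx Yy Yy'.
by rewrite dotNl; absdot; move: (Phi _ _ _) (Phi _ _ _) => a b; clra.
Qed.

Lemma continuous_Phi z x y : X x -> Y y ->
  {for (x, y), continuous (fun w : pt => Phi z w.1 w.2)}.
Proof.
move=> Xx Yy; rewrite /Phi.
have c1 : {for (x, y), continuous (fun w : pt => w.1)} by exact: cvg_fst.
have c2 : {for (x, y), continuous (fun w : pt => w.2)} by exact: cvg_snd.
have c1z : {for (x, y), continuous (fun w : pt => w.1 - z)}.
  by apply: (@cvgB _ _ _ (nbhs (x, y)) _ (fun w : pt => w.1) (cst z)) => //; exact: cvg_cst.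
apply: cvgD; last by apply: cvgMr; exact: (continuous_dot c1z c1z).
apply: cvgB; last by apply: cvgMr; exact: (continuous_dot c2 c2).
rewrite (_ : (fun w : pt => F (w.1, w.2)) = F); last by apply/funext => -[].
exact: (ss_cont SS).
Qed.

Lemma inner_argmin z y : Y y -> exists2 m, X m & forall x, X x -> Phi z m y <= Phi z x y.
Proof.
move=> Yy; have [x1 Xx1] := ss_X0 SS.
set w := gx (x1, y) + (2 * L) *: (x1 - z).
apply: (@argmin_exists _ _ X (fun x => Phi z x y) (Phi z x1 y - dot w w / L) (L / 4) x1).
- exact: ss_X0 SS.
- exact: ss_clX SS.
- apply: continuous_in_subspaceT => x; rewrite inE => Xx.
  apply: (@continuous_comp_pair _ _ _ _ id (cst y) (fun w => Phi z w.1 w.2)).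
  - exact: (@cvg_id _ (nbhs x)).
  - exact: (@cvg_cst _ y _ (nbhs x)).
  - exact: continuous_Phi.
- by rewrite divr_gt0.
- move=> x Xx; have := Phi_lower z Xx1 Xx Yy; rewrite -/w.
  have t0 : 0 < L^-1 by rewrite invr_gt0.
  have := youngN w (x - x1) t0; rewrite invfM invrK.
  rewrite (mulrC L^-1); absdot; move: (Phi _ _ _) (Phi _ _ _) => a b; clra.
Qed.

Lemma inner_argmin_optimal z y m x : Y y -> X m ->
  (forall x, X x -> Phi z m y <= Phi z x y) -> X x ->
  0 <= dot (gx (m, y) + (2 * L) *: (m - z)) (x - m).
Proof.
move=> Yy Xm mm Xx.
apply: (@le_of_slack _ _ _ (2 * L * dot (x - m) (x - m))) => t t0 t1.
have t01 : 0 <= t <= 1 by rewrite !ltW.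
have Xt := convex_segment (ss_cvX SS) Xm Xx t01.
have := le_trans (mm _ Xt) (Phi_upper z Xm Xt Yy).
have -> : m + t *: (x - m) - m = t *: (x - m) by rewrite addrC addKr.
rewrite !dotZr !dotZl => H.
by rewrite -(ler_pM2l t0) mulr0; move: H; absdot; move: (Phi _ _ _) => a; clra.
Qed.

(** Adding the two growth inequalities and the two optimality conditions leaves
    L |m - m'|^2 against the change of the x-gradient with y, which is at most
    L |y - y'|; Young's inequality with the remaining weight L closes. *)
Lemma inner_argmin_lipschitz z y y' m m' : Y y -> Y y' -> X m -> X m' ->
  (forall x, X x -> Phi z m y <= Phi z x y) ->
  (forall x, X x -> Phi z m' y' <= Phi z x y') ->
  dot (m - m') (m - m') <= dot (y - y') (y - y').
Proof.
move=> Yy Yy' Xm Xm' mm mm'.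
have h1 := inner_argmin_optimal Yy Xm mm Xm'.
have h2 := inner_argmin_optimal Yy' Xm' mm' Xm.
have h3 := Phi_lower z Xm Xm' Yy; have h4 := Phi_lower z Xm' Xm Yy.
have h5 := ss_lip SS Xm' Yy Xm' Yy'; rewrite subrr dot0l add0r in h5.
have h6 := dot_ge0 (gy (m', y) - gy (m', y')).
have t0 : 0 < (2 * L)^-1 by rewrite invr_gt0 mulr_gt0.
have h7 := young (gx (m', y) - gx (m', y')) (m' - m) t0.
have E : (4 / (2 * L))^-1 = L / 2 by field; rewrite gt_eqF.
rewrite E in h7.
suff : L * dot (m - m') (m - m') <= L * dot (y - y') (y - y') by rewrite ler_pM2l.
have := mulr_ge0 (ltW t0) h6.
have := ler_wpM2l (ltW t0) h5.
have -> : (2 * L)^-1 * (L ^+ 2 * dot (y - y') (y - y')) = L / 2 * dot (y - y') (y - y').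
  by field; rewrite gt_eqF.
rewrite mulrDr; move: h1 h2 h3 h4 h7; move: (gx (m, y)) (gx (m', y)) (gx (m', y')) => a b c.
set k1 := dot (gy (m', y) - _) _; set k2 := dot (b - c) (b - c); set k3 := dot (y - y') _.
clearbody k1 k2 k3.
rewrite !dotE (dotC m' m) (dotC z m') (dotC z m); absdot.
move: (Phi _ _ _) (Phi _ _ _) => e1 e2; move: (2 * L)^-1 => i; clra.
Qed.

Definition is_saddle z (w : pt) :=
  [/\ X w.1, Y w.2,
      forall x, X x -> Phi z w.1 w.2 + L / 2 * dot (x - w.1) (x - w.1) <= Phi z x w.2 &
      forall y, Y y -> Phi z w.1 y <= Phi z w.1 w.2 - tau / 2 * dot (y - w.2) (y - w.2)].

(** Maximize over Y the continuous function y -> min over x of Phi z x y; its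
    minimizer in x depends continuously on y. At the maximizer ys, the concave
    function Phi z (xh ys) is maximal too: on the segment towards y the inner
    minimizer moves by order t only, so the comparison made at the inner minimizer
    of the moved point survives in the limit t -> 0. *)
Lemma saddle_exists z : exists w, is_saddle z w.
Proof.
have /boolp.choice[xh xhP] : forall y, exists m, Y y ->
    X m /\ forall x, X x -> Phi z m y <= Phi z x y.
  move=> y; have [Yy|nYy] := pselect (Y y); last by exists 0.
  by have [m Xm mm] := inner_argmin z Yy; exists m.
pose q y := proj Y y; have Yq y : Y (q y) by exact: proj_in (ss_Y0 SS) clY (ss_cvY SS) y.
have cq : continuous q by exact: continuous_proj (ss_Y0 SS) clY (ss_cvY SS).
have cxh : continuous (xh \o q).
  apply: (@continuous_of_lipschitz _ _ _ 1) => y y'; rewrite mul1r.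
  apply: le_trans (proj_nonexpansive (ss_Y0 SS) clY (ss_cvY SS) y y').
  have [X1 m1] := xhP _ (Yq y); have [X2 m2] := xhP _ (Yq y').
  exact: (inner_argmin_lipschitz (Yq y) (Yq y') X1 X2 m1 m2).
have cg : continuous (fun y => Phi z (xh (q y)) (q y)).
  move=> y; have [X1 _] := xhP _ (Yq y).
  apply: (@continuous_comp_pair _ _ _ _ (xh \o q) q (fun w => Phi z w.1 w.2)).
  - exact: cxh.
  - exact: cq.
  - exact: continuous_Phi.
have [ys] := EVT_max_rV (ss_Y0 SS) (ss_cpY SS) (continuous_subspaceT cg).
rewrite inE => Yys mys.
have qid y : Y y -> q y = y by move=> Yy; apply: proj_id (ss_Y0 SS) clY (ss_cvY SS) _ Yy.
have {}mys y : Y y -> Phi z (xh y) y <= Phi z (xh ys) ys.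
  by move=> Yy; have := mys y; rewrite inE !qid//; exact.
have [Xs ms] := xhP _ Yys.
exists (xh ys, ys); split => //=.
  move=> x Xx.
  exact: (argmin_growth (ss_cvX SS) (Phi_strongly_convex z Yys) Xs ms Xx).
have ymax y : Y y -> Phi z (xh ys) y <= Phi z (xh ys) ys.
  move=> Yy; set g := gx (xh ys, y) + (2 * L) *: (xh ys - z).
  apply: (@le_of_slack _ _ _ (enorm g * enorm (y - ys))) => t t0 t1.
  have t01 : 0 <= t <= 1 by rewrite !ltW.
  have Yt := convex_segment (ss_cvY SS) Yys Yy t01.
  set yt := ys + t *: (y - ys) in Yt *; have [Xt mt] := xhP _ Yt.
  have h1 := Phi_strongly_concave z Xt Yys Yy t01; rewrite -/yt /= in h1.
  have h2 := xhP _ Yys; have h3 := h2.2 _ Xt; have h4 := mys _ Yt.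
  have h5 : Phi z (xh yt) y <= Phi z (xh ys) ys.
    have n0 : 0 <= tau / 2 * (t * (1 - t)) * dot (y - ys) (y - ys).
      by rewrite !mulr_ge0 ?dot_ge0 ?invr_ge0 ?subr_ge0 // ltW.
    have e1 : 0 <= 1 - t by rewrite subr_ge0 ltW.
    suff : t * Phi z (xh yt) y <= t * Phi z (xh ys) ys by rewrite ler_pM2l.
    have := ler_wpM2l e1 h3.
    move: h1 h3 h4 n0; move: (tau / 2 * _ * _) => n0.
    move: (Phi _ _ _) (Phi _ _ _) (Phi _ _ _) (Phi _ _ _) => a b c d; clra.
  have h6 := Phi_lower z Xs Xt Yy; rewrite -/g in h6.
  have h7 : - dot g (xh yt - xh ys) <= t * (enorm g * enorm (y - ys)).
    rewrite -dotNr mulrCA; apply: le_trans (CauchySchwarz _ _) _.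
    rewrite ler_wpM2l ?enorm_ge0// enormN; apply: enorm_le_sqrt.
      by rewrite mulr_ge0 ?enorm_ge0// ltW.
    apply: le_trans (inner_argmin_lipschitz Yt Yys Xt Xs mt ms) _.
    by rewrite /yt (addrC ys) addrK dotZl dotZr exprMn enorm_sqr expr2 mulrA.
  have h8 := mulr_ge0 (ltW L0) (dot_ge0 (xh yt - xh ys)).
  move: h5 h6 h7 h8; absdot; move: (Phi _ _ _) (Phi _ _ _) (Phi _ _ _) => a b c.
  move: (_ * (_ * _)) => e; clra.
move=> y Yy.
have mn y' : Y y' -> - Phi z (xh ys) ys <= - Phi z (xh ys) y'.
  by rewrite lerN2; exact: ymax.
have := argmin_growth (ss_cvY SS) (Phi_strongly_concave z Xs) Yys mn Yy.
by move: (Phi _ _ _) (Phi _ _ _) => a b; absdot; clra.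
Qed.

(** Each saddle point is tested against the other one: the values of F cancel in
    the sum of the four inequalities and only the proximal terms see z' - z. *)
Lemma saddle_stable z z' w w' : is_saddle z w -> is_saddle z' w' ->
  L * dot (w'.1 - w.1) (w'.1 - w.1) + tau * dot (w'.2 - w.2) (w'.2 - w.2) <=
  2 * L * dot (z' - z) (w'.1 - w.1).
Proof.
case: w w' => x y [x' y'] [/= Xx Yy h1 h2] [/= Xx' Yy' h3 h4].
move: (h1 _ Xx') (h2 _ Yy') (h3 _ Xx) (h4 _ Yy); rewrite /Phi.
move: (F _) (F _) (F _) (F _) => a b c d.
rewrite !dotE (dotC z' x) (dotC z' x') (dotC z x') (dotC z x) (dotC x' x) (dotC y' y).
by absdot; clra.
Qed.

Lemma saddle_stable_x z z' w w' : is_saddle z w -> is_saddle z' w' ->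
  dot (w'.1 - w.1) (w'.1 - w.1) <= 4 * dot (z' - z) (z' - z).
Proof.
move=> sw sw'; have h := saddle_stable sw sw'.
have h2 : dot (w'.1 - w.1) (w'.1 - w.1) <= 2 * dot (z' - z) (w'.1 - w.1).
  rewrite -(ler_pM2l L0).
  have := mulr_ge0 tau0 (dot_ge0 (w'.2 - w.2)).
  by move: h; absdot; clra.
have h3 := @young _ _ 1 (z' - z) (w'.1 - w.1) ltr01.
rewrite mulr1 in h3; move: h2 h3; absdot; clra.
Qed.

Lemma saddle_stable_y z z' w w' : is_saddle z w -> is_saddle z' w' ->
  tau * dot (w'.2 - w.2) (w'.2 - w.2) <= L * dot (z' - z) (z' - z).
Proof.
move=> sw sw'; have h := saddle_stable sw sw'.
have := mulr_ge0 (ltW L0) (dot_ge0 (z' - z - (w'.1 - w.1))).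
move: h; move: (z' - z) (w'.1 - w.1) => a b; rewrite !dotE (dotC b a).
by absdot; clra.
Qed.

(** Upper bound for the value at z': test its minimization with the old x and the
    old maximization with the new y. *)
Lemma saddle_value_drift z z' w w' : is_saddle z w -> is_saddle z' w' ->
  Phi z' w'.1 w'.2 <= Phi z w.1 w.2
    + L * (dot (w.1 - z') (w.1 - z') - dot (w.1 - z) (w.1 - z)).
Proof.
case: w w' => x y [x' y'] [/= Xx Yy h1 h2] [/= Xx' Yy' h3 h4].
have h5 := h3 _ Xx; have h6 := h2 _ Yy'.
have h7 := mulr_ge0 (ltW L0) (dot_ge0 (x - x')).
have h8 := mulr_ge0 tau0 (dot_ge0 (y' - y)).
move: h5 h6 h7 h8; rewrite /Phi; move: (F _) (F _) (F _) => a b c.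
by absdot; clra.
Qed.

End Saddle.

Section Regularization.
Context {R : realType} {n p : nat}.
Notation pt := ('rV[R]_n * 'rV[R]_p)%type.
Context (X : set 'rV[R]_n) (Y : set 'rV[R]_p) (L : R).
Context (F : pt -> R) (gx : pt -> 'rV[R]_n) (gy : pt -> 'rV[R]_p).
Hypothesis SS : smooth_saddle X Y L F gx gy.

Let L0 : 0 < L := ss_L0 SS.

(** The four saddle inequalities, two for each regularization, leave only the
    regularizer on the right: its oscillation over Y bounds the displacement. *)
Lemma saddle_bias (tau DD : R) z w w0 : 0 <= tau ->
  (forall y, Y y -> dot y y <= DD) ->
  is_saddle X Y L F tau z w -> is_saddle X Y L F 0 z w0 ->
  2 * L * dot (w.1 - w0.1) (w.1 - w0.1) <= tau * DD.
Proof.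
case: w w0 => x y [x0 y0] tau0 yD [/= Xx Yy h1 h2] [/= Xx0 Yy0 h3 h4].
have h5 := ler_wpM2l tau0 (yD _ Yy0).
have h6 := mulr_ge0 tau0 (dot_ge0 y); have h7 := mulr_ge0 tau0 (dot_ge0 (y0 - y)).
move: (h1 _ Xx0) (h2 _ Yy0) (h3 _ Xx) (h4 _ Yy); rewrite /Phi.
move: (F _) (F _) (F _) (F _) => a b c d.
rewrite !dotE (dotC x0 x) (dotC x0 z) (dotC z x).
move: h5 h6 h7; rewrite !dotE; absdot; clear -SS L0; lra.
Qed.

Context (phi : 'rV[R]_n -> R).
Hypothesis phi_ub : forall x y, X x -> Y y -> F (x, y) <= phi x.
Hypothesis phi_lub : forall x c, X x -> (forall y, Y y -> F (x, y) <= c) -> phi x <= c.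

Definition envelope (z : 'rV[R]_n) : R^o := inf [set phi x + L * dot (x - z) (x - z) | x in X].

Lemma envelopeE z w0 : is_saddle X Y L F 0 z w0 ->
  envelope z = Phi L F 0 z w0.1 w0.2.
Proof.
case: w0 => x0 y0 [/= Xx0 Yy0 h1 h2].
have E : phi x0 + L * dot (x0 - z) (x0 - z) <= Phi L F 0 z x0 y0.
  rewrite -lerBrDr; apply: phi_lub => // y Yy; have := h2 _ Yy; rewrite /Phi.
  by move: (F _) (F _) => a b; absdot; clear -SS L0; lra.
have lb x : X x -> Phi L F 0 z x0 y0 <= phi x + L * dot (x - z) (x - z).
  move=> Xx; have := h1 _ Xx; have := phi_ub Xx Yy0.
  have := mulr_ge0 (ltW L0) (dot_ge0 (x - x0)).
  by rewrite /Phi; move: (F _) (F _) (phi x) => a b c; absdot; clear -SS L0; lra.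
apply/eqP; rewrite eq_le; apply/andP; split.
  apply: le_trans E; apply: ge_inf; last by exists x0.
  by exists (Phi L F 0 z x0 y0) => _ [x Xx <-]; exact: lb.
apply: lb_le_inf; first by exists (phi x0 + L * dot (x0 - z) (x0 - z)); exists x0.
by move=> _ [x Xx <-]; exact: lb.
Qed.

(** The value drift from z to z + h e and back gives both one-sided bounds; the
    difference of the two is of order h^2 because the minimizer is Lipschitz. *)
Lemma envelope_expansion z e w0 (h : R) : is_saddle X Y L F 0 z w0 ->
  `|envelope (z + h *: e) - envelope z - h * (2 * L * dot (z - w0.1) e)|
  <= 5 * L * dot e e * h ^+ 2.
Proof.
move=> s0; have [w sw] := saddle_exists SS (lexx 0) (z + h *: e).
rewrite (envelopeE s0) (envelopeE sw).
have h1 := saddle_value_drift SS (lexx 0) s0 sw.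
have h2 := saddle_value_drift SS (lexx 0) sw s0.
have h3 := saddle_stable_x SS (lexx 0) s0 sw.
rewrite (addrC z) addrK in h3.
have h4 := young (h *: e) (w.1 - w0.1) ltr01; rewrite mulr1 in h4.
have h5 := ler_wpM2l (ltW L0) h4; have h6 := ler_wpM2l (ltW L0) h3.
have h7 := mulr_ge0 (ltW L0) (mulr_ge0 (sqr_ge0 h) (dot_ge0 e)).
rewrite ler_norml; move: h1 h2 h5 h6 h7; move: (Phi _ _ _ _ _ _) (Phi _ _ _ _ _ _) => a b.
rewrite !dotE !(dotC z w.1) !(dotC z w0.1) !(dotC e z) !(dotC e w.1) !(dotC e w0.1).
rewrite !(dotC w0.1 w.1).
by absdot => k1 k2 k3 k4 k5; apply/andP; split; clear -SS L0 k1 k2 k3 k4 k5; lra.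
Qed.

Lemma derive_envelope z e w0 : is_saddle X Y L F 0 z w0 ->
  'D_e envelope z = 2 * L * dot (z - w0.1) e.
Proof.
move=> s0; set l := 2 * L * _; rewrite /derive; apply: cvg_lim => //.
apply/cvgrPdist_le => eps eps0.
set K := 5 * L * dot e e + 1.
have K0 : 0 < K by rewrite ltr_wpDl // !mulr_ge0 ?dot_ge0// ltW.
near=> h.
have h0 : h != 0 by near: h; exact: nbhs_dnbhs_neq.
have hK : `|h| <= eps / K.
  near: h; apply: dnbhs0_le; exact: divr_gt0.
rewrite -(ler_pM2l (_ : 0 < `|h|)) ?normr_gt0//.
have -> : `|h| * `|l - h^-1 *: ((envelope \o shift z) (h *: e) - envelope z)| =
   `|envelope (z + h *: e) - envelope z - h * l|.
  set A : R := (envelope \o shift z) (h *: e) - envelope z.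
  change (h^-1 *: A) with (h^-1 * A).
  have -> : envelope (z + h *: e) - envelope z = A by rewrite /A /= (addrC z).
  by rewrite -normrM [RHS]distrC; congr (`|_|); field.
apply: le_trans (envelope_expansion e h s0) _.
rewrite -(real_normK (num_real h)) expr2 (mulrC `|h| eps) mulrA ler_wpM2r //.
have : (5 * L * dot e e) * `|h| <= K * `|h|.
  by rewrite ler_wpM2r // /K lerDl.
move=> /le_trans; apply; rewrite mulrC -ler_pdivlMr //.
Unshelve. all: by end_near. Qed.

End Regularization.

(** * Energy balance of one iteration *)

Section WeightedYoung.
Context {R : realType} {n : nat}.
Implicit Types (u v : 'rV[R]_n).

(** A cross term of weight w <= W, split against the weight W. The split parameter
    is an integer so that linear arithmetic gets numerals as coefficients. *)
Lemma wyoung (w W : R) (q : nat) u v : 0 <= w -> w <= W ->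
  w * dot u v <= W * (q.+1%:R^-1 * dot u u + q.+1%:R / 4 * dot v v).
Proof.
move=> w0 wW; have t0 : 0 < (q.+1%:R)^-1 :> R by rewrite invr_gt0.
have E : (4 * q.+1%:R^-1)^-1 = q.+1%:R / 4 :> R by rewrite invfM invrK mulrC.
apply: le_trans (_ : w * (q.+1%:R^-1 * dot u u + q.+1%:R / 4 * dot v v) <= _).
  by rewrite ler_wpM2l // -E young.
by rewrite ler_wpM2r // addr_ge0 // mulr_ge0 ?dot_ge0 ?divr_ge0 ?(ltW t0).
Qed.

Lemma wyoungN (w W : R) (q : nat) u v : 0 <= w -> w <= W ->
  - (w * dot u v) <= W * (q.+1%:R^-1 * dot u u + q.+1%:R / 4 * dot v v).
Proof.
by move=> w0 wW; have := wyoung q u (- v) w0 wW; rewrite !dotE mulrN opprK.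
Qed.

End WeightedYoung.

Section Energy.
Context {R : realType} {n p : nat}.
Implicit Types (r : 'rV[R]_n) (g v y : 'rV[R]_p).

(** With r and g the primal and dual residuals and v the momentum, this is
    |r|^2/2 + |g|^2/2 + <g, v>, written with the square of g + v because the dual
    variable moves along g + v up to errors. *)
Definition kinetic r g v : R :=
  2^-1 * dot r r + 2^-1 * dot (g + v) (g + v) - 2^-1 * dot v v.

(** y stands for the dual distance to the saddle point and P for the value gap. *)
Definition energy (L a : R) r g v y (P : R) : R :=
  kinetic r g v + 3 / 4 * dot (v + (a / 2) *: y) (v + (a / 2) *: y)
  + 3 / 4 * (L - a) * P.

(** The identity |r1|^2 - |r0|^2 = 2 <rh, r1 - r0> + |r1 - rh|^2 - |r0 - rh|^2,
    and its dual analogue, make the monotonicity term m and the negative squares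
    of an extragradient step appear; s is the mismatch of the dual step. *)
Lemma kinetic_step (r0 rh r1 dx : 'rV[R]_n) g0 g1 v0 v1 (s wh : 'rV[R]_p) (m : R) :
  dot rh (r1 - r0) + dot wh (g1 - g0) <= m ->
  r1 = rh + dx -> wh = g1 + v1 + s ->
  kinetic r1 g1 v1 <= kinetic r0 g0 v0 + m + 2^-1 * dot dx dx
    + dot s s + dot (v1 - v0) (v1 - v0)
    - 2^-1 * (dot (r0 - rh) (r0 - rh) + dot (g0 + v0 - wh) (g0 + v0 - wh))
    + dot g1 (v1 - v0).
Proof.
move=> hm e1 e2; subst r1 wh; have := dot_ge0 (s - (v1 - v0)).
move: hm; rewrite /kinetic !dotE.
rewrite !(dotC dx rh) !(dotC r0 rh).
rewrite !(dotC g1 g0) !(dotC v0 g0) !(dotC v0 g1) !(dotC v1 g0) !(dotC v1 g1) !(dotC v1 v0).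
rewrite !(dotC s g0) !(dotC s g1) !(dotC s v0) !(dotC s v1).
absdot; clear; lra.
Qed.

Lemma square_step (u0 u1 w : 'rV[R]_p) (h : R) : u1 - u0 = h *: w ->
  2^-1 * dot u1 u1 <= 2^-1 * dot u0 u0 + h * dot u1 w.
Proof.
move=> hw; have -> : u0 = u1 - h *: w by rewrite -hw opprB addrCA subrr addr0.
have := mulr_ge0 (sqr_ge0 h) (dot_ge0 w).
rewrite !dotE !(dotC w u1); absdot; clear; lra.
Qed.

Lemma dot_triple_le (u v w : 'rV[R]_p) :
  dot (u + v + w) (u + v + w) <= 3 * (dot u u + dot v v + dot w w).
Proof.
have := dot_ge0 (u - v); have := dot_ge0 (v - w); have := dot_ge0 (u - w).
by rewrite !dotE !(dotC v u) !(dotC w u) !(dotC w v); absdot; clear; lra.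
Qed.

Lemma mixed_error_le (s e1y dy e2 : 'rV[R]_p) (k : R) : 0 <= k -> k <= 384^-1 ->
  s = (1 + k) *: (e1y - dy) - k *: e2 ->
  dot s s <= 23 / 10 * (dot e1y e1y + dot dy dy) + 50^-1 * dot e2 e2.
Proof.
move=> k0 k1 hs.
  have h1 := young ((1 + k) *: (e1y - dy)) (- (k *: e2)) (_ : 0 < 20^-1).
  have h2 := dot_sub_le e1y dy.
  have h3 : (1 + k) * ((1 + k) * dot (e1y - dy) (e1y - dy)) <= 102 / 100 * dot (e1y - dy) (e1y - dy).
    by rewrite mulrA ler_wpM2r ?dot_ge0//; move: k0 k1; clear; nra.
  have h4 : k * (k * dot e2 e2) <= 1000^-1 * dot e2 e2.
    by rewrite mulrA ler_wpM2r ?dot_ge0//; move: k0 k1; clear; nra.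
  have h5 := dot_ge0 e2; have := h1 (ltac:(by rewrite invr_gt0)).
  have -> : dot s s = dot ((1 + k) *: (e1y - dy)) ((1 + k) *: (e1y - dy)) +
     2 * dot ((1 + k) *: (e1y - dy)) (- (k *: e2)) + dot (- (k *: e2)) (- (k *: e2)).
    rewrite hs; move: (e1y - dy) => q; rewrite !dotE (dotC e2 q); absdot; clear; lra.
  move: (dot_ge0 e1y) (dot_ge0 dy) h2 h3 h4 h5; move: (e1y - dy) => q; rewrite !(dotNl, dotNr, dotZl, dotZr).
  have -> : (4 * 20^-1)^-1 = 5 :> R by field.
  by absdot; clear; lra.
Qed.

(** Balance of one step with a fixed center. rh and wh are the vectors actually
    used for the primal and dual moves, and dx, dy are the changes of the
    gradient field between the extrapolated and the new point, which the negative
    squares of the extragradient step absorb. The momentum update is chosen so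
    that the terms in <g1, v1> cancel up to order h a, and the gap P decreases
    along the same vectors; the relation a^2 = L tau / 128 balances
    the dissipation of v against that of the dual distance. *)
Lemma energy_step (r0 rh r1 dx e1x e0x X : 'rV[R]_n)
    (g0 g1 v0 v1 s wh dy e1y e2 e0y Y0 Y1 : 'rV[R]_p) (P0 P1 L tau a h k : R) :
  0 < L -> 0 < tau -> 0 < a -> 0 < h -> 11 * a <= L -> a ^+ 2 = L * tau / 128 ->
  h * L <= 192^-1 -> 0 <= k -> k <= 384^-1 ->
  dot rh (r1 - r0) + dot wh (g1 - g0) <= - (h * L) * dot rh rh ->
  r1 = rh + (dx - e1x) ->
  wh = g1 + v1 + s ->
  s = (1 + k) *: (e1y - dy) - k *: e2 ->
  v1 - v0 = h *: (- (a *: v1) + (L / 2 - a) *: (g1 + e2)) ->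
  Y1 - Y0 = h *: wh ->
  P1 - P0 <= h * (dot r0 rh - dot g1 wh) ->
  dot Y1 g1 <= - (P1 + L / 2 * dot X X + tau / 2 * dot Y1 Y1) ->
  tau / 2 * dot Y1 Y1 - dot r1 X + L / 2 * dot X X <= P1 ->
  dot dx dx + dot dy dy <= 2048^-1 *
    (dot (r0 - rh) (r0 - rh) + dot (g0 + v0 - wh) (g0 + v0 - wh) + dot e0x e0x + dot e0y e0y) ->
  energy L a r1 g1 v1 Y1 P1 <= energy L a r0 g0 v0 Y0 P0
    - (15 / 100) * (h * L) * dot rh rh - (1 / 10) * (h * L) * dot g1 g1
    - (25 / 100) * (h * a) * dot v1 v1 - (30 / 100) * (h * a * L * tau) * dot Y1 Y1
    - (15 / 100) * (h * a * L ^+ 2) * dot X X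
    - (40 / 100) * (dot (r0 - rh) (r0 - rh) + dot (g0 + v0 - wh) (g0 + v0 - wh))
    + 3 / 2 * (h * (L / 2 - a)) * dot (v1 + (a / 2) *: Y1) e2
    + 4 * (dot e0x e0x + dot e0y e0y + dot e1x e1x + dot e1y e1y + dot e2 e2).
Proof.
move=> L0 tau0 a0 h0 aL a2 hL k0 k1 hM hr1 hwh hs hdv hY hP hYG hPl hdel.
have K := kinetic_step v0 hM hr1 hwh.
set d1 := r0 - rh in K hdel *; set d2 := g0 + v0 - wh in K hdel *.
set dv := v1 - v0 in K hdv *.
pose w := - (a / 2) *: v1 + ((L - a) / 2) *: g1 + (L / 2 - a) *: e2 + (a / 2) *: s.
set u1 := v1 + (a / 2) *: Y1.
have hu : u1 - (v0 + (a / 2) *: Y0) = h *: w.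
  rewrite /u1 opprD addrACA -scalerBr hY -/dv hdv hwh /w; clear; apply/rowP => i; rewrite !mxE; lra.
have U := square_step hu.
have Udot : dot u1 w = - (a / 2) * dot v1 v1 + (L - a) / 2 * dot v1 g1
   + (L / 2 - a) * dot u1 e2 + a / 2 * dot v1 s + a / 4 * dot (a *: Y1) s
   - a / 4 * dot v1 (a *: Y1) + (L - a) / 4 * (a * dot Y1 g1).
  by rewrite /w /u1 !dotE !(dotC Y1 v1); absdot; clear; lra.
have Gdv : dot g1 dv = h * (- a * dot g1 v1 + (L / 2 - a) * (dot g1 g1 + dot g1 e2)).
  by rewrite hdv !dotE; absdot; clear; lra.
have Gwh : dot g1 wh = dot g1 g1 + dot v1 g1 + dot g1 s.
  by rewrite hwh !dotE (dotC v1 g1).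
have Rrh : dot r0 rh = dot rh rh + dot d1 rh by rewrite /d1 !dotE; absdot; clear; lra.
(* The weights h a <= h L / 11 and h L <= 1/192 make every cross term below small. *)
have ha0 : 0 <= h * a by rewrite mulr_ge0 ?ltW.
have hL0 : 0 <= h * L by rewrite mulr_ge0 ?ltW.
have haL : 11 * (h * a) <= h * L by rewrite mulrCA ler_wpM2l // (ltW h0).
have ha1 : h * a <= 2112^-1 by move: haL hL; clear; lra.
have La0 : 0 <= L - a by move: aL a0; clear; lra.
have hLa0 : 0 <= h * (L - a) by rewrite mulr_ge0 // ltW.
have hLa1 : h * (L - a) <= h * L by move: ha0; clear; lra.
have hc0 : 0 <= h * (L / 2 - a).
  by rewrite mulr_ge0 ?(ltW h0)//; move: aL a0; clear; lra.
have hc1 : h * (L / 2 - a) <= h * L / 2 by move: ha0; clear; lra.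
have HL (q : R) : 0 <= q -> h * L * q <= 192^-1 * q by move=> q0; rewrite ler_wpM2r.
have HA (q : R) : 0 <= q -> 11 * (h * a * q) <= h * L * q.
  by move=> q0; rewrite mulrA ler_wpM2r.
have HA1 (q : R) : 0 <= q -> h * a * q <= 2112^-1 * q by move=> q0; rewrite ler_wpM2r.
have f1 := wyoung 14 rh d1 hLa0 hLa1.
have p4 := wyoungN 3 v1 g1 ha0 (lexx _).
have p5 := wyoung 24 g1 e2 hc0 hc1.
have p6 := wyoungN 39 g1 s hLa0 hLa1.
have p8 := wyoungN 2 v1 (a *: Y1) ha0 (lexx _).
have f9 := wyoung 1 r1 ((L - a) *: X) ha0 (lexx _).
have p11 := wyoung 9 v1 s ha0 (lexx _).
have p11' := wyoung 9 (a *: Y1) s ha0 (lexx _).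
have f12 := dot_sub_le dx e1x.
have f13 := mixed_error_le k0 k1 hs.
have f14 : dot dv dv <= 3 * (h * a / 2112 * dot v1 v1 + h * L / 768 * dot g1 g1 + 1000^-1 * dot e2 e2).
  have -> : dv = - (h * a) *: v1 + (h * (L / 2 - a)) *: g1 + (h * (L / 2 - a)) *: e2.
    by rewrite hdv; clear; apply/rowP => i; rewrite !mxE; lra.
  apply: le_trans (dot_triple_le _ _ _) _; rewrite ler_pM2l // !dotZl !dotZr.
  have i1 : - (h * a) * (- (h * a) * dot v1 v1) <= h * a / 2112 * dot v1 v1.
    by rewrite mulrA ler_wpM2r ?dot_ge0// mulrNN ler_wpM2l.
  have i2 : h * (L / 2 - a) * (h * (L / 2 - a) * dot g1 g1) <= h * L / 768 * dot g1 g1.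
    rewrite mulrA ler_wpM2r ?dot_ge0//; move: hc0 hc1 hL hL0.
    by move: (h * (L / 2 - a)) (h * L) => q1 q2; clear; nra.
  have i3 : h * (L / 2 - a) * (h * (L / 2 - a) * dot e2 e2) <= 1000^-1 * dot e2 e2.
    rewrite mulrA ler_wpM2r ?dot_ge0//; move: hc0 hc1 hL hL0.
    by move: (h * (L / 2 - a)) (h * L) => q1 q2; clear; nra.
  by move: i1 i2 i3; clear; lra.
have f15 : dot r1 r1 <= 2 * dot rh rh + 4 * dot dx dx + 4 * dot e1x e1x.
  by move: (dot_add_le rh (dx - e1x)) f12; rewrite -hr1; absdot; clear; lra.
have kap0 : 0 <= h * a * (L - a) by rewrite mulr_ge0.
have f9b : h * a * (L - a) * dot Y1 g1 <=
   - (10 / 11) * (h * a * L * tau) * dot Y1 Y1 - (495 / 1000) * (h * a * L ^+ 2) * dot X X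
   + 2^-1 * (h * a) * dot r1 r1.
  have j1 : dot Y1 g1 <= - (tau * dot Y1 Y1 + L * dot X X - dot r1 X).
    by move: hYG hPl; absdot; clear; lra.
  have {}j1 := ler_wpM2l kap0 j1.
  have := f9; rewrite dotZl !dotZr => j2.
  have -> : h * a * L ^+ 2 = h * a * (L * L) by rewrite expr2.
  have j3 : (10 / 11) * (h * a * L * tau) * dot Y1 Y1 <= h * a * (L - a) * (tau * dot Y1 Y1).
    have -> : 10 / 11 * (h * a * L * tau) * dot Y1 Y1 = h * a * (10 / 11 * L) * (tau * dot Y1 Y1).
      by absdot; clear; lra.
    rewrite ler_wpM2r ?mulr_ge0 ?dot_ge0 ?(ltW tau0)// ler_wpM2l//; move: aL; clear; lra.
  have j4 : (495 / 1000) * (h * a * (L * L)) * dot X X <=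
      h * a * (L - a) * (L * dot X X) - h * a * (2^-1 * ((L - a) * ((L - a) * dot X X))).
    have -> : h * a * (L - a) * (L * dot X X) - h * a * (2^-1 * ((L - a) * ((L - a) * dot X X)))
      = h * a * (2^-1 * (L * L - a * a)) * dot X X by absdot; clear; lra.
    have -> : 495 / 1000 * (h * a * (L * L)) * dot X X = h * a * (495 / 1000 * (L * L)) * dot X X.
      by absdot; clear; lra.
    rewrite ler_wpM2r ?dot_ge0// ler_wpM2l//; move: aL a0 L0; clear; nra.
  move: j1 j2 j3 j4.
  by absdot; clear; lra.
(* From here on everything is linear in the products of h a, h L and squared norms. *)
have aY : dot (a *: Y1) (a *: Y1) = 128^-1 * (L * tau * dot Y1 Y1).
  by rewrite dotZl dotZr mulrA -expr2 a2; absdot; clear; lra.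
rewrite aY in p8 p11'.
clear f9.
have m1 := HL _ (dot_ge0 d1); have m2 := HL _ (dot_ge0 s); have m3 := HL _ (dot_ge0 e2).
have m4 := HA _ (dot_ge0 g1); have m5 := HA1 _ (dot_ge0 s); have m6 := HA _ (dot_ge0 rh).
have m7 := HA1 _ (dot_ge0 dx); have m8 := HA1 _ (dot_ge0 e1x).
have q0 : 0 <= h * a * (L * tau * dot Y1 Y1) by rewrite !mulr_ge0 ?dot_ge0 ?ltW.
have q1 : 0 <= h * a * (L ^+ 2 * dot X X) by rewrite !mulr_ge0 ?dot_ge0 ?ltW.
have q2 := mulr_ge0 ha0 (dot_ge0 v1); have q3 := mulr_ge0 hL0 (dot_ge0 g1).
have q4 := mulr_ge0 hL0 (dot_ge0 rh); have q5 := dot_ge0 d1; have q6 := dot_ge0 d2.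
have q7 := dot_ge0 e0x; have q8 := dot_ge0 e0y; have q9 := dot_ge0 e1x.
have q10 := dot_ge0 e1y; have q11 := dot_ge0 e2; have q12 := dot_ge0 dx.
have q13 := dot_ge0 dy; have q14 := dot_ge0 s.
have f15' := ler_wpM2l ha0 f15.
have {}hP := ler_wpM2l La0 hP.
rewrite /energy -/u1; rewrite Gdv in K; rewrite Udot in U; rewrite Gwh Rrh in hP.
rewrite (dotC v1 g1) in U hP p4.
rewrite (dotC rh d1) in f1.
move: K U hP f1 p4 p5 p6 p8 p11 p11' f12 f13 f14 f15' f9b hdel.
move: m1 m2 m3 m4 m5 m6 m7 m8 q0 q1 q2 q3 q4 q5 q6 q7 q8 q9 q10 q11 q12 q13 q14 (mulr_ge0 ha0 (dot_ge0 rh)).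
clear -R; absdot; move: (kinetic _ _ _) (kinetic _ _ _) => K1 K0.
lra.
Qed.

(** Completing squares in v leaves - 3/8 a^2 |y|^2, which the tau-term of the gap
    compensates; the pairing of r with X is absorbed by |r|^2 and L |X|^2. *)
Lemma energy_ge0 (r X : 'rV[R]_n) (g v y : 'rV[R]_p) (P L tau a : R) :
  0 < L -> 0 < tau -> 0 < a -> 11 * a <= L -> a ^+ 2 = L * tau / 128 ->
  tau / 2 * dot y y - dot r X + L / 2 * dot X X <= P ->
  0 <= energy L a r g v y P.
Proof.
move=> L0 tau0 a0 aL a2 hP.
have La0 : 0 <= L - a by move: aL a0; clear; lra.
have k1 := ler_wpM2l La0 hP.
have k2 := dot_ge0 (r - (L - a) *: X); have k3 := dot_ge0 (v + 3 *: ((a / 2) *: y)).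
have k4 := dot_ge0 (g + v); have k5 := mulr_ge0 (mulr_ge0 (ltW a0) La0) (dot_ge0 X).
have k6 : 10 / 11 * (L * (tau * dot y y)) <= (L - a) * (tau * dot y y).
  have -> : 10 / 11 * (L * (tau * dot y y)) = 10 / 11 * L * (tau * dot y y) by rewrite !mulrA.
  rewrite ler_wpM2r ?mulr_ge0 ?dot_ge0 ?(ltW tau0)//; move: aL; clear; lra.
have k7 : a * (a * dot y y) = L * tau / 128 * dot y y by rewrite mulrA -expr2 a2.
have k8 : 0 <= L * (tau * dot y y) by rewrite !mulr_ge0 ?dot_ge0 ?ltW.
have k9 := dot_ge0 r.
move: k1 k2 k3 k4 k5 k6 k7 k8 k9; rewrite /energy /kinetic; move: (dot (g + v) (g + v)) => gv.
rewrite !dotE (dotC y v) (dotC X r); absdot; clear; lra.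
Qed.

(** Effect on the potential of the displacement dz of the center, zeta = z - w.1
    and X = x - w.1. The value changes by at most 2 L <zeta, dz> + L |dz|^2, which
    contains - 2 be L |zeta|^2; every other change is paid by a small part of it
    and by be times quantities that a step dissipates. *)
Lemma energy_drift (r1 r2 X zeta dz : 'rV[R]_n) (g v y1 y2 : 'rV[R]_p)
    (P1 P2 p1 p2 L tau a be : R) :
  0 < L -> 0 < tau -> 0 < a -> 11 * a <= L -> a ^+ 2 = L * tau / 128 ->
  0 < be -> be <= 1000^-1 ->
  dz = be *: (X - zeta) ->
  r2 = r1 - (2 * L) *: dz ->
  P2 <= P1 + 2 * L * dot dz X ->
  p2 <= p1 + L * (2 * dot zeta dz + dot dz dz) ->
  tau * dot (y2 - y1) (y2 - y1) <= L * dot dz dz ->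
  L * p2 + energy L a r2 g v y2 P2 <= L * p1 + energy L a r1 g v y1 P1
    + be * (- L ^+ 2 * dot zeta zeta + 9 * L ^+ 2 * dot X X + 8 * dot r1 r1
            + 2 * dot (v + (a / 2) *: y1) (v + (a / 2) *: y1)).
Proof.
move=> L0 tau0 a0 aL a2 be0 be1 hdz hr2 hP hp hy.
have La0 : 0 <= L - a by move: aL a0; clear; lra.
have [xz xzE] : exists q, q = X - zeta by exists (X - zeta).
rewrite -xzE in hdz.
have dzz : dot dz dz = be * (be * dot xz xz) by rewrite hdz dotZl dotZr.
have small (q : R) : 0 <= q -> be * q <= 1000^-1 * q by move=> q0; rewrite ler_wpM2r.
have L2 : 0 <= L ^+ 2 by exact: sqr_ge0.
have xz2 : dot xz xz <= 2 * dot X X + 2 * dot zeta zeta by rewrite xzE; exact: dot_sub_le.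
have r_part : 2^-1 * dot r2 r2 <= 2^-1 * dot r1 r1
    + be * (8 * dot r1 r1 + 8^-1 * (L ^+ 2 * dot xz xz)) + 2 * (L ^+ 2 * dot dz dz).
  have := mulr_ge0 (ltW be0) (dot_ge0 (8 *: r1 + L *: xz)).
  rewrite hr2 hdz !dotE (dotC xz r1); absdot; clear; lra.
set u1 := v + (a / 2) *: y1.
have u2E : v + (a / 2) *: y2 = u1 + (a / 2) *: (y2 - y1).
  by rewrite /u1 -addrA -scalerDr addrCA subrr addr0.
have dyb : (a / 2) * ((a / 2) * dot (y2 - y1) (y2 - y1)) <= 512^-1 * (L ^+ 2 * dot dz dz).
  have -> : a / 2 * (a / 2 * dot (y2 - y1) (y2 - y1)) = 4^-1 * (a ^+ 2 * dot (y2 - y1) (y2 - y1)).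
    by absdot; clear; lra.
  rewrite a2; have := ler_wpM2l (ltW L0) hy; absdot; clear; lra.
have u_part : 3 / 4 * dot (v + (a / 2) *: y2) (v + (a / 2) *: y2) <=
    3 / 4 * dot u1 u1 + 2 * be * dot u1 u1 + 512^-1 * (be * (L ^+ 2 * dot xz xz)).
  have h1 := young u1 ((a / 2) *: (y2 - y1)) be0.
  have h2 : (4 * be)^-1 * dot ((a / 2) *: (y2 - y1)) ((a / 2) *: (y2 - y1)) <=
      2048^-1 * (be * (L ^+ 2 * dot xz xz)).
    rewrite dotZl dotZr mulrC ler_pdivrMr ?mulr_gt0//.
    apply: le_trans dyb _; rewrite dzz; absdot; clear; lra.
  have h3 : a / 2 * (a / 2 * dot (y2 - y1) (y2 - y1)) <= 512^-1 * 1000^-1 * (be * (L ^+ 2 * dot xz xz)).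
    apply: le_trans dyb _; rewrite dzz.
    have := small (be * (L ^+ 2 * dot xz xz)).
    move=> /(_ (mulr_ge0 (ltW be0) (mulr_ge0 L2 (dot_ge0 xz)))); absdot; clear; lra.
  have h4 := mulr_ge0 (ltW be0) (mulr_ge0 L2 (dot_ge0 xz)).
  have h5 := mulr_ge0 (ltW be0) (dot_ge0 u1).
  move: h1 h2 h3 h4 h5; rewrite u2E; clear u2E; move: (y2 - y1) u1 => d u.
  move: (be * (_ * _)) => q; rewrite !dotE (dotC d u); move: (4 * be)^-1 => q'.
  by absdot; clear; lra.
have P_part : 3 / 4 * (L - a) * P2 <= 3 / 4 * (L - a) * P1
    + 3 / 2 * (be * (L ^+ 2 * (3 * dot X X + 8^-1 * dot zeta zeta))).
  have h1 := ler_wpM2l La0 hP.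
  have h2 : dot xz X <= 3 * dot X X + 8^-1 * dot zeta zeta.
    have := dot_ge0 (4 *: X + zeta); rewrite xzE !dotE (dotC zeta X); absdot; clear; lra.
  have h3 : (L - a) * (L * (be * dot xz X)) <= L ^+ 2 * (be * (3 * dot X X + 8^-1 * dot zeta zeta)).
    apply: le_trans (_ : (L - a) * (L * (be * (3 * dot X X + 8^-1 * dot zeta zeta))) <= _).
      by do 3 (rewrite ler_wpM2l // ?(ltW L0) ?(ltW be0)//).
    rewrite mulrA ler_wpM2r ?mulr_ge0 ?addr_ge0 ?dot_ge0 ?(ltW be0)// ?mulr_ge0 ?dot_ge0//.
    by rewrite expr2 ler_wpM2r ?(ltW L0)//; move: a0; clear; lra.
  move: h1 h3; rewrite hdz dotZl; absdot; clear; lra.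
have p_part : L * p2 <= L * p1 + be * (L ^+ 2 * (- (175 / 100) * dot zeta zeta + 4 * dot X X))
    + L ^+ 2 * dot dz dz.
  have h1 := ler_wpM2l (ltW L0) hp.
  have h2 : 2 * dot zeta xz <= - (175 / 100) * dot zeta zeta + 4 * dot X X.
    have := dot_ge0 (4 *: X - zeta); rewrite xzE !dotE (dotC zeta X); absdot; clear; lra.
  have h3 : L ^+ 2 * (be * (2 * dot zeta xz)) <= L ^+ 2 * (be * (- (175 / 100) * dot zeta zeta + 4 * dot X X)).
    by do 2 (rewrite ler_wpM2l // ?(ltW be0)//).
  move: h1 h3; rewrite {1}hdz dotZr; absdot; clear; lra.
have c1 := small _ (mulr_ge0 (ltW be0) (mulr_ge0 L2 (dot_ge0 xz))).
have c2 := ler_wpM2l (ltW be0) (ler_wpM2l L2 xz2).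
have c3 := mulr_ge0 (ltW be0) (mulr_ge0 L2 (dot_ge0 X)).
have c4 := mulr_ge0 (ltW be0) (mulr_ge0 L2 (dot_ge0 zeta)).
move: r_part u_part P_part p_part c1 c2 c3 c4.
rewrite /energy /kinetic dzz -/u1; absdot; clear; lra.
Qed.

End Energy.

(** The step sizes in terms of a = s / 16, the form in which the energy estimates
    use them. *)
Record step_params {R : realType} (L tau h a al k be : R) : Prop := StepParams {
  sp_tau0 : 0 < tau; sp_tauL : tau <= L; sp_h0 : 0 < h;
  sp_h : h * (3 * L + tau) = 64^-1; sp_a0 : 0 < a; sp_aL : 11 * a <= L;
  sp_a2 : a ^+ 2 = L * tau / 128; sp_al : al * (1 + h * a) = 1;
  sp_k : k = al * h * (L / 2 - a); sp_be : be = h * a / 256 }.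

Section OneStep.
Context {R : realType} {n p : nat}.
Notation pt := ('rV[R]_n * 'rV[R]_p)%type.
Context {X : set 'rV[R]_n} {Y : set 'rV[R]_p} {L : R}.
Context {F : pt -> R} {gx : pt -> 'rV[R]_n} {gy : pt -> 'rV[R]_p}.
Hypothesis SS : smooth_saddle X Y L F gx gy.
Context {tau h a al k be : R}.
Hypothesis SP : step_params L tau h a al k be.

Let L0 : 0 < L := ss_L0 SS.
Let tau0 : 0 < tau := sp_tau0 SP.
Let h0 : 0 < h := sp_h0 SP.
Let a0 : 0 < a := sp_a0 SP.
Let clY : closed Y.
Proof. by apply: compact_closed (ss_cpY SS); exact: norm_hausdorff. Qed.

Ltac cl := clear -SS SP L0 tau0 h0 a0 clY.

Definition normal_at m (C : set 'rV[R]_m) (x v : 'rV[R]_m) :=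
  forall x', C x' -> dot v (x' - x) <= 0.

Definition resx (z x : 'rV[R]_n) (y : 'rV[R]_p) (xi : 'rV[R]_n) :=
  gx (x, y) + (2 * L) *: (x - z) + xi.
Definition resy (x : 'rV[R]_n) (y nu : 'rV[R]_p) := gy (x, y) - tau *: y - nu.

(** The value of the saddle point is multiplied by L to give it the dimension of a
    squared gradient, like the energy. *)
Definition potential (z x : 'rV[R]_n) (y : 'rV[R]_p) (xi : 'rV[R]_n) (nu v : 'rV[R]_p) (w : pt) : R :=
  L * Phi L F tau z w.1 w.2 +
  energy L a (resx z x y xi) (resy x y nu) v (y - w.2)
    (Phi L F tau z w.1 w.2 - Phi L F tau z x y).

Lemma hL_le : h * L <= 192^-1.
Proof.
have := sp_h SP; have := mulr_gt0 h0 tau0 => e1 e2; move: e1 e2; cl; lra.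
Qed.

Lemma al_bounds : 0 < al /\ al <= 1.
Proof.
have q := mulr_gt0 h0 a0; have e := sp_al SP.
have al0 : 0 < al.
  rewrite -(pmulr_lgt0 (x := 1 + h * a)) ?e ?ltr01//; move: q; cl; lra.
split => //; have := mulr_gt0 al0 q; move: e; cl; lra.
Qed.

Lemma k_bounds : 0 <= k /\ k <= 384^-1.
Proof.
have [al0 al1] := al_bounds; have q := mulr_gt0 h0 a0; have aL := sp_aL SP.
have c0 : 0 <= h * (L / 2 - a).
  rewrite mulr_ge0 ?(ltW h0)//; move: aL a0 L0; cl; lra.
rewrite (sp_k SP) -mulrA; split; first by rewrite mulr_ge0 // (ltW al0).
apply: (@le_trans _ _ (1 * (h * (L / 2 - a)))); first by rewrite ler_wpM2r.
have := hL_le; move: q; cl; lra.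
Qed.

Lemma ha_le : h * a <= 2112^-1.
Proof.
have := ler_wpM2l (ltW h0) (sp_aL SP); have := hL_le; cl; lra.
Qed.

(** A point x of C written as the result of a step from c with vector q2 is its own
    projection, so nonexpansiveness compares the two vectors. *)
Lemma proj_step m (C : set 'rV[R]_m) (c q1 q2 : 'rV[R]_m) (x : 'rV[R]_m) :
  C !=set0 -> closed C -> convex_set C -> C x ->
  x = c - h *: q2 ->
  dot (x - proj C (c - h *: q1)) (x - proj C (c - h *: q1)) <= h ^+ 2 * dot (q1 - q2) (q1 - q2).
Proof.
move=> C0 clC cvC Cx xE; have := proj_normal C0 clC cvC (c - h *: q1) Cx.
set t := proj C _.
have -> : c - h *: q1 - t = (x - t) - h *: (q1 - q2).
  by rewrite xE; cl; apply/rowP => i; rewrite !mxE; lra.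
have := dot_ge0 (x - t - h *: (q1 - q2)); move: (x - t) (q1 - q2) => u q.
by rewrite !dotE (dotC q u); absdot; cl; lra.
Qed.

(** This is why the scheme may use xi and nu as normal vectors: they are the
    residuals of the projection steps. *)
Lemma proj_residual_normal m (C : set 'rV[R]_m) (c q : 'rV[R]_m) :
  C !=set0 -> closed C -> convex_set C ->
  normal_at C (proj C (c - h *: q)) (h^-1 *: (c - proj C (c - h *: q)) - q).
Proof.
move=> C0 clC cvC x' Cx'; have := proj_normal C0 clC cvC (c - h *: q) Cx'.
set t := proj C _; rewrite dotC.
have -> : c - h *: q - t = h *: (h^-1 *: (c - t) - q).
  by rewrite scalerBr scalerA divff ?gt_eqF// scale1r addrAC.
by rewrite dotZl pmulr_rle0.
Qed.

Lemma field_lipschitz z x x' y y' : X x -> X x' -> Y y -> Y y' ->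
  dot (gx (x, y) + (2 * L) *: (x - z) - (gx (x', y') + (2 * L) *: (x' - z)))
      (gx (x, y) + (2 * L) *: (x - z) - (gx (x', y') + (2 * L) *: (x' - z)))
  + dot (gy (x, y) - tau *: y - (gy (x', y') - tau *: y'))
        (gy (x, y) - tau *: y - (gy (x', y') - tau *: y'))
  <= (3 * L + tau) ^+ 2 * (dot (x - x') (x - x') + dot (y - y') (y - y')).
Proof.
move=> Xx Xx' Yy Yy'; have H := ss_lip SS Xx Yy Xx' Yy'.
have aux m (g q : 'rV[R]_m) : dot (g + q) (g + q) <= 3 * dot g g + 3 / 2 * dot q q.
  have := dot_ge0 (2 *: g - q); rewrite !dotE (dotC q g); absdot; cl; lra.
have -> : gx (x, y) + (2 * L) *: (x - z) - (gx (x', y') + (2 * L) *: (x' - z)) =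
   (gx (x, y) - gx (x', y')) + (2 * L) *: (x - x').
  by move: (gx _) (gx _) => g g'; cl; apply/rowP => i; rewrite !mxE; lra.
have -> : gy (x, y) - tau *: y - (gy (x', y') - tau *: y') =
   (gy (x, y) - gy (x', y')) + (- tau) *: (y - y').
  by move: (gy _) (gy _) => g g'; cl; apply/rowP => i; rewrite !mxE; lra.
apply: le_trans (lerD (aux _ _ _) (aux _ _ _)) _.
rewrite !dotZl !dotZr.
have t2 : tau * tau <= L * L by rewrite ler_pM ?(ltW tau0)// (sp_tauL SP).
have := ler_wpM2r (dot_ge0 (y - y')) t2.
have := mulr_ge0 (mulr_ge0 (ltW L0) (ltW tau0)) (dot_ge0 (x - x')).
have := mulr_ge0 (mulr_ge0 (ltW L0) (ltW tau0)) (dot_ge0 (y - y')).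
have := mulr_ge0 (mulr_ge0 (ltW tau0) (ltW tau0)) (dot_ge0 (x - x')).
have := mulr_ge0 (mulr_ge0 (ltW tau0) (ltW tau0)) (dot_ge0 (y - y')).
have := mulr_ge0 (mulr_ge0 (ltW L0) (ltW L0)) (dot_ge0 (y - y')).
move: H; absdot; cl; lra.
Qed.

Lemma saddle_gap (z x : 'rV[R]_n) (y : 'rV[R]_p) (xi : 'rV[R]_n) (nu : 'rV[R]_p) w :
  X x -> Y y -> normal_at X x xi -> normal_at Y y nu ->
  is_saddle X Y L F tau z w ->
  (dot (y - w.2) (resy x y nu) <= - ((Phi L F tau z w.1 w.2 - Phi L F tau z x y)
     + L / 2 * dot (x - w.1) (x - w.1) + tau / 2 * dot (y - w.2) (y - w.2))) /\
  (tau / 2 * dot (y - w.2) (y - w.2) - dot (resx z x y xi) (x - w.1)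
     + L / 2 * dot (x - w.1) (x - w.1) <= Phi L F tau z w.1 w.2 - Phi L F tau z x y).
Proof.
case: w => x' y' Xx Yy nx ny [/= Xx' Yy' h1 h2]; split.
  have := h1 _ Xx; have := Phi_concave SS tau z Xx Yy Yy'; have := ny _ Yy'.
  rewrite /resy; move: (Phi _ _ _ _ _ _) (Phi _ _ _ _ _ _) (Phi _ _ _ _ _ _) => e1 e2 e3.
  move: (gy _) => g; rewrite !dotE (dotC y' y) (dotC y g) (dotC y' g) (dotC y nu) (dotC y' nu).
  by absdot; cl; lra.
have := h2 _ Yy; have := Phi_lower SS tau z Xx Xx' Yy; have := nx _ Xx'.
rewrite /resx; move: (Phi _ _ _ _ _ _) (Phi _ _ _ _ _ _) (Phi _ _ _ _ _ _) => e1 e2 e3.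
by rewrite !dotE (dotC x' x); absdot; cl; lra.
Qed.

Lemma potential_lower (z x : 'rV[R]_n) (y : 'rV[R]_p) (xi : 'rV[R]_n) (nu v : 'rV[R]_p) w :
  X x -> Y y -> normal_at X x xi -> normal_at Y y nu ->
  is_saddle X Y L F tau z w ->
  L * Phi L F tau z w.1 w.2 <= potential z x y xi nu v w.
Proof.
move=> Xx Yy nx ny sw; rewrite /potential lerDl.
have [_ g2] := saddle_gap Xx Yy nx ny sw.
exact: (energy_ge0 _ _ L0 tau0 a0 (sp_aL SP) (sp_a2 SP) g2).
Qed.

(** Strong monotonicity of the saddle operator of Phi along the actual move; normal
    cones are monotone, so xi and nu contribute with the right sign. *)
Lemma move_monotone (z x x1 xi xi1 rh : 'rV[R]_n) (y y1 nu nu1 wh : 'rV[R]_p) :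
  X x -> Y y -> normal_at X x xi -> normal_at Y y nu ->
  X x1 -> Y y1 -> normal_at X x1 xi1 -> normal_at Y y1 nu1 ->
  x1 = x - h *: rh -> y1 = y + h *: wh ->
  dot rh (resx z x1 y1 xi1 - resx z x y xi) + dot wh (resy x1 y1 nu1 - resy x y nu)
  <= - (h * L) * dot rh rh.
Proof.
move=> Xx Yy nx ny X1 Y1 nx1 ny1 x1E y1E.
have a1 := Phi_lower SS tau z Xx X1 Yy; have a2 := Phi_lower SS tau z X1 Xx Y1.
have a3 := Phi_concave SS tau z Xx Yy Y1; have a4 := Phi_concave SS tau z X1 Y1 Yy.
have b1 := nx _ X1; have b2 := nx1 _ Xx; have b3 := ny _ Y1; have b4 := ny1 _ Yy.
have dX : x1 - x = - (h *: rh) by rewrite {1}x1E addrC addKr.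
have dX' : x - x1 = h *: rh by rewrite -opprB dX opprK.
have dY : y1 - y = h *: wh by rewrite {1}y1E addrC addKr.
have dY' : y - y1 = - (h *: wh) by rewrite -opprB dY.
have t0 := mulr_ge0 (ltW tau0) (mulr_ge0 (sqr_ge0 h) (dot_ge0 wh)).
move: a1 a2 a3 a4 b1 b2 b3 b4; rewrite dX dX' dY dY' /resx /resy.
move: (gx (x, y) + _) (gx (x1, y1) + _) (gy (x, y) - _) (gy (x1, y1) - _) => c1 c2 c3 c4.
move: (Phi _ _ _ _ _ _) (Phi _ _ _ _ _ _) (Phi _ _ _ _ _ _) (Phi _ _ _ _ _ _) => f1 f2 f3 f4.
move: t0 => /[swap] H1 /[swap] H2 /[swap] H3 /[swap] H4 /[swap] H5 /[swap] H6 /[swap] H7 /[swap] H8 t0.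
rewrite -(ler_pM2l h0).
move: H1 H2 H3 H4 H5 H6 H7 H8 t0.
rewrite !dotE !(dotC rh) !(dotC wh); absdot; cl; lra.
Qed.

Lemma move_gap (z x x1 xi rh : 'rV[R]_n) (y y1 nu1 wh : 'rV[R]_p) :
  X x -> Y y -> normal_at X x xi -> X x1 -> Y y1 -> normal_at Y y1 nu1 ->
  x1 = x - h *: rh -> y1 = y + h *: wh ->
  Phi L F tau z x y - Phi L F tau z x1 y1 <=
  h * (dot (resx z x y xi) rh - dot (resy x1 y1 nu1) wh).
Proof.
move=> Xx Yy nx X1 Y1 ny1 x1E y1E.
have a1 := Phi_lower SS tau z Xx X1 Yy.
have a4 := Phi_concave SS tau z X1 Y1 Yy.
have b1 := nx _ X1; have b4 := ny1 _ Yy.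
have dX : x1 - x = - (h *: rh) by rewrite {1}x1E addrC addKr.
have dY : y1 - y = h *: wh by rewrite {1}y1E addrC addKr.
have dY' : y - y1 = - (h *: wh) by rewrite -opprB dY.
have t0 := mulr_ge0 (ltW tau0) (mulr_ge0 (sqr_ge0 h) (dot_ge0 wh)).
have t1 := mulr_ge0 (ltW L0) (mulr_ge0 (sqr_ge0 h) (dot_ge0 rh)).
move: a1 a4 b1 b4; rewrite dX dY' /resx /resy.
move: (gx (x, y) + _) (gy (x1, y1) - _) => c1 c4.
move: (Phi _ _ _ _ _ _) (Phi _ _ _ _ _ _) (Phi _ _ _ _ _ _) => f1 f2 f3.
move: t0 t1; rewrite !dotE; absdot; cl; lra.
Qed.

(** The new point and the extrapolated point are projections of steps from the
    same base point, so they differ by h times the difference of the vectors,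
    which is the residual mismatch plus the error of the first estimate. *)
Lemma move_displacement (z x x1 xt xi rh : 'rV[R]_n) (y y1 yt nu v wh : 'rV[R]_p) (g0 : pt) :
  X x1 -> Y y1 -> x1 = x - h *: rh -> y1 = y + h *: wh ->
  xt = proj X (x - h *: (g0.1 + (2 * L) *: (x - z) + xi)) ->
  yt = proj Y (y + h *: (g0.2 - tau *: y - nu + v)) ->
  dot (x1 - xt) (x1 - xt) + dot (y1 - yt) (y1 - yt) <=
  2 * h ^+ 2 * (dot (resx z x y xi - rh) (resx z x y xi - rh)
    + dot (resy x y nu + v - wh) (resy x y nu + v - wh)
    + dot (g0.1 - gx (x, y)) (g0.1 - gx (x, y)) + dot (g0.2 - gy (x, y)) (g0.2 - gy (x, y))).
Proof.
move=> X1 Y1 x1E y1E xtE ytE.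
have p1 := proj_step (g0.1 + (2 * L) *: (x - z) + xi)
  (ss_X0 SS) (ss_clX SS) (ss_cvX SS) X1 x1E.
have y1E' : y1 = y - h *: (- wh) by rewrite scalerN opprK.
have p2 := proj_step (- (g0.2 - tau *: y - nu + v)) (ss_Y0 SS) clY (ss_cvY SS) Y1 y1E'.
rewrite -xtE in p1; rewrite scalerN opprK -ytE in p2.
set d1 := resx z x y xi - rh; set d2 := resy x y nu + v - wh.
have q1 : g0.1 + (2 * L) *: (x - z) + xi - rh = d1 + (g0.1 - gx (x, y)).
  rewrite /d1 /resx; move: (gx _) g0.1 => u g; cl; apply/rowP => i; rewrite !mxE; lra.
have q2 : - (g0.2 - tau *: y - nu + v) - - wh = - (d2 + (g0.2 - gy (x, y))).
  rewrite /d2 /resy; move: (gy _) g0.2 => u g; cl; apply/rowP => i; rewrite !mxE; lra.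
move: p1 p2; rewrite q1 q2 dotNl dotNr opprK => p1 p2.
have := ler_wpM2l (sqr_ge0 h) (dot_add_le d1 (g0.1 - gx (x, y))).
have := ler_wpM2l (sqr_ge0 h) (dot_add_le d2 (g0.2 - gy (x, y))).
by move: p1 p2; absdot; cl; lra.
Qed.

(** 2 h^2 (3 L + tau)^2 = 2 / 64^2 = 1 / 2048. *)
Lemma field_change_le z x1 xt y1 yt (Q : R) : X x1 -> X xt -> Y y1 -> Y yt ->
  dot (x1 - xt) (x1 - xt) + dot (y1 - yt) (y1 - yt) <= 2 * h ^+ 2 * Q ->
  dot (gx (x1, y1) + (2 * L) *: (x1 - z) - (gx (xt, yt) + (2 * L) *: (xt - z)))
      (gx (x1, y1) + (2 * L) *: (x1 - z) - (gx (xt, yt) + (2 * L) *: (xt - z)))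
  + dot (gy (x1, y1) - tau *: y1 - (gy (xt, yt) - tau *: yt))
        (gy (x1, y1) - tau *: y1 - (gy (xt, yt) - tau *: yt)) <= 2048^-1 * Q.
Proof.
move=> X1 Xt Y1 Yt HQ; apply: le_trans (field_lipschitz z X1 Xt Y1 Yt) _.
apply: le_trans (ler_wpM2l (sqr_ge0 _) HQ) _.
have -> : 2048^-1 = 2 * (h * (3 * L + tau)) ^+ 2 :> R by rewrite (sp_h SP); field.
by rewrite exprMn; absdot; cl; lra.
Qed.

(** Implicit form of v1 = al v + k q: with al = 1 / (1 + h a) the friction acts on
    the new momentum. *)
Lemma momentum_step (v v1 q : 'rV[R]_p) : v1 = al *: v + k *: q ->
  v1 - v = h *: (- (a *: v1) + (L / 2 - a) *: q).
Proof.
move=> vE.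
have E2 : (1 + h * a) *: v1 = v + (h * (L / 2 - a)) *: q.
  rewrite vE scalerDr !scalerA (sp_k SP) (mulrC _ al) (sp_al SP) scale1r !mulrA.
  by rewrite (mulrC _ al) (sp_al SP) mul1r.
move: E2 => /rowP E2.
by apply/rowP => i; have := E2 i; rewrite !mxE; move: (v1 0 i) (v 0 i) (q 0 i); cl => *; lra.
Qed.

Lemma saddle_gap_drift z z1 x1 y1 w w' :
  is_saddle X Y L F tau z w -> is_saddle X Y L F tau z1 w' ->
  Phi L F tau z1 w'.1 w'.2 - Phi L F tau z1 x1 y1 <=
    Phi L F tau z w.1 w.2 - Phi L F tau z x1 y1 + 2 * L * dot (z1 - z) (x1 - w.1).
Proof.
move=> sw sw'; have sd := saddle_value_drift SS (ltW tau0) sw sw'.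
have PE : Phi L F tau z1 x1 y1 = Phi L F tau z x1 y1
     + L * (dot (x1 - z1) (x1 - z1) - dot (x1 - z) (x1 - z)).
  by rewrite /Phi; move: (F _) => f1; absdot; cl; lra.
rewrite PE; move: sd.
move: (Phi _ _ _ _ _ _) (Phi _ _ _ _ _ _) (Phi _ _ _ _ _ _) => f1 f2 f3; move: w.1 => x'.
rewrite !dotE !(dotC z x') !(dotC z1 x') !(dotC z x1) !(dotC z1 x1).
by absdot; cl; lra.
Qed.

Lemma saddle_value_step z z1 w w' :
  is_saddle X Y L F tau z w -> is_saddle X Y L F tau z1 w' ->
  Phi L F tau z1 w'.1 w'.2 <= Phi L F tau z w.1 w.2
    + L * (2 * dot (z - w.1) (z1 - z) + dot (z1 - z) (z1 - z)).
Proof.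
move=> sw sw'; have := saddle_value_drift SS (ltW tau0) sw sw'.
move: (Phi _ _ _ _ _ _) (Phi _ _ _ _ _ _) => f1 f2; move: w.1 => x'.
rewrite !dotE !(dotC z x') !(dotC z1 x') !(dotC z1 z); by absdot; cl; lra.
Qed.

(** The step relative to the old center, followed by the change of center. The
    constants of the two estimates leave room for the displacements of the
    query points, which the recursive estimator will need. *)
Lemma potential_step (z x xt x1 xi xi1 z1 : 'rV[R]_n) (y yt y1 nu nu1 v vbar v1 : 'rV[R]_p)
    (g0 g1 g2 w w' : pt) :
  X x -> Y y -> normal_at X x xi -> normal_at Y y nu ->
  is_saddle X Y L F tau z w -> is_saddle X Y L F tau z1 w' ->
  xt = proj X (x - h *: (g0.1 + (2 * L) *: (x - z) + xi)) ->
  yt = proj Y (y + h *: (g0.2 - tau *: y - nu + v)) ->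
  vbar = al *: v + k *: (g1.2 - tau *: yt) ->
  x1 = proj X (x - h *: (g1.1 + (2 * L) *: (xt - z))) ->
  xi1 = h^-1 *: (x - x1) - g1.1 - (2 * L) *: (xt - z) ->
  y1 = proj Y (y + h *: (g1.2 - tau *: yt + vbar)) ->
  nu1 = (1 + k)^-1 *: (h^-1 *: (y - y1) + g1.2 - tau *: yt + vbar) ->
  v1 = al *: v + k *: (g2.2 - tau *: y1 - nu1) ->
  z1 = z + be *: (x1 - z) ->
  let e0x := g0.1 - gx (x, y) in let e0y := g0.2 - gy (x, y) in
  let e1x := g1.1 - gx (xt, yt) in let e1y := g1.2 - gy (xt, yt) in
  let e2 := g2.2 - gy (x1, y1) in let u1 := v1 + (a / 2) *: (y1 - w.2) in
  [/\ X xt /\ Y yt, X x1 /\ Y y1, normal_at X x1 xi1 /\ normal_at Y y1 nu1 &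
  potential z1 x1 y1 xi1 nu1 v1 w' + be * L ^+ 2 * dot (z - w.1) (z - w.1)
    + be * L ^+ 2 * (dot (xt - x) (xt - x) + dot (yt - y) (yt - y)
       + (dot (x1 - xt) (x1 - xt) + dot (y1 - yt) (y1 - yt)))
    + 10^-1 * (h * a) * dot u1 u1 <=
  potential z x y xi nu v w + 3 / 2 * (h * (L / 2 - a)) * dot u1 e2
    + 6 * (dot e0x e0x + dot e0y e0y + dot e1x e1x + dot e1y e1y + dot e2 e2)].
Proof.
move=> Xx Yy nx ny sw sw' xtE ytE vbE x1P xi1E y1P nu1E v1E z1E e0x e0y e1x e1y e2 u1.
have pX q := proj_in (ss_X0 SS) (ss_clX SS) (ss_cvX SS) q.
have pY q := proj_in (ss_Y0 SS) clY (ss_cvY SS) q.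
have Xt : X xt by rewrite xtE; exact: pX.
have Yt : Y yt by rewrite ytE; exact: pY.
have X1 : X x1 by rewrite x1P; exact: pX.
have Y1 : Y y1 by rewrite y1P; exact: pY.
have [k0 k1] := k_bounds; have aL := sp_aL SP; have a2 := sp_a2 SP.
have k10 : 1 + k != 0 by rewrite gt_eqF// ltr_pwDl.
have nx1 : normal_at X x1 xi1.
  have := @proj_residual_normal _ X x (g1.1 + (2 * L) *: (xt - z))
    (ss_X0 SS) (ss_clX SS) (ss_cvX SS).
  by rewrite -x1P opprD addrA -xi1E.
have ny1 : normal_at Y y1 nu1.
  move=> y' Yy'.
  have := @proj_residual_normal _ Y y (- (g1.2 - tau *: yt + vbar))
      (ss_Y0 SS) clY (ss_cvY SS).
  rewrite scalerN opprK -y1P => /(_ _ Yy'); rewrite opprK => H.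
  rewrite nu1E dotZl; have k10' : 0 <= (1 + k)^-1 by rewrite invr_ge0 addr_ge0.
  by apply: mulr_ge0_le0 => //; move: H; rewrite !addrA.
have [rh rhE] : exists q, q = h^-1 *: (x - x1) by exists (h^-1 *: (x - x1)).
have [wh whE] : exists q, q = h^-1 *: (y1 - y) by exists (h^-1 *: (y1 - y)).
have x1E : x1 = x - h *: rh.
  by rewrite rhE scalerA divff ?gt_eqF// scale1r opprB addrCA subrr addr0.
have y1E : y1 = y + h *: wh.
  by rewrite whE scalerA divff ?gt_eqF// scale1r addrCA subrr addr0.
have Enu : (1 + k) *: nu1 = - wh + g1.2 - tau *: yt + vbar.
  have -> : - wh = h^-1 *: (y - y1) by rewrite whE -scalerN opprB.
  by rewrite nu1E scalerA divff // scale1r.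
pose dx := gx (x1, y1) + (2 * L) *: (x1 - z) - (gx (xt, yt) + (2 * L) *: (xt - z)).
pose dy := gy (x1, y1) - tau *: y1 - (gy (xt, yt) - tau *: yt).
have Ep : resx z x1 y1 xi1 = rh + (dx - e1x).
  rewrite /resx xi1E -rhE /dx /e1x; move: (gx _) (gx _) g1.1 => c1 c2 c3.
  by cl; apply/rowP => i; rewrite !mxE; lra.
have Ed : wh = resy x1 y1 nu1 + v1 + ((1 + k) *: (e1y - dy) - k *: e2).
  move: Enu; rewrite /resy v1E /dy /e1y /e2 vbE.
  move: (gy _) (gy _) (tau *: yt) (tau *: y1) g1.2 g2.2 => c1 c2 c4 c5 c6 c7; cl.
  by move=> /rowP E; apply/rowP => i; have := E i; rewrite !mxE; lra.
have Em : v1 - v = h *: (- (a *: v1) + (L / 2 - a) *: (resy x1 y1 nu1 + e2)).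
  apply: momentum_step; rewrite v1E; congr (_ + _ *: _); rewrite /resy /e2.
  by move: (gy _) (tau *: y1) g2.2 => c1 c3 c4; cl; apply/rowP => i; rewrite !mxE; lra.
have hM := move_monotone z Xx Yy nx ny X1 Y1 nx1 ny1 x1E y1E.
have hD := move_displacement X1 Y1 x1E y1E xtE ytE.
have hdel := field_change_le z X1 Xt Y1 Yt hD; rewrite -/dx -/dy -/e0x -/e0y in hdel.
have [hYG hPl] := saddle_gap X1 Y1 nx1 ny1 sw.
have hP : Phi L F tau z w.1 w.2 - Phi L F tau z x1 y1
     - (Phi L F tau z w.1 w.2 - Phi L F tau z x y) <=
   h * (dot (resx z x y xi) rh - dot (resy x1 y1 nu1) wh).
  have := move_gap z Xx Yy nx X1 Y1 ny1 x1E y1E.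
  move: (Phi _ _ _ _ _ _) (Phi _ _ _ _ _ _) (Phi _ _ _ _ _ _) => f1 f2 f3.
  by absdot; cl; lra.
have hY : (y1 - w.2) - (y - w.2) = h *: wh.
  by rewrite {1}y1E opprB addrA subrK addrAC subrr add0r.
have ES := energy_step L0 tau0 a0 h0 aL a2 hL_le k0 k1 hM Ep Ed erefl Em hY hP hYG hPl hdel.
have q0 : 0 < h * a by rewrite mulr_gt0.
have beE := sp_be SP; have be0 : 0 < be by rewrite beE divr_gt0.
have be1 : be <= 1000^-1 by rewrite beE; have := ha_le; move: q0; cl; lra.
have z1z : z1 - z = be *: (x1 - z) by rewrite z1E (addrC z) addrK.
have hdz : z1 - z = be *: ((x1 - w.1) - (z - w.1)).
  by rewrite z1z; congr (_ *: _); rewrite opprB addrA subrK.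
have hr2 : resx z1 x1 y1 xi1 = resx z x1 y1 xi1 - (2 * L) *: (z1 - z).
  by rewrite /resx; move: (gx _) => c1; cl; apply/rowP => i; rewrite !mxE; lra.
have hp2 := saddle_value_step sw sw'.
have hP2 := saddle_gap_drift x1 y1 sw sw'.
have hy : tau * dot ((y1 - w'.2) - (y1 - w.2)) ((y1 - w'.2) - (y1 - w.2)) <=
    L * dot (z1 - z) (z1 - z).
  have -> : y1 - w'.2 - (y1 - w.2) = - (w'.2 - w.2) by rewrite !opprB addrC addrA subrK.
  move: (saddle_stable_y SS sw sw'); move: (w'.2 - w.2) => q.
  by rewrite dotNl dotNr opprK.
have DR := energy_drift (resy x1 y1 nu1) v1 L0 tau0 a0 aL a2 be0 be1 hdz hr2 hP2 hp2 hy.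
have r1le : dot (resx z x1 y1 xi1) (resx z x1 y1 xi1) <=
    2 * dot rh rh + 4 * dot dx dx + 4 * dot e1x e1x.
  rewrite Ep; have := dot_add_le rh (dx - e1x); have := dot_sub_le dx e1x.
  by absdot; cl; lra.
have u1le : dot u1 u1 <= 2 * dot v1 v1 + 256^-1 * (L * tau * dot (y1 - w.2) (y1 - w.2)).
  have := dot_add_le v1 ((a / 2) *: (y1 - w.2)); rewrite -/u1 dotZl dotZr.
  have -> : a / 2 * (a / 2 * dot (y1 - w.2) (y1 - w.2)) = 4^-1 * (a ^+ 2 * dot (y1 - w.2) (y1 - w.2)).
    by absdot; cl; lra.
  by rewrite a2; absdot; cl; lra.
have sle := mixed_error_le k0 k1 (erefl ((1 + k) *: (e1y - dy) - k *: e2)).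
have whle := dot_triple_le (resy x1 y1 nu1) v1 ((1 + k) *: (e1y - dy) - k *: e2).
rewrite -Ed in whle.
have mvx : dot (xt - x) (xt - x) <= 2 * h ^+ 2 * dot rh rh + 2 * dot (x1 - xt) (x1 - xt).
  have -> : xt - x = - (h *: rh) - (x1 - xt).
    by rewrite {1}x1E; cl; apply/rowP => i; rewrite !mxE; lra.
  apply: le_trans (dot_sub_le _ _) _; rewrite dotNl dotNr dotZl dotZr.
  by absdot; cl; lra.
have mvy : dot (yt - y) (yt - y) <= 2 * h ^+ 2 * dot wh wh + 2 * dot (y1 - yt) (y1 - yt).
  have -> : yt - y = h *: wh - (y1 - yt).
    by rewrite {1}y1E; cl; apply/rowP => i; rewrite !mxE; lra.
  apply: le_trans (dot_sub_le _ _) _; rewrite dotZl dotZr.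
  by absdot; cl; lra.
have [mv mvE] : exists q, q = dot (xt - x) (xt - x) + dot (yt - y) (yt - y)
    + (dot (x1 - xt) (x1 - xt) + dot (y1 - yt) (y1 - yt)) by eexists.
have [D DE] : exists q, q = dot (resx z x y xi - rh) (resx z x y xi - rh)
    + dot (resy x y nu + v - wh) (resy x y nu + v - wh) by eexists.
rewrite -DE in ES hD hdel.
have mvle : mv <= h ^+ 2 * (2 * dot rh rh + 2 * dot wh wh
     + 6 * (D + dot e0x e0x + dot e0y e0y)).
  by move: mvx mvy hD; rewrite mvE -/e0x -/e0y; absdot; cl; lra.
have D0 : 0 <= D by rewrite DE addr_ge0 ?dot_ge0.
have hL2 : L ^+ 2 * h ^+ 2 <= 1000^-1.
  have -> : L ^+ 2 * h ^+ 2 = (h * L) * (h * L) by rewrite -exprMn mulrC expr2.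
  apply: (@le_trans _ _ (192^-1 * 192^-1)); first by rewrite ler_pM ?hL_le// mulr_ge0 ?ltW.
  by cl; lra.
have mvle2 : be * L ^+ 2 * mv <= be * (1000^-1 * (2 * dot rh rh + 2 * dot wh wh
     + 6 * (D + dot e0x e0x + dot e0y e0y))).
  rewrite -mulrA ler_wpM2l ?(ltW be0)//.
  apply: le_trans (ler_wpM2l (sqr_ge0 L) mvle) _.
  by rewrite mulrA ler_wpM2r // !addr_ge0 // mulr_ge0 ?dot_ge0// !addr_ge0 ?dot_ge0.
have b1 := ler_wpM2l (ltW be0) r1le; have b2 := ler_wpM2l (ltW be0) u1le.
have b3 := ler_wpM2l (ltW be0) whle; have b4 := ler_wpM2l (ltW be0) sle.
have b5 := ler_wpM2l (ltW q0) u1le.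
have q11 (t : R) : 0 <= t -> 11 * (h * a * t) <= h * L * t.
  by move=> t0; rewrite mulrA ler_wpM2r // mulrCA ler_wpM2l ?(ltW h0).
have q12 (t : R) : 0 <= t -> be * t <= 1000^-1 * t by move=> t0; rewrite ler_wpM2r.
have c1 := q11 _ (dot_ge0 rh); have c2 := q11 _ (dot_ge0 (resy x1 y1 nu1)).
have c3 := q12 _ (dot_ge0 dx); have c4 := q12 _ (dot_ge0 e1x); have c5 := q12 _ (dot_ge0 dy).
have c6 := q12 _ (dot_ge0 e1y); have c7 := q12 _ (dot_ge0 e2); have c8 := q12 _ D0.
have c9 := q12 _ (dot_ge0 e0x); have c10 := q12 _ (dot_ge0 e0y).
have d1 := mulr_ge0 (ltW q0) (dot_ge0 rh); have d2 := mulr_ge0 (ltW q0) (dot_ge0 (resy x1 y1 nu1)).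
have d3 := mulr_ge0 (ltW q0) (dot_ge0 v1).
have LL0 : 0 <= L ^+ 2 by exact: sqr_ge0.
have d4 := mulr_ge0 (ltW q0) (mulr_ge0 LL0 (dot_ge0 (x1 - w.1))).
have Lt0 : 0 <= L * tau by rewrite mulr_ge0 ?ltW.
have d5 := mulr_ge0 (ltW q0) (mulr_ge0 Lt0 (dot_ge0 (y1 - w.2))).
have [d6 d7] := (dot_ge0 dx, dot_ge0 dy); have [d8 d9] := (dot_ge0 e1x, dot_ge0 e1y).
have [d10 d11] := (dot_ge0 e0x, dot_ge0 e0y); have d12 := dot_ge0 e2.
split => //; rewrite /potential.
move: ES DR mvle2 b1 b2 b3 b4 b5 c1 c2 c3 c4 c5 c6 c7 c8 c9 c10 d1 d2 d3 d4 d5 d6 d7 d8 d9 d10 d11 d12 D0 hdel.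
rewrite -/u1 -mvE -/e0x -/e0y beE.
move: (energy _ _ _ _ _ _ _) (energy _ _ _ _ _ _ _) (energy _ _ _ _ _ _ _) => E1 E2 E3.
move: (Phi _ _ _ _ _ _) (Phi _ _ _ _ _ _) => p1 p2.
absdot; cl; lra.
Qed.

End OneStep.

(** * Stationarity and the initial potential *)

Section Problem.
Context {R : realType} {n p : nat}.
Notation pt := ('rV[R]_n * 'rV[R]_p)%type.
Context {X : set 'rV[R]_n} {Y : set 'rV[R]_p}.
Context {dS : measure_display} {S : measurableType dS} {D : probability S R}.
Context {f : pt -> S -> R^o} {gradf : pt -> S -> pt} {L : R}.
Hypothesis SA : standing_assumptions X Y D f gradf L.
Implicit Types (x z : 'rV[R]_n) (y : 'rV[R]_p).

Let F : pt -> R := objective D f.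
Let gx (z : pt) := (grad2 (objective D f) z).1.
Let gy (z : pt) := (grad2 (objective D f) z).2.
Let DY := max_norm Y.
Let ph := phi Y D f.
Let L0 : 0 < L. Proof. exact: L_gt0 SA. Qed.
Let D0 : 0 < DY. Proof. exact: max_norm_gt0 SA. Qed.

Ltac cl := clear -SA gx gy L0 D0 ph F DY.

Lemma saddle_structure : smooth_saddle X Y L F gx gy.
Proof.
split; try by case: SA.
- move=> x y Xx Yy; apply: differentiable_continuous.
  exact: (objective_differentiable SA (z := (x, y)) (conj Xx Yy)).
- by move=> x x' y Xx Xx' Yy; exact: (objective_weakly_convex SA Xx Xx' Yy).
- move=> x x' y Xx Xx' Yy.
  have := objective_upper SA (z := (x, y)) (z' := (x', y)) (conj Xx Yy) (conj Xx' Yy).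
  by rewrite /= subrr !dot0r !addr0.
- by move=> x y y' Xx Yy Yy'; exact: (objective_concave_grad SA Xx Yy Yy').
- move=> x y x' y' Xx Yy Xx' Yy'.
  exact: (grad_lipschitz_sqr SA (z := (x, y)) (z' := (x', y')) (conj Xx Yy) (conj Xx' Yy')).
Qed.

Let SS := saddle_structure.

Ltac cl ::= clear -SA gx gy L0 D0 ph F DY SS.

Lemma max_norm_ub y : Y y -> enorm y <= DY.
Proof.
move=> Yy; apply: sup_upper_bound; last by exists y.
split; first by exists (enorm y), y.
have [B [_ HB]] := compact_bounded (Y_compact SA).
exists (Num.sqrt (p%:R * (B + 1) ^+ 2)) => _ [y' Yy' <-].
apply: enorm_le_sqrt; first exact: sqrtr_ge0.
rewrite sqr_sqrtr; last by rewrite mulr_ge0 // sqr_ge0.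
apply: le_trans (dot_le_normr _) _; rewrite ler_wpM2l //.
have y'B : `|y'| <= B + 1 by apply: HB; rewrite ?ltrDl.
by rewrite ler_pXn2r ?nnegrE // (le_trans _ y'B).
Qed.

Lemma dot_max_norm y : Y y -> dot y y <= DY ^+ 2.
Proof.
move=> Yy; rewrite -enorm_sqr ler_pXn2r ?nnegrE ?enorm_ge0 ?max_norm_ub//.
exact: ltW.
Qed.

Lemma objective_bounded_in_y x : X x -> has_sup [set objective D f (x, y) | y in Y].
Proof.
move=> Xx; have [y0 Yy0] := Y_nonempty SA.
split; first by exists (F (x, y0)), y0.
exists (F (x, y0) + enorm (gy (x, y0)) * (2 * DY)) => _ [y Yy <-].
apply: le_trans (objective_concave_grad SA Xx Yy0 Yy) _.
rewrite lerD2l; apply: le_trans (CauchySchwarz _ _) _.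
rewrite ler_wpM2l ?enorm_ge0//; apply: le_trans (enorm_add_le _ _) _.
by rewrite enormN mulr2n mulrDl mul1r lerD ?max_norm_ub.
Qed.

Lemma phi_ub x y : X x -> Y y -> F (x, y) <= ph x.
Proof.
by move=> Xx Yy; apply: (sup_upper_bound (objective_bounded_in_y Xx)); exists y.
Qed.

Lemma phi_lub x (c : R) : X x -> (forall y, Y y -> F (x, y) <= c) -> ph x <= c.
Proof.
move=> Xx H; apply: ge_sup; first exact: (objective_bounded_in_y Xx).1.
by move=> _ [y Yy <-]; exact: H.
Qed.

Lemma phi_inf_le x : X x -> phi_inf X Y D f <= ph x.
Proof. by move=> Xx; apply: ge_inf; [exact: phi_bounded_below SA|exists x]. Qed.

Lemma moreauE : moreau X Y D f L = envelope X L ph.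
Proof.
apply/funext => z; rewrite /moreau /envelope; congr inf.
by apply/seteqP; split => _ [x Xx <-]; exists x => //; rewrite enorm_sqr.
Qed.

Lemma S_OS_sqrE z w0 : is_saddle X Y L F 0 z w0 ->
  S_OS X Y D f L z ^+ 2 = 4 * L ^+ 2 * dot (z - w0.1) (z - w0.1).
Proof.
move=> s0; rewrite /S_OS enorm_sqr.
suff -> : grad (moreau X Y D f L) z = (2 * L) *: (z - w0.1).
  by rewrite dotZl dotZr; absdot; cl; lra.
apply/rowP => i; rewrite !mxE moreauE.
rewrite (derive_envelope SS phi_ub phi_lub (delta_mx 0 i) s0); congr (_ * _).
rewrite /dot (bigD1 i) //= !mxE !eqxx mulr1 big1 ?addr0// => j ji.
by rewrite !mxE (negbTE ji) andbF mulr0.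
Qed.

(** |z - w0.1|^2 <= 2 |z - w.1|^2 + 2 |w.1 - w0.1|^2, where w0 is the saddle point
    without regularization. *)
Lemma S_OS_le (tau : R) z w : 0 <= tau -> is_saddle X Y L F tau z w ->
  S_OS X Y D f L z ^+ 2 <= 8 * L ^+ 2 * dot (z - w.1) (z - w.1) + 4 * L * tau * DY ^+ 2.
Proof.
move=> tau0 sw; have [w0 s0] := saddle_exists SS (lexx 0) z.
rewrite (S_OS_sqrE s0).
have b := saddle_bias tau0 dot_max_norm sw s0.
have t : dot (z - w0.1) (z - w0.1) <= 2 * dot (z - w.1) (z - w.1) + 2 * dot (w.1 - w0.1) (w.1 - w0.1).
  have -> : z - w0.1 = (z - w.1) + (w.1 - w0.1) by rewrite addrA subrK.
  exact: dot_add_le.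
have := ler_wpM2l (ltW L0) b; have := ler_wpM2l (sqr_ge0 L) t.
by move: (DY ^+ 2) => q; absdot; cl; lra.
Qed.

Lemma saddle_value_lower (tau : R) z w : 0 <= tau -> is_saddle X Y L F tau z w ->
  phi_inf X Y D f - tau / 2 * DY ^+ 2 <= Phi L F tau z w.1 w.2.
Proof.
case: w => x y tau0 [/= Xx Yy _ h2].
have : ph x <= Phi L F tau z x y + tau / 2 * DY ^+ 2.
  apply: phi_lub => // y' Yy'.
  have := h2 _ Yy'; have := ler_wpM2l tau0 (dot_max_norm Yy').
  have := mulr_ge0 tau0 (dot_ge0 (y' - y)).
  have := mulr_ge0 (ltW L0) (dot_ge0 (x - z)).
  rewrite /Phi; move: (F _) (F _) (DY ^+ 2) => e1 e2 e3; absdot; cl; lra.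
have := phi_inf_le Xx; by move: (Phi _ _ _ _ _ _) (phi_inf _ _ _ _) (ph x) (DY ^+ 2) => e1 e2 e3 e4; cl; lra.
Qed.

(** At the start the momentum and the normal vectors vanish and z = x, so the energy
    only contains the initial gradient, tau y0, the dual diameter and the gap. *)
Lemma potential_init (tau a : R) x0 y0 w : 0 < tau -> tau <= L ->
  0 < a -> 11 * a <= L -> a ^+ 2 = L * tau / 128 -> X x0 -> Y y0 ->
  is_saddle X Y L F tau x0 w ->
  potential (gx := gx) (gy := gy) (L := L) (F := F) (tau := tau) (a := a) x0 x0 y0 0 0 0 w
    - L * (phi_inf X Y D f - tau / 2 * DY ^+ 2) <= L * initial_quantity X Y D f L x0 y0.
Proof.
case: w => x y tau0 tauL a0 aL a2 Xx0 Yy0 [/= Xx Yy h1 h2].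
have p1 := h1 _ Xx0; have p2 := phi_ub Xx0 Yy.
have p3 := objective_concave_grad SA Xx0 Yy0 Yy; rewrite -/F -/(gy (x0, y0)) in p3.
have p4 : dot (gy (x0, y0)) (y - y0) <= 2 * DY * enorm (gy (x0, y0)).
  apply: le_trans (CauchySchwarz _ _) _; rewrite mulrC ler_wpM2r ?enorm_ge0//.
  apply: le_trans (enorm_add_le _ _) _.
  by rewrite enormN mulr2n mulrDl mul1r lerD ?max_norm_ub.
have p5 := dot_max_norm Yy0; have p6 := dot_max_norm Yy.
rewrite /initial_quantity; cbv zeta.
rewrite (_ : (grad2 (objective D f) (x0, y0)).1 = gx (x0, y0)) //.
rewrite (_ : (grad2 (objective D f) (x0, y0)).2 = gy (x0, y0)) //.
rewrite -/F -/DY -/ph /potential /energy /kinetic /resx /resy.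
rewrite -[(x, y).1]/x -[(x, y).2]/y.
move: (gx (x0, y0)) (gy (x0, y0)) p3 p4 => G H p3 p4.
rewrite !subrr !subr0 !scaler0 !addr0 !add0r !enorm_sqr !dot0r.
have p7 := dot_sub_le H (tau *: y0).
rewrite [dot (tau *: y0) _]dotZl [dot y0 (tau *: y0)]dotZr in p7.
have p8 := dot_sub_le y0 y.
have La0 : 0 <= L - a by move: aL a0; cl; lra.
have t2 : tau * (tau * dot y0 y0) <= L * (tau * DY ^+ 2).
  apply: le_trans (_ : L * (tau * dot y0 y0) <= _).
    by rewrite ler_wpM2r // mulr_ge0 ?dot_ge0 // ltW.
  by rewrite ler_wpM2l ?(ltW L0)// ler_wpM2l // ltW.
have t3 : a / 2 * (a / 2 * dot (y0 - y) (y0 - y)) <= 128^-1 * (L * (tau * DY ^+ 2)).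
  have -> : a / 2 * (a / 2 * dot (y0 - y) (y0 - y)) = 4^-1 * (a ^+ 2 * dot (y0 - y) (y0 - y)).
    by absdot; cl; lra.
  rewrite a2; have e : dot (y0 - y) (y0 - y) <= 4 * DY ^+ 2.
    by move: p5 p6 p8; move: (DY ^+ 2) => q; absdot; cl; lra.
  have := ler_wpM2l (ltW L0) (ler_wpM2l (ltW tau0) e).
  by move: (DY ^+ 2) => q; absdot; cl; lra.
have gap : Phi L F tau x0 x y - Phi L F tau x0 x0 y0 <= 2 * DY * enorm H + 2^-1 * (tau * DY ^+ 2).
  have l0 := mulr_ge0 (ltW L0) (dot_ge0 (x0 - x)).
  have l1 := mulr_ge0 (ltW tau0) (dot_ge0 y).
  have l2 := ler_wpM2l (ltW tau0) p5.
  move: p1 p3 p4 l0 l1 l2; rewrite /Phi subrr dot0r.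
  move: (F _) (F _) (F _) (enorm H) (DY) => e1 e2 e3 e4 e5; absdot; cl; lra.
have gap0 : 0 <= 2 * DY * enorm H + 2^-1 * (tau * DY ^+ 2).
  by rewrite addr_ge0 // !mulr_ge0 ?enorm_ge0 ?sqr_ge0 ?(ltW D0) ?(ltW tau0) ?invr_ge0.
have gap2 : 3 / 4 * (L - a) * (Phi L F tau x0 x y - Phi L F tau x0 x0 y0) <=
   L * (2 * DY * enorm H + 2^-1 * (tau * DY ^+ 2)).
  apply: le_trans (_ : 3 / 4 * (L - a) * (2 * DY * enorm H + 2^-1 * (tau * DY ^+ 2)) <= _).
    by rewrite ler_wpM2l // mulr_ge0.
  by rewrite ler_wpM2r //; move: a0 aL La0; cl; lra.
have val : Phi L F tau x0 x y <= ph x0.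
  have l0 := mulr_ge0 (ltW L0) (dot_ge0 (x0 - x)).
  have l1 := mulr_ge0 (ltW tau0) (dot_ge0 y).
  move: p1 p2 l0 l1; rewrite /Phi subrr dot0r.
  move: (F _) (F _) (ph x0) => e1 e2 e3; absdot; cl; lra.
have tD : L * (tau * DY ^+ 2) <= L * (L * DY ^+ 2).
  by rewrite ler_wpM2l ?(ltW L0)// ler_wpM2r // sqr_ge0.
have LD0 : 0 <= L * (L * DY ^+ 2).
  exact: mulr_ge0 (ltW L0) (mulr_ge0 (ltW L0) (sqr_ge0 DY)).
have val2 := ler_wpM2l (ltW L0) val.
have -> : L * (ph x0 - phi_inf X Y D f + 2 * DY * enorm H + (dot G G + 2 * dot H H) / L +
   (3 + 64^-1) * L * DY ^+ 2) = L * ph x0 - L * phi_inf X Y D f + L * (2 * DY * enorm H)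
   + (dot G G + 2 * dot H H) + (3 + 64^-1) * (L * (L * DY ^+ 2)).
  by field; rewrite gt_eqF.
have G0 := dot_ge0 G; have H0 := dot_ge0 H; rewrite dotZl dotZr.
move: gap2 val2 p7 t2 t3 tD LD0 G0 H0.
move: (Phi _ _ _ _ _ _) (Phi _ _ _ _ _ _) (ph x0) (phi_inf _ _ _ _) (enorm H) DY => e1 e2 e3 e4 e5 e6.
by absdot; cl; lra.
Qed.

End Problem.

(** * Pathwise bounds along a run *)

Definition sqn {R : realType} {n p : nat} (u : 'rV[R]_n * 'rV[R]_p) : R :=
  dot u.1 u.1 + dot u.2 u.2.

Section Requests.
Context {R : realType} {n p : nat}.
Notation pt := ('rV[R]_n * 'rV[R]_p)%type.
Variables (X : set 'rV[R]_n) (Y : set 'rV[R]_p) (L : R) (c : @params R).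
Variables (rq : @estimator R n p) (x0 : 'rV[R]_n) (y0 : 'rV[R]_p).

Definition at_run (t : nat) := run X Y L c rq x0 y0 t.

(** Pairs of a query point and the estimate returned there. The third pair is read off
    from the state, which keeps it for the next iteration. *)
Definition ask0 (t : nat) : pt * pt :=
  let s := at_run t in let u := (x_of s, y_of s) in
  (u, rq (3 * t)%N (last_of s) u).

Definition ask1 (t : nat) : pt * pt :=
  let s := at_run t in let g0 := (ask0 t).2 in
  let u := (proj X (x_of s - h_of c *: (g0.1 + (2 * L) *: (x_of s - z_of s) + xi_of s)),
            proj Y (y_of s + h_of c *: (g0.2 - tau_of c *: y_of s - n_of s + v_of s))) in
  (u, rq (3 * t + 1)%N (ask0 t) u).

Definition ask2 (t : nat) : pt * pt := last_of (at_run t.+1).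

(** All requests in the order in which they are made. Locked: its recursion over
    iterations must not be unfolded by conversion. *)
Definition ask : nat -> pt * pt := locked (fun j : nat =>
  match (j %% 3)%N with
  | 0 => ask0 (j %/ 3)%N | 1 => ask1 (j %/ 3)%N | _ => ask2 (j %/ 3)%N end).

Lemma ask_3t t : ask (3 * t)%N = ask0 t.
Proof. by rewrite /ask -lock mulnC modnMl mulnK. Qed.

Lemma ask_3t1 t : ask (3 * t + 1)%N = ask1 t.
Proof. by rewrite /ask -lock mulnC modnMDl divnMDl// addn0. Qed.

Lemma ask_3t2 t : ask (3 * t + 2)%N = ask2 t.
Proof. by rewrite /ask -lock mulnC modnMDl divnMDl// addn0. Qed.

Lemma runS t (s := at_run t) (s' := at_run t.+1) (g0 := (ask0 t).2)
    (g1 := (ask1 t).2) (u1 := (ask1 t).1)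
    (vbar := alpha_of c *: v_of s + k_of c *: (g1.2 - tau_of c *: u1.2)) :
  [/\ x_of s' = proj X (x_of s - h_of c *: (g1.1 + (2 * L) *: (u1.1 - z_of s))),
      y_of s' = proj Y (y_of s + h_of c *: (g1.2 - tau_of c *: u1.2 + vbar)),
      xi_of s' = (h_of c)^-1 *: (x_of s - x_of s') - g1.1 - (2 * L) *: (u1.1 - z_of s),
      n_of s' = (1 + k_of c)^-1 *: ((h_of c)^-1 *: (y_of s - y_of s') + g1.2
                  - tau_of c *: u1.2 + vbar) &
   [/\ z_of s' = z_of s + beta_of c *: (x_of s' - z_of s),
      v_of s' = alpha_of c *: v_of s
        + k_of c *: ((ask2 t).2.2 - tau_of c *: y_of s' - n_of s'),
      (ask2 t).1 = (x_of s', y_of s') &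
      (ask2 t).2 = rq (3 * t + 2)%N (ask1 t) (x_of s', y_of s')]].
Proof.
rewrite /vbar /u1 /g1 /g0 /s' /s /ask2 /ask1 /ask0 /at_run /=.
by case: (run X Y L c rq x0 y0 t) => x y z xi nu v l; case: c => *; split.
Qed.

(** The last request of an iteration is stored in the state, so that every request
    after the initial one sees its predecessor. *)
Lemma ask_rec j : (0 < j)%N -> (ask j).2 = rq j (ask j.-1) (ask j).1.
Proof.
move=> j0; have : (j %% 3 < 3)%N by rewrite ltn_mod.
rewrite {-1}(divn_eq j 3) mulnC; move: (j %/ 3)%N (j %% 3)%N (divn_eq j 3) => t r jE.
case: r jE => [|[|[|//]]] jE _.
- case: t jE => [|t] jE; first by rewrite jE in j0.
  rewrite addn0 ask_3t (_ : (3 * t.+1).-1 = 3 * t + 2)%N; last by lia.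
  by rewrite ask_3t2.
- by rewrite (_ : (3 * t + 1).-1 = 3 * t)%N ?ask_3t ?ask_3t1// addn1.
- rewrite (_ : (3 * t + 2).-1 = 3 * t + 1)%N; last by rewrite addn1 addn2.
  rewrite ask_3t1 ask_3t2.
  by have [_ _ _ _ [_ _ -> ->]] := runS t.
Qed.

(** So the request that opens an iteration adds no displacement, and the two others
    are those that the energy balance dissipates. *)
Lemma ask_stay t : (ask (3 * t + 3)%N).1 = (ask (3 * t + 2)%N).1.
Proof.
rewrite (_ : 3 * t + 3 = 3 * t.+1)%N; last by lia.
by rewrite ask_3t ask_3t2; have [_ _ _ _ [_ _ -> _]] := runS t.
Qed.

End Requests.

Lemma sum3 {R : realType} (G : nat -> R) T :
  \sum_(t < T) (G (3 * t)%N + G (3 * t + 1)%N + G (3 * t + 2)%N) = \sum_(j < 3 * T) G j.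
Proof.
elim: T => [|T IH]; first by rewrite muln0 !big_ord0.
by rewrite mulnS addnC addn3 !big_ord_recr /= IH !addrA addn1 addn2.
Qed.

Lemma telescope_le {R : realType} (V A B C Q G : nat -> R) T :
  (forall t, V t.+1 + A t + B t + C t <=
     V t + Q t + 6 * (G (3 * t)%N + G (3 * t + 1)%N + G (3 * t + 2)%N)) ->
  V T + \sum_(t < T) (A t + B t + C t) <=
  V 0%N + \sum_(t < T) Q t + 6 * \sum_(j < 3 * T) G j.
Proof.
rewrite -sum3 => H; elim: T => [|T IH]; first by rewrite !big_ord0 mulr0 !addr0.
rewrite !big_ord_recr /=; have := H T; move: IH; clear H.
by move: (bigop _ _ _) (bigop _ _ _) (bigop _ _ _) => b1 b2 b3; lra.
Qed.

Lemma sqn_sum_le {R : realType} {n p : nat} (A B C : 'rV[R]_n * 'rV[R]_p) :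
  dot A.1 A.1 + dot A.2 A.2 + dot B.1 B.1 + dot B.2 B.2 + dot C.2 C.2 <=
  sqn A + sqn B + sqn C.
Proof. by rewrite /sqn !addrA lerD2r lerDl dot_ge0. Qed.

Lemma inv_ge_of_small {R : realType} (be : R) :
  0 < be -> be <= (2112 * 256)^-1 -> 6 <= (400 * be)^-1.
Proof.
move=> be0 be1; rewrite -div1r ler_pdivlMr; first by move: be1; rewrite invfM; lra.
by apply: mulr_gt0 be0; rewrite ltr0n.
Qed.

Lemma scaled_shift {R : realType} m (k : R) (u c1 c2 u' q G : 'rV[R]_m) :
  u + k *: (q - c1 - c2) + u' = u + k *: (G - c1 - c2) + u' + k *: (q - G).
Proof. by apply/rowP => i; rewrite !mxE; ring. Qed.

Section Trajectory.
Context {R : realType} {n p : nat}.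
Notation pt := ('rV[R]_n * 'rV[R]_p)%type.
Context {X : set 'rV[R]_n} {Y : set 'rV[R]_p}.
Context {dS : measure_display} {S : measurableType dS} {D : probability S R}.
Context {f : pt -> S -> R^o} {gradf : pt -> S -> pt} {L : R}.
Hypothesis SA : standing_assumptions X Y D f gradf L.
Context {tau h a al k be : R}.
Hypothesis SP : step_params L tau h a al k be.
Variables (x0 : 'rV[R]_n) (y0 : 'rV[R]_p).
Hypotheses (Xx0 : X x0) (Yy0 : Y y0).
Variable rq : @estimator R n p.

Let F : pt -> R := objective D f.
Let gF := grad2 (objective D f).
Let DY := max_norm Y.
Let SS := saddle_structure SA.
Let c := Params tau h al k be.
Let L0 : 0 < L. Proof. exact: L_gt0 SA. Qed.
Let tau0 : 0 < tau := sp_tau0 SP.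
Let h0 : 0 < h := sp_h0 SP.
Let a0 : 0 < a := sp_a0 SP.

Definition saddle (z : 'rV[R]_n) : pt := get (is_saddle X Y L F tau z).

Lemma saddleP z : is_saddle X Y L F tau z (saddle z).
Proof. by have [w ?] := saddle_exists SS (ltW tau0) z; apply: getPex; exists w. Qed.

Let st := at_run X Y L c rq x0 y0.
Let req := ask X Y L c rq x0 y0.

Definition req_err (j : nat) : pt := (req j).2 - gF (req j).1.
Definition req_move (j : nat) : R := sqn ((req (j + 1)%N).1 - (req j).1).
Definition center_gap (t : nat) : R :=
  let z := z_of (st t) in dot (z - (saddle z).1) (z - (saddle z).1).
(** The momentum that multiplies the last gradient error of an iteration in the
    energy balance. *)
Definition mom (t : nat) : 'rV[R]_p :=
  v_of (st t.+1) + (a / 2) *: (y_of (st t.+1) - (saddle (z_of (st t))).2).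
(** The momentum [mom t] with the estimate replaced by the true gradient: it is
    known before the last request of iteration t is answered. *)
Definition mom0 (t : nat) : 'rV[R]_p :=
  al *: v_of (st t) + k *: ((gF (x_of (st t.+1), y_of (st t.+1))).2
     - tau *: y_of (st t.+1) - n_of (st t.+1))
  + (a / 2) *: (y_of (st t.+1) - (saddle (z_of (st t))).2).

Arguments req_err : simpl never.
Arguments req_move : simpl never.
Arguments center_gap : simpl never.
Arguments mom : simpl never.
Arguments mom0 : simpl never.

Lemma req_err_0 t :
  req_err (3 * t)%N = (ask0 X Y L c rq x0 y0 t).2 - gF (x_of (st t), y_of (st t)).
Proof. by rewrite /req_err /req ask_3t. Qed.

Lemma req_err_1 t :
  req_err (3 * t + 1)%N = (ask1 X Y L c rq x0 y0 t).2 - gF (ask1 X Y L c rq x0 y0 t).1.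
Proof. by rewrite /req_err /req ask_3t1. Qed.

Lemma req_2 t : (req (3 * t + 2)%N).1 = (x_of (st t.+1), y_of (st t.+1)).
Proof. by have [_ _ _ _ [_ _ <- _]] := runS X Y L c rq x0 y0 t; rewrite /req ask_3t2. Qed.

Lemma req_err_2 t :
  req_err (3 * t + 2)%N = (ask2 X Y L c rq x0 y0 t).2 - gF (x_of (st t.+1), y_of (st t.+1)).
Proof. by rewrite /req_err req_2 /req ask_3t2. Qed.

Lemma req_move_0 t :
  req_move (3 * t)%N = sqn ((ask1 X Y L c rq x0 y0 t).1 - (x_of (st t), y_of (st t))).
Proof. by rewrite /req_move /req ask_3t ask_3t1. Qed.

Lemma req_move_1 t :
  req_move (3 * t + 1)%N =
    sqn ((x_of (st t.+1), y_of (st t.+1)) - (ask1 X Y L c rq x0 y0 t).1).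
Proof.
rewrite /req_move (_ : (3 * t + 1 + 1 = 3 * t + 2)%N); last by rewrite -addnA.
by rewrite req_2 /req ask_3t1.
Qed.

Lemma req_stay t : req_move (3 * t + 2)%N = 0.
Proof.
rewrite /req_move (_ : (3 * t + 2 + 1 = 3 * t + 3)%N); last by rewrite -addnA.
by rewrite /req ask_stay subrr /sqn !dot0r addr0.
Qed.

Lemma momE t : mom t = mom0 t + k *: (req_err (3 * t + 2)%N).2.
Proof.
rewrite req_err_2 /mom /mom0.
have [_ _ _ _ [_ -> _ _]] := runS X Y L c rq x0 y0 t; rewrite -/st.
move: (gF _) (ask2 _ _ _ _ _ _ _ _).2 => [Gx G] [qx q] /=.
move: (al *: _) (n_of _) (tau *: _) ((a / 2) *: _) => g3 g4 g5 g6.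
exact: scaled_shift.
Qed.

Let pot t := potential (gx := fun z => (gF z).1) (gy := fun z => (gF z).2)
  (L := L) (F := F) (tau := tau) (a := a) (z_of (st t)) (x_of (st t)) (y_of (st t)) (xi_of (st t))
  (n_of (st t)) (v_of (st t)) (saddle (z_of (st t))).

Let good t := [/\ X (x_of (st t)), Y (y_of (st t)), normal_at X (x_of (st t)) (xi_of (st t)) &
   normal_at Y (y_of (st t)) (n_of (st t))].

Let run_step t : good t ->
  [/\ good t.+1, X (req (3 * t + 1)%N).1.1 /\ Y (req (3 * t + 1)%N).1.2 &
  pot t.+1 + be * L ^+ 2 * center_gap t
    + be * L ^+ 2 * (req_move (3 * t)%N + req_move (3 * t + 1)%N)
    + 10^-1 * (h * a) * dot (mom t) (mom t) <=
  pot t + 3 / 2 * (h * (L / 2 - a)) * dot (mom t) (req_err (3 * t + 2)%N).2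
    + 6 * (sqn (req_err (3 * t)%N) + sqn (req_err (3 * t + 1)%N) + sqn (req_err (3 * t + 2)%N))].
Proof.
move=> [Xx Yy nx ny].
have [xE yE xiE nE [zE vE q2E _]] := runS X Y L c rq x0 y0 t.
have [] := potential_step SS SP Xx Yy nx ny (saddleP (z_of (st t)))
  (saddleP (z_of (st t.+1))) (g0 := (ask0 X Y L c rq x0 y0 t).2)
  (g1 := (ask1 X Y L c rq x0 y0 t).2) (g2 := (ask2 X Y L c rq x0 y0 t).2)
  erefl erefl erefl xE xiE yE nE vE zE.
move=> [Xt Yt] [X1 Y1] [nx1 ny1] H; split => //.
  by rewrite /req ask_3t1.
rewrite req_err_0 req_err_1 req_err_2 req_move_0 req_move_1; apply: le_trans H _.
rewrite lerD2l ler_pM2l; last by rewrite ltr0n.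
exact: (sqn_sum_le ((ask0 X Y L c rq x0 y0 t).2 - gF (x_of (st t), y_of (st t)))
  ((ask1 X Y L c rq x0 y0 t).2 - gF (ask1 X Y L c rq x0 y0 t).1)
  ((ask2 X Y L c rq x0 y0 t).2 - gF (x_of (st t.+1), y_of (st t.+1)))).
Qed.

Lemma run_good t : good t.
Proof.
elim: t => [|t /run_step[]//]; split => // x' _; rewrite /st /= dot0l //.
Qed.

Lemma req_in j : X (req j).1.1 /\ Y (req j).1.2.
Proof.
rewrite /req; have : (j %% 3 < 3)%N by rewrite ltn_mod.
rewrite {-1}(divn_eq j 3) mulnC; move: (j %/ 3)%N (j %% 3)%N => t [|[|[|//]]] _.
- by rewrite !addn0 !ask_3t; have [] := run_good t.
- by have [] := run_step (run_good t).
- have [_ _ _ _ [_ _ q _]] := runS X Y L c rq x0 y0 t.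
  by rewrite ask_3t2 q; have [] := run_good t.+1.
Qed.

Let run_energy T :
  \sum_(t < T) (be * L ^+ 2 * center_gap t
    + be * L ^+ 2 * (req_move (3 * t)%N + req_move (3 * t + 1)%N)
    + 10^-1 * (h * a) * dot (mom t) (mom t)) <=
  L * initial_quantity X Y D f L x0 y0
  + \sum_(t < T) (3 / 2 * (h * (L / 2 - a)) * dot (mom t) (req_err (3 * t + 2)%N).2)
  + 6 * \sum_(j < 3 * T) sqn (req_err j).
Proof.
have := telescope_le T (V := pot) (A := fun t => be * L ^+ 2 * center_gap t)
  (B := fun t => be * L ^+ 2 * (req_move (3 * t)%N + req_move (3 * t + 1)%N))
  (C := fun t => 10^-1 * (h * a) * dot (mom t) (mom t))
  (Q := fun t => 3 / 2 * (h * (L / 2 - a)) * dot (mom t) (req_err (3 * t + 2)%N).2)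
  (G := fun j => sqn (req_err j))
  (fun t => let: And3 _ _ H := run_step (run_good t) in H).
have i0 := potential_init SA tau0 (sp_tauL SP) a0 (sp_aL SP) (sp_a2 SP) Xx0 Yy0 (saddleP x0).
have [Xx Yy nx ny] := run_good T.
have i1 := potential_lower SS SP (v_of (st T)) Xx Yy nx ny (saddleP (z_of (st T))).
have i2 := ler_wpM2l (ltW L0) (saddle_value_lower SA (ltW tau0) (saddleP (z_of (st T)))).
move: i0 i1 i2; rewrite -/(pot T).
have -> : potential (gx := fun z => (gF z).1) (gy := fun z => (gF z).2)
  (L := L) (F := F) (tau := tau) (a := a) x0 x0 y0 0 0 0 (saddle x0) = pot 0 by [].
move: (pot _) (pot _) (initial_quantity _ _ _ _ _ _ _) (Phi _ _ _ _ _ _) => p1 p2 q r.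
move: (bigop _ _ _) (bigop _ _ _) (bigop _ _ _) (phi_inf _ _ _ _ - _) => *; lra.
Qed.

Let hc_bounds : 0 <= h * (L / 2 - a) /\ h * (L / 2 - a) <= 384^-1.
Proof.
have aL := sp_aL SP; have hL := hL_le SP.
have q1 := mulr_gt0 h0 a0; have q2 := ler_wpM2l (ltW h0) aL.
by split; move: q1 q2 hL; move: (SP) => _; lra.
Qed.

Let be_bounds : 0 < be /\ be <= (2112 * 256)^-1.
Proof.
have q := mulr_gt0 h0 a0; have q2 := ha_le SP; rewrite (sp_be SP); split; first exact: divr_gt0.
by rewrite invfM ler_wpM2r.
Qed.

Let sqn_ge0 m m' (u : 'rV[R]_m * 'rV[R]_m') : 0 <= sqn u.
Proof. by rewrite addr_ge0 ?dot_ge0. Qed.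

Let sum_third (G : nat -> R) T : (forall j, 0 <= G j) ->
  \sum_(t < T) G (3 * t + 2)%N <= \sum_(j < 3 * T) G j.
Proof.
move=> G0; rewrite -sum3; apply: ler_sum => t _.
by rewrite lerDr addr_ge0.
Qed.

(** The difference of mom and mom0 is k times the error, so that
    replacing one by the other costs a small multiple of the squared error. *)
Lemma run_bound_unbiased T :
  \sum_(t < T) (be * L ^+ 2 * center_gap t) <=
  L * initial_quantity X Y D f L x0 y0
  + \sum_(t < T) (3 / 2 * (h * (L / 2 - a)) * dot (mom0 t) (req_err (3 * t + 2)%N).2)
  + 7 * \sum_(j < 3 * T) sqn (req_err j).
Proof.
have [hc0 hc1] := hc_bounds; have [be0 _] := be_bounds.
have [k0 k1] := k_bounds SS SP.
have H : \sum_(t < T) (3 / 2 * (h * (L / 2 - a)) * dot (mom t) (req_err (3 * t + 2)%N).2) <=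
  \sum_(t < T) (3 / 2 * (h * (L / 2 - a)) * dot (mom0 t) (req_err (3 * t + 2)%N).2)
  + \sum_(j < 3 * T) sqn (req_err j).
  apply: le_trans (lerD (lexx _) (sum_third T (fun j => sqn_ge0 (req_err j)))).
  rewrite -big_split; apply: ler_sum => t _; rewrite -[leRHS]/(_ + _).
  rewrite momE dotDl dotZl mulrDr lerD2l /sqn.
  move: (req_err _) => [e1 e2]; rewrite -[(e1, e2).1]/e1 -[(e1, e2).2]/e2.
  rewrite mulrA; apply: (@le_trans _ _ (1 * dot e2 e2)); last first.
    by rewrite mul1r lerDr dot_ge0.
  rewrite ler_wpM2r ?dot_ge0//.
  have kk : h * (L / 2 - a) * k <= 384^-1 * 384^-1 by rewrite ler_pM.
  by rewrite -(mulrA (3 / 2)); move: kk; move: (h * _ * k) (SP) => r _; lra.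
apply: le_trans (_ : _ <= _) (le_trans (run_energy T) _).
  apply: ler_sum => t _; rewrite -addrA lerDl; apply: addr_ge0.
    apply: mulr_ge0; first exact: mulr_ge0 (ltW be0) (sqr_ge0 L).
    exact: addr_ge0 (sqn_ge0 _) (sqn_ge0 _).
  by rewrite !mulr_ge0 ?dot_ge0 ?(ltW h0) ?(ltW a0).
move: H; move: (bigop _ _ _) (bigop _ _ _) (bigop _ _ _) (initial_quantity _ _ _ _ _ _ _).
by move: (SP) => _ *; lra.
Qed.

(** The pairing of momentum and error is split by Young's inequality against the
    dissipated square of the momentum; since h a = 256 be, the error then carries
    the weight 1 / be. *)
Lemma run_bound_recursive T :
  \sum_(t < T) (be * L ^+ 2 * center_gap t) + be * L ^+ 2 * \sum_(j < 3 * T) req_move j <=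
  L * initial_quantity X Y D f L x0 y0
  + (200 * be)^-1 * \sum_(j < 3 * T) sqn (req_err j).
Proof.
have [hc0 hc1] := hc_bounds; have [be0 be1] := be_bounds.
have ib : 6 <= (400 * be)^-1.
  by apply: inv_ge_of_small.
have M : \sum_(j < 3 * T) req_move j =
   \sum_(t < T) (req_move (3 * t)%N + req_move (3 * t + 1)%N).
  by rewrite -sum3; apply: eq_bigr => t _; rewrite req_stay addr0.
have H : \sum_(t < T) (3 / 2 * (h * (L / 2 - a)) * dot (mom t) (req_err (3 * t + 2)%N).2) <=
  \sum_(t < T) (10^-1 * (h * a) * dot (mom t) (mom t))
  + (400 * be)^-1 * \sum_(j < 3 * T) sqn (req_err j).
  have S0 := sum_third T (fun j => sqn_ge0 (req_err j)).
  have ib0 : 0 <= (400 * be)^-1 by rewrite invr_ge0; apply: mulr_ge0 (ltW be0); rewrite ler0n.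
  apply: le_trans (lerD (lexx _) (ler_wpM2l ib0 S0)).
  rewrite mulr_sumr -big_split; apply: ler_sum => t _; rewrite -[leRHS]/(_ + _).
  have -> : h * a = 256 * be by rewrite (sp_be SP) mulrCA divff ?mulr1// pnatr_eq0.
  have e20 : dot (req_err (3 * t + 2)%N).2 (req_err (3 * t + 2)%N).2 <= sqn (req_err (3 * t + 2)%N).
    by rewrite /sqn lerDr dot_ge0.
  have be10 : 0 < 10 * be by rewrite mulr_gt0.
  have Y1 := young (mom t) (req_err (3 * t + 2)%N).2 be10.
  have c0 : 0 <= 3 / 2 * (h * (L / 2 - a)) by rewrite mulr_ge0.
  have := ler_wpM2l c0 Y1.
  have u0 := dot_ge0 (mom t); have e0 := dot_ge0 (req_err (3 * t + 2)%N).2.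
  have r1 := ler_wpM2r (mulr_ge0 (ltW be0) u0) hc1.
  have ibe : 0 <= be^-1 by rewrite invr_ge0 ltW.
  have r2 := ler_wpM2r (mulr_ge0 ibe e0) hc1.
  have r3 := ler_wpM2l ibe e20; have r4 := mulr_ge0 (ltW be0) u0.
  have r5 := mulr_ge0 ibe e0.
  rewrite !invfM.
  move: r1 r2 r3 r4 r5; move: (dot _ _) (dot _ _) (dot _ _) (sqn _) (be^-1) (h * _) (SP).
  by move=> q1 q2 q3 q4 q5 q6 _; lra.
have E : be * L ^+ 2 * \sum_(t < T) center_gap t + be * L ^+ 2 * \sum_(j < 3 * T) req_move j
    + 10^-1 * (h * a) * \sum_(t < T) dot (mom t) (mom t) <=
   L * initial_quantity X Y D f L x0 y0
   + 3 / 2 * (h * (L / 2 - a)) * \sum_(t < T) dot (mom t) (req_err (3 * t + 2)%N).2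
   + 6 * \sum_(j < 3 * T) sqn (req_err j).
  by have := run_energy T; rewrite 2!big_split -!mulr_sumr -M.
have S0 : 0 <= \sum_(j < 3 * T) sqn (req_err j) by apply: sumr_ge0 => j _; exact: sqn_ge0.
have S1 := ler_wpM2r S0 ib.
rewrite -!mulr_sumr in H *.
have -> : (200 * be)^-1 = (400 * be)^-1 + (400 * be)^-1 by field; rewrite gt_eqF.
move: E H S1; move: (bigop _ _ _) (bigop _ _ _) (bigop _ _ _) (bigop _ _ _) (bigop _ _ _).
move: (initial_quantity _ _ _ _ _ _ _) ((400 * be)^-1) (SP).
by move=> q1 q2 _ q3 q4 q5 q6 q7; lra.
Qed.

End Trajectory.

(** * Expectations and sub-sigma-algebras *)

Section Expectation.
Context {R : realType} {d : measure_display} {Omega : measurableType d}.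
Variable P : probability Omega R.
Implicit Types (f g U Z : Omega -> R) (A : set (set Omega)).

Definition summable f := P.-integrable setT (EFin \o f).
Definition mean f : R := Rintegral P setT f.
(** The conditional expectation of Z given A vanishes, for integrable Z. *)
Definition centered A Z := forall G, A G -> (\int[P]_(o in G) (Z o)%:E = 0)%E.

Lemma summable_meas f : summable f -> measurable_fun setT f.
Proof. by move=> /measurable_int /measurable_EFinP. Qed.

Lemma summableD f g : summable f -> summable g -> summable (fun o => f o + g o).
Proof. by move=> sf sg; apply: (integrableD measurableT sf sg). Qed.

Lemma summableB f g : summable f -> summable g -> summable (fun o => f o - g o).
Proof. by move=> sf sg; apply: (integrableB measurableT sf sg). Qed.

Lemma summableZ (k : R) f : summable f -> summable (fun o => k * f o).
Proof. by move=> sf; apply: (integrableZl measurableT k sf). Qed.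

Lemma summable_cst (k : R) : summable (fun=> k).
Proof. exact: (finite_measure_integrable_cst P). Qed.

Lemma summable_sum (I : Type) (s : seq I) (F : I -> Omega -> R) :
  (forall i, summable (F i)) -> summable (fun o => \sum_(i <- s) F i o).
Proof.
move=> sF; elim: s => [|i s IH].
  by under [X in summable X]funext do rewrite big_nil; exact: summable_cst.
under [X in summable X]funext do rewrite big_cons; exact: summableD.
Qed.

Lemma summable_le f g : measurable_fun setT f -> summable g ->
  (forall o, `|f o| <= g o) -> summable f.
Proof.
move=> mf sg fg; apply: (le_integrable measurableT _ _ sg); first exact/measurable_EFinP.
by move=> o _ /=; rewrite lee_fin (le_trans (fg o)) // ler_norm.
Qed.

Lemma summable_abs f : summable f -> summable (fun o => `|f o|).
Proof. by move=> sf; exact: (integrable_norm sf). Qed.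

Lemma meanD f g : summable f -> summable g -> mean (fun o => f o + g o) = mean f + mean g.
Proof. exact: RintegralD. Qed.

Lemma meanB f g : summable f -> summable g -> mean (fun o => f o - g o) = mean f - mean g.
Proof. exact: RintegralB. Qed.

Lemma meanZ (k : R) f : summable f -> mean (fun o => k * f o) = k * mean f.
Proof. exact: RintegralZl. Qed.

Lemma mean_cst (k : R) : mean (fun=> k) = k.
Proof. by rewrite /mean Rintegral_cst//= (_ : P setT = 1%E) ?mulr1//; exact: probability_setT. Qed.

Lemma mean_ge0 f : (forall o, 0 <= f o) -> 0 <= mean f.
Proof. by move=> f0; apply: Rintegral_ge0. Qed.

Lemma mean_le f g : summable f -> summable g -> (forall o, f o <= g o) -> mean f <= mean g.
Proof. by move=> sf sg fg; apply: le_Rintegral. Qed.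

Lemma mean_sum (I : Type) (s : seq I) (F : I -> Omega -> R) :
  (forall i, summable (F i)) -> mean (fun o => \sum_(i <- s) F i o) = \sum_(i <- s) mean (F i).
Proof.
move=> sF; elim: s => [|i s IH].
  by rewrite big_nil (_ : (fun=> _) = fun=> 0) ?mean_cst//; apply/funext => o; rewrite big_nil.
rewrite big_cons -IH -meanD //; last exact: summable_sum.
by congr mean; apply/funext => o; rewrite big_cons.
Qed.

Lemma EFin_mean f : summable f -> ((mean f)%:E = \int[P]_o (f o)%:E)%E.
Proof. by move=> sf; rewrite fineK //; exact: integrable_fin_num. Qed.

Lemma summable_on f G : measurable G -> summable f -> P.-integrable G (EFin \o f).
Proof. by move=> mG; apply: integrableS. Qed.

Lemma summable_mul_sqr f g : measurable_fun setT f -> measurable_fun setT g ->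
  summable (fun o => f o ^+ 2) -> summable (fun o => g o ^+ 2) -> summable (fun o => f o * g o).
Proof.
move=> mf mg sf sg; apply: (summable_le _ (summableD sf sg)); first exact: measurable_funM.
move=> o; rewrite -(real_normK (num_real (f o))) -(real_normK (num_real (g o))) normrM.
have := sqr_ge0 (`|f o| - `|g o|); have := mulr_ge0 (normr_ge0 (f o)) (normr_ge0 (g o)).
by move: `|f o| `|g o| => a b; lra.
Qed.

End Expectation.

Section SubSigma.
Import HBNNSimple.
Context {R : realType} {d : measure_display} {Omega : measurableType d}.
Variable P : probability Omega R.
Implicit Types (f g U Z : Omega -> R) (A : set (set Omega)).

Lemma measurable_wrtP A f : sigma_algebra setT A ->
  measurable_wrt A f <-> measurable_fun [set: g_sigma_algebraType A] (f : g_sigma_algebraType A -> R).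
Proof.
move=> sA; split => [mf _ B mB|mf B mB].
  by rewrite setTI; apply: measurable_structure.sub_sigma_algebra; exact: mf.
by have := mf measurableT B mB; rewrite setTI /measurable/= sigma_algebra_id.
Qed.

Lemma measurable_wrtT A f : Defs.sub_sigma_algebra A -> measurable_wrt A f -> measurable_fun setT f.
Proof. by move=> [_ AT] mf _ B mB; rewrite setTI; apply: AT; exact: mf. Qed.

Lemma measurable_wrtS A A' f : A `<=` A' -> measurable_wrt A f -> measurable_wrt A' f.
Proof. by move=> AA mf B mB; apply: AA; exact: mf. Qed.

Lemma wrt_cst A (k : R) : sigma_algebra setT A -> measurable_wrt A (fun=> k).
Proof. by move=> sA; apply/measurable_wrtP. Qed.

Lemma wrtD A f g : sigma_algebra setT A -> measurable_wrt A f -> measurable_wrt A g ->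
  measurable_wrt A (fun o => f o + g o).
Proof.
move=> sA /(measurable_wrtP _ sA) mf /(measurable_wrtP _ sA) mg; apply/(measurable_wrtP _ sA).
exact: measurable_funD.
Qed.

Lemma wrtM A f g : sigma_algebra setT A -> measurable_wrt A f -> measurable_wrt A g ->
  measurable_wrt A (fun o => f o * g o).
Proof.
move=> sA /(measurable_wrtP _ sA) mf /(measurable_wrtP _ sA) mg; apply/(measurable_wrtP _ sA).
exact: measurable_funM.
Qed.

Lemma wrt_max0 A f : sigma_algebra setT A -> measurable_wrt A f ->
  measurable_wrt A (fun o => Num.max (f o) 0).
Proof.
move=> sA /(measurable_wrtP _ sA) mf; apply/(measurable_wrtP _ sA).
exact: measurable_maxr.
Qed.

Lemma wrtZ A (k : R) f : sigma_algebra setT A -> measurable_wrt A f ->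
  measurable_wrt A (fun o => k * f o).
Proof. by move=> sA; apply: wrtM => //; exact: wrt_cst. Qed.

Lemma wrt_sum A (I : Type) (s : seq I) (F : I -> Omega -> R) : sigma_algebra setT A ->
  (forall i, measurable_wrt A (F i)) -> measurable_wrt A (fun o => \sum_(i <- s) F i o).
Proof.
move=> sA mF; elim: s => [|i s IH].
  by under [X in measurable_wrt _ X]funext do rewrite big_nil; exact: wrt_cst.
by under [X in measurable_wrt _ X]funext do rewrite big_cons; apply: wrtD.
Qed.

Lemma centeredS A A' Z : A `<=` A' -> centered P A' Z -> centered P A Z.
Proof. by move=> AA cZ G AG; apply: cZ; exact: AA. Qed.

Lemma centeredD A Z Z' : Defs.sub_sigma_algebra A -> summable P Z -> summable P Z' ->
  centered P A Z -> centered P A Z' -> centered P A (fun o => Z o + Z' o).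
Proof.
move=> [_ AT] sZ sZ' cZ cZ' G AG; have mG := AT _ AG.
by rewrite integralD_EFin ?cZ ?cZ' ?adde0//; exact: summable_on.
Qed.

Lemma centeredZ A (k : R) Z : Defs.sub_sigma_algebra A -> summable P Z ->
  centered P A Z -> centered P A (fun o => k * Z o).
Proof.
move=> [_ AT] sZ cZ G AG; have mG := AT _ AG.
under eq_integral do rewrite EFinM.
by rewrite integralZl ?cZ ?mule0//; exact: summable_on.
Qed.

Let mean_simple A Z (s : seq R) (B : R -> set Omega) : Defs.sub_sigma_algebra A ->
  summable P Z -> centered P A Z -> (forall y, A (B y)) ->
  mean P (fun o => (\sum_(y <- s) y * \1_(B y) o) * Z o) = 0.
Proof.
move=> sA sZ cZ AB; have AT := sA.2.
have sB y : summable P (fun o => \1_(B y) o * Z o).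
  apply: (summable_le _ (summable_abs sZ)).
    by apply: measurable_funM; [exact: measurable_indic (AT _ (AB y))|exact: summable_meas sZ].
  move=> o; rewrite normrM indicE; case: (o \in B y) => /=; rewrite ?normr1 ?mul1r//.
  by rewrite normr0 mul0r.
transitivity (mean P (fun o => \sum_(y <- s) y * (\1_(B y) o * Z o))).
  by congr mean; apply/funext => o; rewrite mulr_suml; apply: eq_bigr => y _; rewrite mulrA.
rewrite mean_sum => [|y]; last exact: summableZ.
apply: big1 => y _; rewrite meanZ // (_ : mean P _ = 0) ?mulr0//.
rewrite /mean (_ : (fun o => _) = Z \_ (B y)); last first.
  by apply/funext => o; rewrite /patch indicE; case: (o \in B y); rewrite ?mul1r ?mul0r.
by rewrite -Rintegral_mkcond /Rintegral cZ.
Qed.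

(** Approximate U from below by simple functions measurable for A and pass to the
    limit by dominated convergence, with |U Z| as the dominating function. *)
Let mean_centered_ge0 A U Z : Defs.sub_sigma_algebra A -> measurable_wrt A U ->
  (forall o, 0 <= U o) -> summable P Z -> summable P (fun o => U o * Z o) ->
  centered P A Z -> mean P (fun o => U o * Z o) = 0.
Proof.
move=> sA mU U0 sZ sUZ cZ.
pose U' : g_sigma_algebraType A -> \bar R := EFin \o U.
have mU' : measurable_fun setT U' by apply/measurable_EFinP/measurable_wrtP => //; exact: sA.1.
pose phi := nnsfun_approx measurableT mU'.
pose ph k : g_sigma_algebraType A -> R := phi k.
have U'0 o : setT o -> (0 <= U' o)%E by move=> _; rewrite lee_fin.
have phiE k : ph k = approx setT U' k :> (Omega -> R) by rewrite /ph /phi nnsfun_approxE.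
have phi0 k o : 0 <= (ph k : Omega -> R) o by exact: (@fun_ge0 _ _ (phi k) o).
have phiU k o : (ph k : Omega -> R) o <= U o.
  by rewrite -lee_fin phiE; exact: le_approx.
have mphi k y : A ((ph k : Omega -> R) @^-1` [set y]).
  have := @measurable_sfunP _ _ _ _ (phi k) [set y] (measurable_set1 y).
  by rewrite /measurable/= sigma_algebra_id //; exact: sA.1.
have mZ := summable_meas sZ.
have phiZ k : mean P (fun o => (ph k : Omega -> R) o * Z o) = 0.
  transitivity (mean P (fun o => (\sum_(y <- fset_set (range (ph k : Omega -> R)))
      y * \1_((ph k : Omega -> R) @^-1` [set y]) o) * Z o)).
    by congr mean; apply/funext => o; congr (_ * _); rewrite /ph fimfunE fsbig_finite.
  exact: (mean_simple _ sA sZ cZ (mphi k)).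
have mphik k : measurable_fun [set: Omega] (ph k : Omega -> R).
  apply: (measurable_wrtT sA); apply/(measurable_wrtP _ sA.1); exact: measurable_funPT.
have sphi k : summable P (fun o => (ph k : Omega -> R) o * Z o).
  apply: (summable_le _ (summable_abs sUZ)); first exact: measurable_funM.
  move=> o; rewrite !normrM ler_wpM2r // ger0_norm // ger0_norm //.
have := @dominated_convergence _ _ _ P setT measurableT
  (fun k o => ((ph k : Omega -> R) o * Z o)%:E) (EFin \o (fun o => U o * Z o))
  (EFin \o (fun o => `|U o * Z o|)).
case.
- by move=> k; exact: measurable_int (sphi k).
- exact: measurable_int sUZ.
- apply: aeW => o _; apply: cvg_EFin; first exact: nearW.
  apply: cvgMl => //.
  have := cvg_nnsfun_approx measurableT mU' U'0 (x := o) I.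
  by move/fine_cvg.
- exact: summable_abs.
- apply: aeW => o k _ /=; rewrite lee_fin !normrM ler_wpM2r // ger0_norm // ger0_norm //.
move=> _ _; rewrite (_ : [sequence _]_n = fun=> 0%E); last first.
  by apply/funext => k /=; rewrite -EFin_mean// phiZ.
move=> H; have := cvg_unique _ H (cvg_cst 0%E).
by rewrite /= /mean /Rintegral => -> //; exact: ereal_hausdorff.
Qed.

(** An error that averages to zero over every event known before the sample is
    orthogonal to everything known before the sample. *)
Lemma mean_centered A U Z : Defs.sub_sigma_algebra A -> measurable_wrt A U ->
  summable P Z -> summable P (fun o => U o * Z o) ->
  centered P A Z -> mean P (fun o => U o * Z o) = 0.
Proof.
move=> sA mU sZ sUZ cZ.
have mN : measurable_wrt A (fun o => - U o).
  under [X in measurable_wrt _ X]funext do rewrite -mulN1r; exact: wrtZ sA.1 mU.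
have mA := wrt_max0 sA.1 mU; have mB := wrt_max0 sA.1 mN.
have sub (V : Omega -> R) : measurable_wrt A V -> (forall o, `|V o| <= `|U o|) ->
    summable P (fun o => V o * Z o).
  move=> mV VU; apply: (summable_le _ (summable_abs sUZ)).
    by apply: measurable_funM; [exact: measurable_wrtT sA mV|exact: summable_meas sZ].
  by move=> o; rewrite !normrM ler_wpM2r.
have s1 : summable P (fun o => Num.max (U o) 0 * Z o).
  by apply: sub => // o; case: (lerP (U o) 0); rewrite ?normr0.
have s2 : summable P (fun o => Num.max (- U o) 0 * Z o).
  by apply: sub => // o; case: (lerP (- U o) 0); rewrite ?normr0 ?normrN.
rewrite (_ : (fun o => _) = fun o => Num.max (U o) 0 * Z o - Num.max (- U o) 0 * Z o).
  rewrite meanB // (mean_centered_ge0 sA mA) ?(mean_centered_ge0 sA mB) ?subr0// => o.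
    by rewrite le_max lexx orbT.
  by rewrite le_max lexx orbT.
apply/funext => o; rewrite -mulrBl; congr (_ * _).
by case: (lerP (U o) 0); case: (lerP (- U o) 0); lra.
Qed.

End SubSigma.

(** * Square integrable random points *)

(** Both blocks of coordinates of a point under one index type. *)
Definition crd {R : realType} {n p : nat} (u : 'rV[R]_n * 'rV[R]_p) (c : 'I_n + 'I_p) : R :=
  match c with inl i => u.1 0 i | inr j => u.2 0 j end.

Section Coordinates.
Context {R : realType} {n p : nat}.
Notation pt := ('rV[R]_n * 'rV[R]_p)%type.
Implicit Types u v : pt.

Lemma sqn_crd u : sqn u = \sum_c crd u c ^+ 2.
Proof.
by rewrite big_sumType /=; congr (_ + _); apply: eq_bigr => i _; rewrite expr2.
Qed.

Lemma crd_le u c : crd u c ^+ 2 <= sqn u.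
Proof.
by rewrite sqn_crd (bigD1 c) //= lerDl sumr_ge0 // => i _; exact: sqr_ge0.
Qed.

Lemma crdB u v c : crd (u - v) c = crd u c - crd v c.
Proof. by case: c => i /=; rewrite !mxE. Qed.

Lemma sqn_lt u (e : R) : 0 <= e -> (forall c, `|crd u c| < e) -> sqn u <= (n + p)%:R * e ^+ 2.
Proof.
move=> e0 h; rewrite sqn_crd; apply: (@le_trans _ _ (\sum_(c : 'I_n + 'I_p) e ^+ 2)).
  by apply: ler_sum => c _; rewrite -real_normK ?num_real// ler_pXn2r ?nnegrE// ltW.
by rewrite sumr_const card_sum !card_ord mulr_natl.
Qed.

Lemma sqn_ge0 u : 0 <= sqn u.
Proof. by rewrite addr_ge0 ?dot_ge0. Qed.

Lemma open_crd (O : set pt) v : open O -> O v ->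
  exists2 e, 0 < e & forall v', (forall c, `|crd (v' - v) c| < e) -> O v'.
Proof.
rewrite openE => /[apply] /nbhs_ballP[e /= e0 H]; exists e => // v' v'v.
apply: H; split => /=.
  by split => // i j; rewrite (ord1 i) /ball/= distrC; have := v'v (inl j); rewrite crdB.
by split => // i j; rewrite (ord1 i) /ball/= distrC; have := v'v (inr j); rewrite crdB.
Qed.

(** Continuity for the product topology of the two blocks, from a Lipschitz bound
    in the Euclidean norm. *)
Lemma lipschitz_continuous (g : pt -> R) (K : R) : 0 <= K ->
  (forall a b, (g a - g b) ^+ 2 <= K * sqn (a - b)) -> continuous g.
Proof.
move=> K0 gl x; apply/(@cvgrPdist_lt _ _ _ (nbhs x) (nbhs_filter x)) => e e0.
set M := K * (n + p)%:R; have M0 : 0 <= M by rewrite mulr_ge0.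
have d0 : 0 < e / (1 + M) by rewrite divr_gt0 // ltr_pwDl.
apply/nbhs_ballP; exists (e / (1 + M)) => // y [/= [_ b1] [_ b2]].
have H : sqn (x - y) <= (n + p)%:R * (e / (1 + M)) ^+ 2.
  apply: sqn_lt => [|c]; first exact: ltW.
  by rewrite crdB; case: c => i /=; [exact: b1|exact: b2].
rewrite -(ltr_pXn2r (ltn0Sn 1)) ?nnegrE// ?ltW// real_normK ?num_real//.
apply: le_lt_trans (gl x y) _; apply: le_lt_trans (ler_wpM2l K0 H) _.
rewrite mulrA -/M exprMn exprVn mulrCA -[ltRHS]mulr1 ltr_pM2l ?exprn_gt0//.
rewrite ltr_pdivrMr ?exprn_gt0 ?ltr_pwDl// mul1r sqrrD expr1n mul1r.
by have := sqr_ge0 M; move: M0; clear; lra.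
Qed.

End Coordinates.

Section Composition.
Context {R : realType} {n p : nat} {d : measure_display} {Omega : measurableType d}.
Notation pt := ('rV[R]_n * 'rV[R]_p)%type.
Variable A : set (set Omega).
Hypothesis sA : sigma_algebra setT A.
Variable u : Omega -> pt.

Lemma measurable_vec_crd :
  measurable_vec_wrt A u <-> forall c, measurable_wrt A (fun o => crd (u o) c).
Proof.
split=> [[m1 m2] [i|j]|m]; [exact: m1|exact: m2|].
by split=> i; [exact: (m (inl i))|exact: (m (inr i))].
Qed.

Hypothesis mu : measurable_vec_wrt A u.

(** An open set is the union of the boxes with rational centers and radii 1/(k+1)
    that it contains, and there are countably many of them. *)
Lemma preimage_open_wrt (O : set pt) : open O -> A (u @^-1` O).
Proof.
move=> oO; move/measurable_vec_crd : mu => mc.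
pose box (rk : {ffun 'I_n + 'I_p -> rat} * nat) : set pt :=
  [set v | forall c, `|crd v c - ratr (rk.1 c)| < rk.2.+1%:R^-1].
have -> : u @^-1` O = \bigcup_rk (if `[< box rk `<=` O >] then u @^-1` box rk else set0).
  apply/seteqP; split => [ o /= Ou|o [rk _]]; last by case: asboolP => // H; exact: H.
  have [e e0 He] := open_crd oO Ou.
  pose k := Num.trunc (2 / e).
  have k1 : k.+1%:R^-1 < e / 2.
    rewrite invf_plt ?posrE ?divr_gt0// invf_div.
    by have /andP[_] := truncn_itv (ltW (divr_gt0 (ltr0n R 2) e0)).
  have kk : 0 < k.+1%:R^-1 :> R by rewrite invr_gt0.
  have r_ c : exists r : rat, `|crd (u o) c - ratr r| < k.+1%:R^-1.
    have /rat_in_itvoo[r] : crd (u o) c < crd (u o) c + k.+1%:R^-1 by rewrite ltrDl.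
    rewrite in_itv/= => /andP[r1 r2]; exists r.
    by rewrite distrC ger0_norm ?subr_ge0 ?ltW// ltrBlDl.
  have [r Hr] := choice r_.
  exists ([ffun c => r c], k) => //.
  case: asboolP => [_|nH]; first by move=> c; rewrite ffunE; exact: Hr.
  exfalso; apply: nH => v /= Hv; apply: He => c.
  have := Hv c; rewrite ffunE /= => Hvc; rewrite crdB.
  rewrite (_ : _ - _ = (crd v c - ratr (r c)) - (crd (u o) c - ratr (r c))); last by rewrite opprB addrA subrK.
  apply: le_lt_trans (ler_normB _ _) _.
  by move: Hvc (Hr c) k1; move: (k.+1%:R^-1) => K; clear; lra.
have sAE : A = (measurable : set (set (g_sigma_algebraType A))).
  by rewrite -[LHS](sigma_algebra_id sA).
rewrite [X in X _]sAE; apply: countable_bigcupT_measurable => // rk.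
case: asboolP => _ //.
have -> : u @^-1` box rk = \bigcap_(c in setT)
    ((fun o => `|crd (u o) c - ratr (rk.1 c)|) @^-1` `]-oo, rk.2.+1%:R^-1[%classic).
  apply/seteqP; split => o /= H c; first by move=> _ /=; rewrite in_itv /=; exact: H.
  by have := H c I; rewrite /= in_itv.
apply: fin_bigcap_measurable => [|c _]; first exact: finite_finset.
rewrite -[X in measurable X]setTI.
have /(measurable_wrtP _ sA) mcc := mc c.
apply: (measurableT_comp (f := (fun t : R => `|t|))) => //.
exact: measurable_funB.
Qed.

Lemma wrt_continuous (g : pt -> R) : continuous g -> measurable_wrt A (fun o => g (u o)).
Proof.
move=> cg; apply/(measurable_wrtP _ sA).
apply: (measurability _ (RGenOInfty.measurableE R)) => _ [_ [x ->] <-].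
rewrite setTI -[X in measurable X]/(u @^-1` (g @^-1` `]x, +oo[%classic)).
apply: measurable_structure.sub_sigma_algebra; apply: preimage_open_wrt.
by move/continuousP: cg; apply; exact: rray_open.
Qed.

Lemma measurable_point :
  measurable_fun [set: g_sigma_algebraType A] (u : g_sigma_algebraType A -> g_sigma_algebraType (@open pt)).
Proof.
apply: (@measurability _ _ _ (g_sigma_algebraType (@open pt)) _ _ (@open pt)) => // _ [B oB <-].
rewrite setTI; apply: measurable_structure.sub_sigma_algebra; exact: preimage_open_wrt.
Qed.

End Composition.

Section SquareIntegrable.
Context {R : realType} {d : measure_display} {Omega : measurableType d}.
Variable P : probability Omega R.
Implicit Types (A : set (set Omega)) (f g : Omega -> R).

(** Square integrability with measurability for the information A. Because the
    measure is finite these random variables are integrable, and so are their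
    products. *)
Definition sqint A f := measurable_wrt A f /\ summable P (fun o => f o ^+ 2).
Definition vsq A m (V : Omega -> 'rV[R]_m) := forall i, sqint A (fun o => V o 0 i).

Lemma sqintS A A' f : A `<=` A' -> sqint A f -> sqint A' f.
Proof. by move=> AA [m s]; split => //; exact: measurable_wrtS m. Qed.

Lemma sqint_meas A f : Defs.sub_sigma_algebra A -> sqint A f -> measurable_fun setT f.
Proof. by move=> sA [m _]; exact: measurable_wrtT m. Qed.

Lemma sqint_mul A f g : Defs.sub_sigma_algebra A -> sqint A f -> sqint A g ->
  summable P (fun o => f o * g o).
Proof.
by move=> sA sf sg; apply: summable_mul_sqr sf.2 sg.2; apply: (sqint_meas sA).
Qed.

Lemma sqint_cst A (k : R) : Defs.sub_sigma_algebra A -> sqint A (fun=> k).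
Proof. by move=> sA; split; [exact: wrt_cst sA.1|exact: summable_cst]. Qed.

Lemma sqint_summable A f : Defs.sub_sigma_algebra A -> sqint A f -> summable P f.
Proof.
move=> sA sf; have := sqint_mul sA sf (sqint_cst 1 sA).
by under [X in summable _ X]funext do rewrite mulr1.
Qed.

Lemma sqintD A f g : Defs.sub_sigma_algebra A -> sqint A f -> sqint A g ->
  sqint A (fun o => f o + g o).
Proof.
move=> sA sf sg; split; first by apply: wrtD sA.1 sf.1 sg.1.
under [X in summable _ X]funext do rewrite sqrrD.
apply: summableD sg.2; apply: summableD sf.2 _.
by under [X in summable _ X]funext do rewrite -mulr_natl; apply: summableZ; exact: (sqint_mul sA sf sg).
Qed.

Lemma sqintZ A (k : R) f : Defs.sub_sigma_algebra A -> sqint A f -> sqint A (fun o => k * f o).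
Proof.
move=> sA sf; split; first exact: wrtZ sA.1 sf.1.
by under [X in summable _ X]funext do rewrite exprMn; apply: summableZ sf.2.
Qed.

Lemma sqint_le A f g : Defs.sub_sigma_algebra A -> measurable_wrt A f -> summable P g ->
  (forall o, f o ^+ 2 <= g o) -> sqint A f.
Proof.
move=> sA mf sg fg; split => //; apply: (summable_le _ sg).
  by apply: measurable_funX; exact: measurable_wrtT mf.
by move=> o; rewrite ger0_norm ?sqr_ge0.
Qed.

Lemma vsqS A A' m (V : Omega -> 'rV[R]_m) : A `<=` A' -> vsq A V -> vsq A' V.
Proof. by move=> AA h i; exact: sqintS (h i). Qed.

Lemma vsq_cst A m (v : 'rV[R]_m) : Defs.sub_sigma_algebra A -> vsq A (fun=> v).
Proof. by move=> sA i; exact: sqint_cst. Qed.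

Lemma vsqD A m (V W : Omega -> 'rV[R]_m) : Defs.sub_sigma_algebra A ->
  vsq A V -> vsq A W -> vsq A (fun o => V o + W o).
Proof.
move=> sA h h' i; under [X in sqint _ X]funext do rewrite mxE; exact: sqintD.
Qed.

Lemma vsqZ A m (k : R) (V : Omega -> 'rV[R]_m) : Defs.sub_sigma_algebra A ->
  vsq A V -> vsq A (fun o => k *: V o).
Proof.
move=> sA h i; under [X in sqint _ X]funext do rewrite mxE; exact: sqintZ.
Qed.

Lemma vsqN A m (V : Omega -> 'rV[R]_m) : Defs.sub_sigma_algebra A ->
  vsq A V -> vsq A (fun o => - V o).
Proof.
by move=> sA h; under [X in vsq _ X]funext do rewrite -scaleN1r; exact: vsqZ.
Qed.

Lemma vsqB A m (V W : Omega -> 'rV[R]_m) : Defs.sub_sigma_algebra A ->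
  vsq A V -> vsq A W -> vsq A (fun o => V o - W o).
Proof. by move=> sA h h'; apply: vsqD => //; exact: vsqN. Qed.

Lemma vsq_dot A m (V W : Omega -> 'rV[R]_m) : Defs.sub_sigma_algebra A ->
  vsq A V -> vsq A W -> summable P (fun o => dot (V o) (W o)).
Proof.
by move=> sA h h'; rewrite /dot; apply: summable_sum => i; exact: (sqint_mul sA (h i) (h' i)).
Qed.

Section Pairs.
Context {n p : nat}.
Notation pt := ('rV[R]_n * 'rV[R]_p)%type.
Implicit Types u v : Omega -> pt.

Definition psq A u := vsq A (fun o => (u o).1) /\ vsq A (fun o => (u o).2).

Lemma psq_crd A u : psq A u <-> forall c, sqint A (fun o => crd (u o) c).
Proof.
split=> [[h1 h2] [i|j]|h]; [exact: h1|exact: h2|].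
by split=> i; [exact: (h (inl i))|exact: (h (inr i))].
Qed.

Lemma psq_vec A u : psq A u -> measurable_vec_wrt A u.
Proof. by move=> [h1 h2]; split => i; [exact: (h1 i).1|exact: (h2 i).1]. Qed.

Lemma psqS A A' u : A `<=` A' -> psq A u -> psq A' u.
Proof. by move=> AA [h1 h2]; split; exact: vsqS AA _. Qed.

Lemma psqB A u v : Defs.sub_sigma_algebra A -> psq A u -> psq A v -> psq A (fun o => u o - v o).
Proof. by move=> sA [h1 h2] [h3 h4]; split; exact: vsqB. Qed.

Lemma psqD A u v : Defs.sub_sigma_algebra A -> psq A u -> psq A v -> psq A (fun o => u o + v o).
Proof. by move=> sA [h1 h2] [h3 h4]; split; exact: vsqD. Qed.

Lemma psqZ A (k : R) u : Defs.sub_sigma_algebra A -> psq A u -> psq A (fun o => k *: u o).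
Proof. by move=> sA [h1 h2]; split; exact: vsqZ. Qed.

Lemma psq_cst A (k : pt) : Defs.sub_sigma_algebra A -> psq A (fun=> k).
Proof. by move=> sA; split; exact: vsq_cst. Qed.

Lemma psq_sqn A u : Defs.sub_sigma_algebra A -> psq A u -> summable P (fun o => sqn (u o)).
Proof. by move=> sA [h1 h2]; apply: summableD; [exact: (vsq_dot sA h1 h1)|exact: (vsq_dot sA h2 h2)]. Qed.

(** Compare with the constant g 0: the square of g u is at most
    2 (g 0)^2 + 2 K |u|^2. *)
Lemma sqint_lipschitz A u (g : pt -> R) (K : R) : Defs.sub_sigma_algebra A -> 0 <= K ->
  (forall a b, (g a - g b) ^+ 2 <= K * sqn (a - b)) -> psq A u ->
  sqint A (fun o => g (u o)).
Proof.
move=> sA K0 gl pu; have mg := wrt_continuous sA.1 (psq_vec pu) (lipschitz_continuous K0 gl).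
apply: (@sqint_le _ _ (fun o => 2 * K * sqn (u o) + 2 * g 0 ^+ 2)) => //.
  by apply: summableD; [apply: summableZ; exact: psq_sqn pu|exact: summable_cst].
move=> o; have := gl (u o) 0; rewrite subr0.
have := sqr_ge0 (g (u o) - 2 * g 0); move: (g (u o)) (g 0) (sqn _) => a b c; clear; lra.
Qed.

End Pairs.

Lemma vsq_lipschitz A m k (G : 'rV[R]_m -> 'rV[R]_k) (K : R) V : Defs.sub_sigma_algebra A ->
  0 <= K -> (forall a b, dot (G a - G b) (G a - G b) <= K * dot (a - b) (a - b)) ->
  vsq A V -> vsq A (fun o => G (V o)).
Proof.
move=> sA K0 Gl hV i.
apply: (@sqint_lipschitz m 0 A (fun o => (V o, 0)) (fun v => G v.1 0 i) K) => //.
  move=> a b; apply: le_trans (_ : dot (G a.1 - G b.1) (G a.1 - G b.1) <= _).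
    by have := coord_sq_le (G a.1 - G b.1) i; rewrite !mxE.
  apply: le_trans (Gl _ _) _; rewrite ler_wpM2l // /sqn lerDl; exact: dot_ge0.
by split => //; exact: vsq_cst.
Qed.

End SquareIntegrable.

(** * One oracle sample *)

Section ConditionalExpectation.
Context {R : realType} {d : measure_display} {Omega : measurableType d}.
Variable P : probability Omega R.
Implicit Types (A : set (set Omega)) (Z W V : Omega -> R).

Lemma seqDU_wrt A (E : nat -> set Omega) k : sigma_algebra setT A ->
  (forall k, A (E k)) -> A (seqDU E k).
Proof.
move=> sA AE; have AT : A = (measurable : set (set (g_sigma_algebraType A))).
  by rewrite -[LHS](sigma_algebra_id sA).
rewrite [X in X _]AT; have mE j : (measurable : set (set (g_sigma_algebraType A))) (E j).
  by rewrite -[X in X _]AT.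
by apply: measurableD => //; exact: bigsetU_measurable.
Qed.

Lemma wrtI A G H : sigma_algebra setT A -> A G -> A H -> A (G `&` H).
Proof.
move=> sA AG AH; have AT : A = (measurable : set (set (g_sigma_algebraType A))).
  by rewrite -[LHS](sigma_algebra_id sA).
rewrite [X in X _]AT; apply: measurableI; by rewrite -[X in X _]AT.
Qed.

(** Cutting along a disjoint cover on which the variable is integrable reduces
    an almost sure bound of a conditional expectation to a bound of the mean. *)
Lemma condexp_le_integral A Z V : Defs.sub_sigma_algebra A -> measurable_fun setT Z ->
  (forall o, 0 <= Z o) -> measurable_fun setT V -> (forall o, 0 <= V o) ->
  condexp_le P A Z V -> (\int[P]_o (Z o)%:E <= \int[P]_o (V o)%:E)%E.
Proof.
move=> sA mZ Z0 mV V0 [W [[mW [E [AE ET iE ZW]]] WV]].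
have mE k : measurable (seqDU E k) by apply: sA.2; exact: seqDU_wrt sA.1 AE.
have DT : \bigcup_k seqDU E k = setT by rewrite -seqDU_bigcup_eq.
have tE := trivIset_seqDU E; have mWT := measurable_wrtT sA mW.
rewrite -DT ge0_integral_bigcup //; last first.
- by move=> o _; rewrite lee_fin.
- by rewrite DT; exact/measurable_EFinP.
rewrite ge0_integral_bigcup //; last first.
- by move=> o _; rewrite lee_fin.
- by rewrite DT; exact/measurable_EFinP.
apply: lee_nneseries => [k _ _|k _]; first by apply: integral_ge0 => o _; rewrite lee_fin.
have EkE : seqDU E k = seqDU E k `&` E k by apply/esym/setIidPl; exact: subDsetl.
rewrite EkE ZW -?EkE; last exact: seqDU_wrt sA.1 AE.
apply: (@le_trans _ _ (\int[P]_(o in seqDU E k) ((EFin \o W)^\+ o))%E).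
  rewrite [leLHS]integralE.
  by apply: geeDl; rewrite oppe_le0; exact: integral_ge0.
apply: ae_ge0_le_integral => //.
- by apply: measurable_funepos; exact/measurable_EFinP/measurable_funTS.
- by move=> o _; rewrite lee_fin.
- exact/measurable_EFinP/measurable_funTS.
- move: WV; apply: filterS => o WVo _; rewrite unlock /= -EFin_max lee_fin.
  by rewrite ge_max WVo V0.
Qed.

Lemma condexp_le_mean A Z V : Defs.sub_sigma_algebra A -> measurable_fun setT Z ->
  (forall o, 0 <= Z o) -> summable P V -> (forall o, 0 <= V o) ->
  condexp_le P A Z V -> summable P Z /\ mean P Z <= mean P V.
Proof.
move=> sA mZ Z0 sV V0 h.
have H := condexp_le_integral sA mZ Z0 (summable_meas sV) V0 h.
have sZ : summable P Z.
  apply/integrableP; split; first exact/measurable_EFinP.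
  have -> : (\int[P]_o `|(EFin \o Z) o| = \int[P]_o (Z o)%:E)%E.
    by apply: eq_integral => o _ /=; rewrite ger0_norm.
  by apply: le_lt_trans H _; rewrite -EFin_mean// ltry.
by split => //; rewrite -lee_fin !EFin_mean.
Qed.

(** On each piece of the cover both Z and W are integrable and their integrals over
    G agree; the integrable difference is then summed over the pieces. *)
Lemma condexp_centered A Z W : Defs.sub_sigma_algebra A -> is_condexp P A Z W ->
  summable P (fun o => Z o - W o) -> centered P A (fun o => Z o - W o).
Proof.
move=> sA [mW [E [AE ET iE ZW]]] sZW G AG.
have mG : measurable G by exact: sA.2.
have mE k : measurable (seqDU E k) by apply: sA.2; exact: seqDU_wrt sA.1 AE.
have DT : \bigcup_k seqDU E k = setT by rewrite -seqDU_bigcup_eq.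
have mGE k : measurable (G `&` seqDU E k) by exact: measurableI.
have GE : G = \bigcup_k (G `&` seqDU E k) by rewrite -setI_bigcupr DT setIT.
rewrite {1}GE integral_bigcup //; first last.
- by rewrite -GE; exact: summable_on.
- by apply/trivIsetP => i j _ _ ij; rewrite setIACA ((trivIsetP.1 (trivIset_seqDU E)) i j I I ij) setI0.
apply: eseries0 => k _ _.
have EkE : G `&` seqDU E k = G `&` seqDU E k `&` E k.
  by rewrite -setIA; congr (_ `&` _); apply/esym/setIidPl; exact: subDsetl.
have mEk : measurable (E k) by apply: sA.2.
have iZ : P.-integrable (G `&` seqDU E k) (EFin \o Z).
  by rewrite EkE; apply: integrableS (iE k) => //; exact: measurableI.
have iW : P.-integrable (G `&` seqDU E k) (EFin \o W).
  have -> : EFin \o W = fun o => ((EFin \o Z) o - (EFin \o (fun o => Z o - W o)%R) o)%E.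
    by apply/funext => o /=; rewrite -EFinB opprB addrCA subrr addr0.
  by apply: integrableB => //; exact: summable_on.
rewrite (_ : (fun _ => _) = (fun o => (EFin \o Z) o - (EFin \o W) o)%E) //.
rewrite integralB_EFin // {1}EkE ZW -?EkE; last first.
  by apply: wrtI sA.1 AG _; exact: seqDU_wrt sA.1 AE.
by rewrite subee //; exact: integrable_fin_num.
Qed.

End ConditionalExpectation.

Section Oracle.
Context {R : realType} {n p : nat}.
Notation pt := ('rV[R]_n * 'rV[R]_p)%type.
Context {X : set 'rV[R]_n} {Y : set 'rV[R]_p}.
Context {dS : measure_display} {S : measurableType dS} {D : probability S R}.
Context {f : pt -> S -> R^o} {gradf : pt -> S -> pt} {L : R}.
Hypothesis SA : standing_assumptions X Y D f gradf L.
Context {d : measure_display} {Omega : measurableType d} {P : probability Omega R}.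
Implicit Types (A : set (set Omega)) (u v : Omega -> pt) (w : Omega -> S).

Let gF := grad2 (objective D f).

Lemma enorm2_sqr (u : pt) : enorm2 u ^+ 2 = sqn u.
Proof. by rewrite /enorm2 sqr_sqrtr ?addr_ge0 ?sqr_ge0// !enorm_sqr. Qed.

Definition sample_wrt A w := forall B : set S, measurable B -> A (w @^-1` B).

Let closed_domain : closed (X `*` Y).
Proof.
have -> : X `*` Y = fst @^-1` X `&` snd @^-1` Y by [].
have clY : closed Y by apply: compact_closed (Y_compact SA); exact: norm_hausdorff.
apply: closedI.
  by apply: preimage_closed (X_closed SA) => x _; exact: cvg_fst.
by apply: preimage_closed clY => x _; exact: cvg_snd.
Qed.

(** Joint measurability of the gradient on the closed set X x Y is composed with
    the pair of the query point and the sample. *)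
Lemma oracle_measurable A u w : sigma_algebra setT A -> measurable_vec_wrt A u ->
  (forall o, (X `*` Y) (u o)) -> sample_wrt A w ->
  measurable_vec_wrt A (fun o => gradf (u o) (w o)).
Proof.
move=> sA mu uXY mw.
have mD : measurable ((X `*` Y : set (g_sigma_algebraType (@open pt))) `*` [set: S]).
  apply: measurableX => //; rewrite -[X in measurable X]setCK; apply: measurableC.
  apply: measurable_structure.sub_sigma_algebra; exact: closed_openC closed_domain.
pose q : g_sigma_algebraType A -> g_sigma_algebraType (@open pt) * S := fun o => (u o, w o).
have mq : measurable_fun setT q.
  apply: measurable_fun_pair; first exact: measurable_point.
  by move=> _ B mB; rewrite setTI; apply: measurable_structure.sub_sigma_algebra; exact: mw.
have qD : q @` setT `<=` (X `*` Y : set (g_sigma_algebraType (@open pt))) `*` [set: S].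
  by move=> _ [ o _ <-]; split => //; exact: uXY.
have [g1 g2] := gradf_measurable SA.
split=> i; apply/(measurable_wrtP _ sA).
  exact: (measurable_comp mD qD (g1 i) mq).
exact: (measurable_comp mD qD (g2 i) mq).
Qed.

Let condexp_crd (sigma : R) A u w : stochastic_oracle X Y D f gradf P sigma ->
  Defs.sub_sigma_algebra A -> measurable_vec_wrt A u ->
  (forall o, (X `*` Y) (u o)) -> fresh_sample P D A w ->
  forall c, is_condexp P A (fun o => crd (gradf (u o) (w o)) c) (fun o => crd (gF (u o)) c).
Proof. by move=> so sA mu uXY fw; have [h1 h2 _] := so _ _ _ sA mu uXY fw; case. Qed.

(** The conditional variance bound makes the error square integrable although the
    stochastic gradient itself may have no moments; only then does unbiasedness say
    that the error is centered. *)
Lemma sample_error (sigma : R) A A' u w : stochastic_oracle X Y D f gradf P sigma ->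
  Defs.sub_sigma_algebra A -> Defs.sub_sigma_algebra A' -> A `<=` A' ->
  measurable_vec_wrt A u -> (forall o, (X `*` Y) (u o)) -> fresh_sample P D A w ->
  sample_wrt A' w ->
  let e o := gradf (u o) (w o) - gF (u o) in
  [/\ psq P A' e, mean P (fun o => sqn (e o)) <= sigma ^+ 2 &
      forall c, centered P A (fun o => crd (e o) c)].
Proof.
move=> so sA sA' AA mu uXY fw mw e.
have mu' : measurable_vec_wrt A' u.
  by case: mu => m1 m2; split => i; [exact: measurable_wrtS (m1 i)|exact: measurable_wrtS (m2 i)].
have /measurable_vec_crd mg := oracle_measurable sA'.1 mu' uXY mw.
have cc := condexp_crd so sA mu uXY fw.
have me c : measurable_wrt A' (fun o => crd (e o) c).
  rewrite (_ : (fun o => _) = fun o => crd (gradf (u o) (w o)) c + -1 * crd (gF (u o)) c).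
    apply: wrtD sA'.1 (mg c) _; apply: wrtZ sA'.1 _.
    exact: measurable_wrtS AA (cc c).1.
  by apply/funext => o; rewrite crdB mulN1r.
have msq : measurable_fun setT (fun o => sqn (e o)).
  under [X in measurable_fun _ X]funext do rewrite sqn_crd.
  apply: measurable_sum => c; apply: measurable_funX.
  exact: measurable_wrtT sA' (me c).
have [_ _ cl] := so _ _ _ sA mu uXY fw.
have [s m] : summable P (fun o => sqn (e o)) /\ mean P (fun o => sqn (e o)) <= mean P (fun=> sigma ^+ 2).
  apply: (condexp_le_mean sA) => // [ o||o|]; [exact: sqn_ge0|exact: summable_cst|exact: sqr_ge0|].
  by under [X in condexp_le _ _ X]funext do rewrite -enorm2_sqr.
rewrite mean_cst in m; have pe : psq P A' e.
  by apply/psq_crd => c; apply: (sqint_le sA' (me c) s) => o; exact: crd_le.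
split => // c.
rewrite (_ : (fun o => _) = fun o => crd (gradf (u o) (w o)) c - crd (gF (u o)) c); last first.
  by apply/funext => o; rewrite crdB.
apply: condexp_centered sA (cc c) _.
have /psq_crd/(_ c)/(sqint_summable sA') := pe.
by under [X in summable _ X]funext do rewrite crdB.
Qed.

(** Integrate the conditional mean square bound of the paired oracle. *)
Lemma sample_difference (ell : R) A A' u v w : paired_oracle X Y D gradf P ell ->
  Defs.sub_sigma_algebra A -> Defs.sub_sigma_algebra A' -> A `<=` A' ->
  psq P A u -> (forall o, (X `*` Y) (u o)) ->
  psq P A v -> (forall o, (X `*` Y) (v o)) -> fresh_sample P D A w ->
  sample_wrt A' w ->
  let e o := gradf (u o) (w o) - gradf (v o) (w o) in
  psq P A' e /\ mean P (fun o => sqn (e o)) <= ell ^+ 2 * mean P (fun o => sqn (u o - v o)).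
Proof.
move=> po sA sA' AA pu uXY pv vXY fw mw e.
have /measurable_vec_crd mg := oracle_measurable sA'.1 (psq_vec (psqS AA pu)) uXY mw.
have /measurable_vec_crd mg' := oracle_measurable sA'.1 (psq_vec (psqS AA pv)) vXY mw.
have me c : measurable_wrt A' (fun o => crd (e o) c).
  rewrite (_ : (fun o => _) = fun o => crd (gradf (u o) (w o)) c + -1 * crd (gradf (v o) (w o)) c).
    by apply: wrtD sA'.1 (mg c) _; apply: wrtZ sA'.1 _.
  by apply/funext => o; rewrite crdB mulN1r.
have msq : measurable_fun setT (fun o => sqn (e o)).
  under [X in measurable_fun _ X]funext do rewrite sqn_crd.
  apply: measurable_sum => c; apply: measurable_funX.
  exact: measurable_wrtT sA' (me c).
have sd := psq_sqn sA (psqB sA pu pv).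
have cl := po _ _ _ _ sA (psq_vec pu) uXY (psq_vec pv) vXY fw.
have [s m] : summable P (fun o => sqn (e o)) /\
    mean P (fun o => sqn (e o)) <= mean P (fun o => ell ^+ 2 * sqn (u o - v o)).
  apply: (condexp_le_mean sA) => // [ o||o|]; [exact: sqn_ge0|exact: summableZ| |].
    by rewrite mulr_ge0 ?sqr_ge0 ?sqn_ge0.
  under [X in condexp_le _ _ X]funext do rewrite -enorm2_sqr.
  by under [X in condexp_le _ _ _ X]funext do rewrite -enorm2_sqr.
rewrite meanZ // in m; split => //.
by apply/psq_crd => c; apply: (sqint_le sA' (me c) s) => o; exact: crd_le.
Qed.

End Oracle.

(** * Independent samples and batches *)

Section Freshness.
Context {R : realType} {d : measure_display} {Omega : measurableType d}.
Context {dS : measure_display} {S : measurableType dS} {D : probability S R}.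
Context {P : probability Omega R}.
Variable w : nat * nat -> Omega -> S.
Implicit Types (I : set (nat * nat)) (a : nat * nat).

Lemma sample_sigma_sub I : (forall a, I a -> measurable_fun setT (w a)) ->
  Defs.sub_sigma_algebra (sample_sigma I w).
Proof.
move=> mw; split; first exact: smallest_sigma_algebra.
apply: smallest_sub.
  split => //; first by move=> A mA; exact: measurableD.
  by move=> F mF; exact: bigcupT_measurable.
by move=> _ [a [B [Ia mB ->]]]; rewrite -[X in measurable X]setTI; exact: mw.
Qed.

Lemma sample_sigmaS I I' : I `<=` I' -> sample_sigma I w `<=` sample_sigma I' w.
Proof.
by move=> II; apply: sub_sigma_algebra2 => E [a [B [Ia mB ->]]]; exists a, B; split => //; exact: II.
Qed.

Lemma sample_sigma_wrt I a : I a -> sample_wrt (sample_sigma I w) (w a).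
Proof.
by move=> Ia B mB; apply: measurable_structure.sub_sigma_algebra; exists a, B.
Qed.

(** The events independent of E form a lambda-system, so independence extends from
    a generating pi-system. *)
Lemma indep_induction (G : set (set Omega)) (E : set Omega) :
  setI_closed G -> G `<=` measurable -> measurable E ->
  (forall F, G F -> P (F `&` E) = (P F * P E)%E) ->
  forall F, <<s G >> F -> P (F `&` E) = (P F * P E)%E.
Proof.
move=> GI Gm mE GE F GF.
suff: <<s G >> `<=` [set F | measurable F /\ P (F `&` E) = (P F * P E)%E] by move=> /(_ _ GF)[].
apply: lambda_system_subset => //; last by move=> H GH; split; [exact: Gm|exact: GE].
have fE H : measurable H -> (P H = (fine (P H))%:E)%E by move=> mH; rewrite fineK// fin_num_measure.
apply/dynkin_lambda_system; split.
- by split => //; rewrite setTI [P setT]probability_setT mul1e.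
- move=> H [mH HE]; split; first exact: measurableC.
  have mHE : measurable (H `&` E) by exact: measurableI.
  have mCE : measurable (~` H `&` E) by apply: measurableI => //; exact: measurableC.
  have e1 : (P E = P (~` H `&` E) + P (H `&` E))%E.
    rewrite -measureU //; last by rewrite setIACA setICl set0I.
    by rewrite -setIUl setUC setUv setTI.
  have e2 : (1 = P (~` H) + P H)%E.
    rewrite -(@probability_setT _ _ _ P) -measureU // ?setICl// ; last exact: measurableC.
    by rewrite setUC setUv.
  have mC : measurable (~` H) by exact: measurableC.
  move: e1 e2; rewrite HE (fE _ mE) (fE _ mH) (fE _ mC) (fE _ mCE) -!EFinM -!EFinD => -[e1] -[e2].
  congr EFin; have -> : fine (P (~` H)) = 1 - fine (P H) by rewrite e2; lra.
  by move: e1; lra.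
- move=> H tH mH; have mHk k : measurable (H k) by have [] := mH k.
  have mU : measurable (\bigcup_k H k) by exact: bigcupT_measurable.
  split => //; rewrite setI_bigcupl measure_bigcup //; last 2 first.
  + by move=> k _; exact: measurableI.
  + by apply/trivIsetP => i j _ _ ij; rewrite setIACA ((trivIsetP.1 tH) i j I I ij) set0I.
  rewrite measure_bigcup // (fE _ mE) muleC -nneseriesZl; last by move=> k _; exact: measure_ge0.
  by apply: eq_eseriesr => k _ /=; have [_ /= ->] := mH k; rewrite muleC -fE.
Qed.

(** Finite intersections of sample events form a pi-system that generates the
    information in I', and on it independence of w a is the product rule for the
    index a added to the finite family. *)
Lemma iid_fresh I I' a : iid_samples P D I w -> I' `<=` I -> I a -> ~ I' a ->
  fresh_sample P D (sample_sigma I' w) (w a).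
Proof.
move=> [law ind] II Ia nIa; split; first exact: law.
have mw b : I b -> measurable_fun setT (w b) by move=> /law [].
have mpre b B : I b -> measurable B -> measurable (w b @^-1` B).
  by move=> Ib mB; rewrite -[X in measurable X]setTI; exact: mw.
move=> E B IE mB.
pose G : set (set Omega) := [set E | exists s (B : nat * nat -> set S),
   [/\ uniq s, forall b, b \in s -> I' b, forall b, measurable (B b) &
     E = \bigcap_(b in [set` s]) w b @^-1` B b]].
have GE : <<s G >> E.
  apply: (sub_smallest2r (@smallest_sigma_algebra _ setT G)) IE => _ [b [C [Ib mC ->]]].
  exists [:: b], (fun=> C); split => //; first by move=> c; rewrite inE => /eqP ->.
  apply/seteqP; split => [ o Co c|o]; first by rewrite /= inE => /eqP ->.
  by apply; rewrite /= inE.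
apply: indep_induction GE => //; last 2 first.
- exact: mpre.
- move=> _ [s [C [us sI mC ->]]].
  pose C' b := if b == a then B else C b.
  have as_ : a \notin s by apply/negP => /sI.
  have mC' b : measurable (C' b) by rewrite /C'; case: eqP.
  have us' : uniq (a :: s) by rewrite /= as_.
  have sI1 b : b \in a :: s -> I b by rewrite inE => /predU1P[->//|/sI/II].
  have H := ind (a :: s) C' us' sI1 mC'; rewrite big_cons {2}/C' eqxx in H.
  have := ind s C us (fun b sb => II _ (sI _ sb)) mC => H'.
  have e : \bigcap_(b in [set` s]) w b @^-1` C b `&` w a @^-1` B =
      \bigcap_(b in [set` a :: s]) w b @^-1` C' b.
    apply/seteqP; split => [ o [Co Bo] b|o Co].
      rewrite /= inE /C' => /predU1P[->|sb]; first by rewrite eqxx.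
      by case: eqP => [->//|_]; exact: Co.
    split => [b /= sb|]; last by have := Co a; rewrite /C' eqxx; apply; rewrite /= mem_head.
    have := Co b; rewrite /C'; case: eqP => [ba|_]; first by rewrite ba (negbTE as_) in sb.
    by apply; rewrite /= inE sb orbT.
  rewrite e H H'.
  rewrite muleC; congr (_ * _)%E; apply: eq_big_seq => b sb.
  by rewrite /C'; case: eqP => // ba; rewrite ba (negbTE as_) in sb.
- move=> _ _ [s [C [us sI mC ->]]] [s' [C' [us' sI' mC' ->]]].
  exists (undup (s ++ s')), (fun b => (if b \in s then C b else setT) `&` (if b \in s' then C' b else setT)).
  split; first exact: undup_uniq.
  + by move=> b; rewrite mem_undup mem_cat => /orP[/sI|/sI'].
  + by move=> b; apply: measurableI; case: ifP.
  apply/seteqP; split => [ o [Co Co'] b|o H].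
    rewrite /= mem_undup mem_cat => sb; split; case: ifP => // sb'; [exact: Co|exact: Co'].
  split => b /= sb; have := H b; rewrite /= mem_undup mem_cat sb ?orbT => /(_ isT) [].
    by [].
  by [].
- move=> _ [s [C [us sI mC ->]]]; apply: fin_bigcap_measurable => [|b /= sb]; first exact: finite_seq.
  by apply: mpre => //; apply: II; exact: sI.
Qed.

End Freshness.

Section Orthogonality.
Context {R : realType} {n p : nat} {d : measure_display} {Omega : measurableType d}.
Notation pt := ('rV[R]_n * 'rV[R]_p)%type.
Variable P : probability Omega R.
Implicit Types (A : set (set Omega)) (M Z : Omega -> pt).

(** Random points are centered coordinate by coordinate. *)
Definition pcentered A Z := forall c, centered P A (fun o => crd (Z o) c).

Lemma crdD (u v : pt) c : crd (u + v) c = crd u c + crd v c.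
Proof. by case: c => i /=; rewrite !mxE. Qed.

Lemma crdZ (k : R) (u : pt) c : crd (k *: u) c = k * crd u c.
Proof. by case: c => i /=; rewrite !mxE. Qed.

Lemma pcenteredD A A' Z Z' : Defs.sub_sigma_algebra A -> Defs.sub_sigma_algebra A' ->
  psq P A' Z -> psq P A' Z' -> pcentered A Z -> pcentered A Z' -> pcentered A (fun o => Z o + Z' o).
Proof.
move=> sA sA' /psq_crd h /psq_crd h' cZ cZ' c.
under [X in centered _ _ X]funext do rewrite crdD.
by apply: centeredD => //; exact: (sqint_summable sA').
Qed.

Lemma pcenteredZ A A' (k : R) Z : Defs.sub_sigma_algebra A -> Defs.sub_sigma_algebra A' ->
  psq P A' Z -> pcentered A Z -> pcentered A (fun o => k *: Z o).
Proof.
move=> sA sA' /psq_crd h cZ c.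
under [X in centered _ _ X]funext do rewrite crdZ.
by apply: centeredZ => //; exact: (sqint_summable sA').
Qed.

Lemma pcenteredS A A' Z : A `<=` A' -> pcentered A' Z -> pcentered A Z.
Proof. by move=> AA h c; exact: centeredS (h c). Qed.

(** Pythagoras: a centered increment is orthogonal to what was known before it. *)
Lemma mean_sqn_add A A' M Z : Defs.sub_sigma_algebra A -> Defs.sub_sigma_algebra A' ->
  A `<=` A' -> psq P A M -> psq P A' Z -> pcentered A Z ->
  mean P (fun o => sqn (M o + Z o)) = mean P (fun o => sqn (M o)) + mean P (fun o => sqn (Z o)).
Proof.
move=> sA sA' AA pM pZ cZ.
have /psq_crd hM := pM; have /psq_crd hZ := pZ.
have sMZ c : summable P (fun o => crd (M o) c * crd (Z o) c).
  by apply: (sqint_mul sA') (hZ c); exact: sqintS AA (hM c).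
have cross : mean P (fun o => \sum_c crd (M o) c * crd (Z o) c) = 0.
  rewrite mean_sum //; apply: big1 => c _.
  by apply: (mean_centered sA (hM c).1 (sqint_summable sA' (hZ c))).
have sC : summable P (fun o => \sum_c crd (M o) c * crd (Z o) c) by exact: summable_sum.
transitivity (mean P (fun o => (sqn (M o) + sqn (Z o)) + 2 * \sum_c crd (M o) c * crd (Z o) c)).
  congr mean; apply/funext => o; rewrite !sqn_crd mulr_sumr -!big_split /=.
  by apply: eq_bigr => c _; rewrite crdD; ring.
have [s1 s2] := (psq_sqn sA pM, psq_sqn sA' pZ).
rewrite meanD; [|exact: summableD|exact: summableZ].
by rewrite meanZ // cross mulr0 addr0 meanD.
Qed.

(** The samples of a batch are revealed one at a time, along F; each adds a centered
    increment to the part M known before, so the variances add up. *)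
Lemma batch_error (F : nat -> set (set Omega)) (M : Omega -> pt) (Z : nat -> Omega -> pt)
    (b : nat) (c V : R) :
  (forall i, (i <= b)%N -> Defs.sub_sigma_algebra (F i)) ->
  (forall i, (i < b)%N -> F i `<=` F i.+1) ->
  psq P (F 0%N) M ->
  (forall i, (i < b)%N -> [/\ psq P (F i.+1) (Z i), pcentered (F i) (Z i) &
     mean P (fun o => sqn (Z i o)) <= V]) ->
  [/\ psq P (F b) (fun o => M o + c *: \sum_(i < b) Z i o),
      pcentered (F 0%N) (fun o => c *: \sum_(i < b) Z i o) &
      mean P (fun o => sqn (M o + c *: \sum_(i < b) Z i o)) <=
        mean P (fun o => sqn (M o)) + b%:R * (c ^+ 2 * V)].
Proof.
move=> sF iF pM HZ.
suff H k : (k <= b)%N -> [/\ F 0%N `<=` F k, psq P (F k) (fun o => c *: \sum_(i < k) Z i o),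
    pcentered (F 0%N) (fun o => c *: \sum_(i < k) Z i o) &
    mean P (fun o => sqn (M o + c *: \sum_(i < k) Z i o)) <=
        mean P (fun o => sqn (M o)) + k%:R * (c ^+ 2 * V)].
  have [m ps pc me] := H b (leqnn b); split => //.
  by apply: psqD ps; [exact: sF|exact: psqS m pM].
elim: k => [_|k IH kb].
  have e : (fun o : Omega => c *: \sum_(i < 0) Z i o) = fun=> 0.
    by apply/funext => o; rewrite big_ord0 scaler0.
  split => //; rewrite ?e; [exact: psq_cst (sF _ _)| |].
    move=> x G FG; apply: integral0_eq => o _; by case: x => j /=; rewrite mxE.
  rewrite mul0r addr0 le_eqVlt; apply/orP; left; apply/eqP; congr mean.
  by apply/funext => o; rewrite big_ord0 scaler0 addr0.
have [m ps pc me] := IH (ltnW kb); have [pZ cZ mZ] := HZ _ kb.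
have sk := sF _ (ltnW kb); have sk1 := sF _ kb; have ik := iF _ kb; have s0 := sF 0%N isT.
have e : (fun o : Omega => c *: \sum_(i < k.+1) Z i o) =
    fun o => c *: \sum_(i < k) Z i o + c *: Z k o.
  by apply/funext => o; rewrite big_ord_recr /= scalerDr.
have ps' := psqS ik ps; have pcZ := psqZ c sk1 pZ.
have cZ' := pcenteredZ c sk sk1 pZ cZ.
split; rewrite ?e; [exact: subset_trans ik|exact: psqD| |].
  by apply: (pcenteredD s0 sk1) => //; exact: pcenteredS m cZ'.
have -> : (fun o => sqn (M o + c *: \sum_(i < k.+1) Z i o)) =
    fun o => sqn ((M o + c *: \sum_(i < k) Z i o) + c *: Z k o).
  by apply/funext => o; rewrite big_ord_recr /= scalerDr addrA.
rewrite (mean_sqn_add sk sk1 ik _ pcZ cZ'); last by apply: psqD ps => //; exact: psqS m pM.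
have -> : mean P (fun o => sqn (c *: Z k o)) = c ^+ 2 * mean P (fun o => sqn (Z k o)).
  rewrite -meanZ; last exact: psq_sqn pZ.
  by congr mean; apply/funext => o; rewrite /sqn /= !dotZl !dotZr; ring.
rewrite -natr1 mulrDl mul1r addrA lerD // ler_wpM2l ?sqr_ge0//.
Qed.

End Orthogonality.

(** * Measurability of the random run *)

Section RandomRun.
Context {R : realType} {n p : nat}.
Notation pt := ('rV[R]_n * 'rV[R]_p)%type.
Context {X : set 'rV[R]_n} {Y : set 'rV[R]_p}.
Context {dS : measure_display} {S : measurableType dS} {D : probability S R}.
Context {f : pt -> S -> R^o} {gradf : pt -> S -> pt} {L : R}.
Hypothesis SA : standing_assumptions X Y D f gradf L.
Context {d : measure_display} {Omega : measurableType d} {P : probability Omega R}.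
Context {tau h a al k be : R}.
Hypothesis SP : step_params L tau h a al k be.
Variables (x0 : 'rV[R]_n) (y0 : 'rV[R]_p).
Hypotheses (Xx0 : X x0) (Yy0 : Y y0).

Let gF := grad2 (objective D f).
Let c := Params tau h al k be.
Let SS := saddle_structure SA.
Let L0 : 0 < L. Proof. exact: L_gt0 SA. Qed.
Let clY : closed Y.
Proof. by apply: compact_closed (Y_compact SA); exact: norm_hausdorff. Qed.

Lemma vsq_projX A V : Defs.sub_sigma_algebra A -> vsq P A V -> vsq P A (fun o => proj X (V o)).
Proof.
move=> sA; apply: (vsq_lipschitz sA ler01) => x x'; rewrite mul1r.
exact: (proj_nonexpansive (X_nonempty SA) (X_closed SA) (X_convex SA)).
Qed.

Lemma vsq_projY A V : Defs.sub_sigma_algebra A -> vsq P A V -> vsq P A (fun o => proj Y (V o)).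
Proof.
move=> sA; apply: (vsq_lipschitz sA ler01) => x x'; rewrite mul1r.
exact: (proj_nonexpansive (Y_nonempty SA) clY (Y_convex SA)).
Qed.

(** The gradient is Lipschitz on X x Y only; precomposed with the projections it
    is Lipschitz everywhere and unchanged at points of X x Y. *)
Lemma psq_gradient A u : Defs.sub_sigma_algebra A -> psq P A u ->
  (forall o, (X `*` Y) (u o)) -> psq P A (fun o => gF (u o)).
Proof.
move=> sA pu uXY; apply/psq_crd => i.
have pX x := proj_in (X_nonempty SA) (X_closed SA) (X_convex SA) x.
have pY y := proj_in (Y_nonempty SA) clY (Y_convex SA) y.
have -> : (fun o => crd (gF (u o)) i) =
    (fun o => (fun v => crd (gF (proj X v.1, proj Y v.2)) i) (u o)).
  apply/funext => o; have [ux uy] := uXY o; congr (crd (gF _) i).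
  rewrite (proj_id (X_nonempty SA) (X_closed SA) (X_convex SA) ux).
  by rewrite (proj_id (Y_nonempty SA) clY (Y_convex SA) uy) -surjective_pairing.
apply: (@sqint_lipschitz _ _ _ P n p A u (fun v => crd (gF (proj X v.1, proj Y v.2)) i) _ sA (sqr_ge0 L)) => // v v'.
rewrite -crdB; apply: le_trans (crd_le _ _) _.
have := grad_lipschitz_sqr SA (z := (proj X v.1, proj Y v.2)) (z' := (proj X v'.1, proj Y v'.2))
  (conj (pX _) (pY _)) (conj (pX _) (pY _)).
move=> H; apply: le_trans H _; rewrite ler_wpM2l ?sqr_ge0//.
apply: lerD.
  exact: (proj_nonexpansive (X_nonempty SA) (X_closed SA) (X_convex SA)).
exact: (proj_nonexpansive (Y_nonempty SA) clY (Y_convex SA)).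
Qed.

(** The saddle point is a Lipschitz function of the center. *)
Lemma vsq_saddle A V : Defs.sub_sigma_algebra A -> vsq P A V ->
  psq P A (fun o => saddle (X := X) (Y := Y) (D := D) (f := f) (L := L) (tau := tau) (V o)).
Proof.
move=> sA pV; have t0 := sp_tau0 SP.
split.
  apply: (@vsq_lipschitz _ _ _ P A _ _ (fun z => (saddle z).1) 4 V sA _ _ pV) => // z z'.
  exact: (saddle_stable_x SS (ltW t0) (saddleP SA SP z') (saddleP SA SP z)).
apply: (@vsq_lipschitz _ _ _ P A _ _ (fun z => (saddle z).2) (L / tau) V sA _ _ pV) => [|z z']; first by rewrite divr_ge0 ?ltW.
have := saddle_stable_y SS (saddleP SA SP z') (saddleP SA SP z).
by rewrite -ler_pdivlMl // => /le_trans; apply; rewrite mulrA (mulrC tau^-1).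
Qed.

(* Fl j is the information available before request j is answered. *)
Variables (T : nat) (Fl : nat -> set (set Omega)) (rq : Omega -> @estimator R n p).
Hypothesis sFl : forall j, (j <= 3 * T)%N -> Defs.sub_sigma_algebra (Fl j).
Hypothesis iFl : forall j, (j < 3 * T)%N -> Fl j `<=` Fl j.+1.
Hypothesis rqFl : forall j u' g' u, (j < 3 * T)%N ->
  psq P (Fl j) u' -> psq P (Fl j) g' -> psq P (Fl j) u ->
  (forall o, (X `*` Y) (u o)) -> ((0 < j)%N -> forall o, (X `*` Y) (u' o)) ->
  psq P (Fl j.+1) (fun o => rq o j (u' o, g' o) (u o)).

Let st t o := at_run X Y L c (rq o) x0 y0 t.
Let req j o := ask X Y L c (rq o) x0 y0 j.

Record state_sq A (s : Omega -> @state R n p) : Prop := StateSq {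
  sq_x : vsq P A (fun o => x_of (s o)); sq_y : vsq P A (fun o => y_of (s o));
  sq_z : vsq P A (fun o => z_of (s o)); sq_xi : vsq P A (fun o => xi_of (s o));
  sq_n : vsq P A (fun o => n_of (s o)); sq_v : vsq P A (fun o => v_of (s o));
  sq_u : psq P A (fun o => (last_of (s o)).1); sq_g : psq P A (fun o => (last_of (s o)).2) }.

Let req_XY j o : (X `*` Y) (req j o).1.
Proof. exact: (req_in SA SP Xx0 Yy0 (rq o) j). Qed.

Let sad := saddle (X := X) (Y := Y) (D := D) (f := f) (L := L) (tau := tau).
Let u0 t o := mom0 (X := X) (Y := Y) (D := D) (f := f) (L := L) (tau := tau) (h := h)
  (a := a) (al := al) (k := k) (be := be) x0 y0 (rq o) t.

Ltac vs := repeat first [assumption | apply: vsqB | apply: vsqD | apply: vsqZ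
  | apply: vsq_projX | apply: vsq_projY].

(** Every vector of an iteration is a linear combination or a projection of earlier
    ones and of the estimates available at that time. *)
Let step_sq t : (t < T)%N -> state_sq (Fl (3 * t)%N) (st t) ->
  [/\ state_sq (Fl (3 * t.+1)%N) (st t.+1),
      forall r, (r < 3)%N -> psq P (Fl (3 * t + r)%N) (fun o => (req (3 * t + r)%N o).1) /\
         psq P (Fl (3 * t + r).+1) (fun o => (req (3 * t + r)%N o).2) &
      vsq P (Fl (3 * t + 2)%N) (u0 t)].
Proof.
move=> tT [].
pose x o := x_of (st t o); pose y o := y_of (st t o); pose z o := z_of (st t o).
pose xi o := xi_of (st t o); pose nu o := n_of (st t o); pose v o := v_of (st t o).
rewrite -/x -/y -/z -/xi -/nu -/v => sx sy sz sxi sn sv slu slg.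
have j0 : (3 * t < 3 * T)%N by rewrite ltn_mul2l.
have j1 : (3 * t + 1 < 3 * T)%N by lia.
have j2 : (3 * t + 2 < 3 * T)%N by lia.
have e3 : (3 * t.+1 = (3 * t + 2).+1)%N by lia.
have e2 : (3 * t + 2 = (3 * t + 1).+1)%N by lia.
have e1 : (3 * t + 1 = (3 * t).+1)%N by lia.
have sA0 := sFl (ltnW j0); have sA1 := sFl (ltnW j1); have sA2 := sFl (ltnW j2).
have sA3 : Defs.sub_sigma_algebra (Fl (3 * t.+1)) by apply: sFl; rewrite leq_mul2l.
have i01 : Fl (3 * t)%N `<=` Fl (3 * t + 1)%N by rewrite e1; exact: iFl.
have i12 : Fl (3 * t + 1)%N `<=` Fl (3 * t + 2)%N by rewrite e2; exact: iFl.
have i23 : Fl (3 * t + 2)%N `<=` Fl (3 * t.+1)%N by rewrite e3; exact: iFl.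
have i02 := subset_trans i01 i12.
have r0 o : req (3 * t)%N o = ask0 X Y L c (rq o) x0 y0 t by exact: ask_3t.
have r1 o : req (3 * t + 1)%N o = ask1 X Y L c (rq o) x0 y0 t by exact: ask_3t1.
have r2 o : req (3 * t + 2)%N o = ask2 X Y L c (rq o) x0 y0 t by exact: ask_3t2.
pose q0 o := (req (3 * t)%N o).1; pose g0 o := (req (3 * t)%N o).2.
pose q1 o := (req (3 * t + 1)%N o).1; pose g1 o := (req (3 * t + 1)%N o).2.
pose q2 o := (req (3 * t + 2)%N o).1; pose g2 o := (req (3 * t + 2)%N o).2.
have q0E : q0 = fun o => (x o, y o) by apply/funext => o; rewrite /q0 r0.
have pq0 : psq P (Fl (3 * t)%N) q0 by rewrite q0E.
have pg0 : psq P (Fl (3 * t + 1)%N) g0.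
  have -> : g0 = fun o => rq o (3 * t)%N ((last_of (st t o)).1, (last_of (st t o)).2) (q0 o).
    by apply/funext => o; rewrite /g0 /q0 r0 -surjective_pairing.
  rewrite e1; apply: rqFl => // [ o|t0 o]; first exact: req_XY.
  case: (t) t0 => // t' _; have := req_XY (3 * t' + 2)%N o.
  by rewrite /req ask_3t2.
have q1E : q1 = fun o => (proj X (x o - h *: ((g0 o).1 + (2 * L) *: (x o - z o) + xi o)),
    proj Y (y o + h *: ((g0 o).2 - tau *: y o - nu o + v o))).
  by apply/funext => o; rewrite /q1 /g0 r1 r0.
have pq1 : psq P (Fl (3 * t + 1)%N) q1.
  have [sg1 sg2] := pg0.
  have [sx' sy' sz'] := And3 (vsqS i01 sx) (vsqS i01 sy) (vsqS i01 sz).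
  have [sxi' sn' sv'] := And3 (vsqS i01 sxi) (vsqS i01 sn) (vsqS i01 sv).
  by rewrite q1E; split => /=; vs.
have pg1 : psq P (Fl (3 * t + 2)%N) g1.
  have -> : g1 = fun o => rq o (3 * t + 1)%N (q0 o, g0 o) (q1 o).
    by apply/funext => o; rewrite /g1 /q1 /q0 /g0 r1 r0.
  rewrite e2; apply: rqFl => // [|o|_ o]; try exact: req_XY.
  exact: psqS pq0.
have {}sx := vsqS i02 sx; have {}sy := vsqS i02 sy; have {}sz := vsqS i02 sz.
have {}sxi := vsqS i02 sxi; have {}sn := vsqS i02 sn; have {}sv := vsqS i02 sv.
have [sq1 sq1'] := psqS i12 pq1; have [sg1 sg1'] := pg1.
pose x1 o := x_of (st t.+1 o); pose y1 o := y_of (st t.+1 o).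
pose n1 o := n_of (st t.+1 o).
have x1E : x1 = fun o => proj X (x o - h *: ((g1 o).1 + (2 * L) *: ((q1 o).1 - z o))).
  apply/funext => o; have [e _ _ _ _] := runS X Y L c (rq o) x0 y0 t.
  by rewrite [LHS]e /g1 /q1 r1.
have y1E : y1 = fun o => proj Y (y o + h *: ((g1 o).2 - tau *: (q1 o).2 +
     (al *: v o + k *: ((g1 o).2 - tau *: (q1 o).2)))).
  apply/funext => o; have [_ e _ _ _] := runS X Y L c (rq o) x0 y0 t.
  by rewrite [LHS]e /g1 /q1 r1.
have sx1 : vsq P (Fl (3 * t + 2)%N) x1 by rewrite x1E; vs.
have sy1 : vsq P (Fl (3 * t + 2)%N) y1 by rewrite y1E; vs.
have n1E : n1 = fun o => (1 + k)^-1 *: (h^-1 *: (y o - y1 o) + (g1 o).2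
     - tau *: (q1 o).2 + (al *: v o + k *: ((g1 o).2 - tau *: (q1 o).2))).
  apply/funext => o; have [_ _ _ e _] := runS X Y L c (rq o) x0 y0 t.
  by rewrite /n1 [LHS]e /g1 /q1 r1.
have sn1 : vsq P (Fl (3 * t + 2)%N) n1 by rewrite n1E; vs.
have sxi1 : vsq P (Fl (3 * t + 2)%N) (fun o => xi_of (st t.+1 o)).
  rewrite (_ : (fun o => _) = fun o => h^-1 *: (x o - x1 o) - (g1 o).1
      - (2 * L) *: ((q1 o).1 - z o)); first by vs.
  apply/funext => o; have [_ _ e _ _] := runS X Y L c (rq o) x0 y0 t.
  by rewrite [LHS]e /g1 /q1 r1.
have sz1 : vsq P (Fl (3 * t + 2)%N) (fun o => z_of (st t.+1 o)).
  rewrite (_ : (fun o => _) = fun o => z o + be *: (x1 o - z o)); first by vs.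
  by apply/funext => o; have [_ _ _ _ [e _ _ _]] := runS X Y L c (rq o) x0 y0 t; rewrite [LHS]e.
have q2E : q2 = fun o => (x1 o, y1 o).
  apply/funext => o; have [_ _ _ _ [_ _ e _]] := runS X Y L c (rq o) x0 y0 t.
  by rewrite /q2 r2 [LHS]e.
have pq2 : psq P (Fl (3 * t + 2)%N) q2 by rewrite q2E.
have pg2 : psq P (Fl (3 * t.+1)%N) g2.
  have -> : g2 = fun o => rq o (3 * t + 2)%N (q1 o, g1 o) (q2 o).
    apply/funext => o; have [_ _ _ _ [_ _ _ e]] := runS X Y L c (rq o) x0 y0 t.
    by rewrite /g2 r2 [LHS]e q2E /q1 /g1 r1 -surjective_pairing.
  rewrite e3; apply: rqFl => // [ o|_ o]; exact: req_XY.
split.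
- split; [exact: vsqS i23 sx1|exact: vsqS i23 sy1|exact: vsqS i23 sz1|exact: vsqS i23 sxi1
    |exact: vsqS i23 sn1| | |].
  + rewrite (_ : (fun o => _) = fun o => al *: v o + k *: ((g2 o).2 - tau *: y1 o - n1 o)).
      have [_ sg2'] := pg2; have sv' := vsqS i23 sv; have sy' := vsqS i23 sy1.
      by have sn' := vsqS i23 sn1; vs.
    apply/funext => o; have [_ _ _ _ [_ e _ _]] := runS X Y L c (rq o) x0 y0 t.
    by rewrite [LHS]e /g2 r2.
  + apply: psqS i23 _; rewrite (_ : (fun o => _) = q2) //.
    by apply/funext => o; rewrite /q2 r2.
  + by rewrite (_ : (fun o => _) = g2) //; apply/funext => o; rewrite /g2 r2.
- by case=> [|[|[|//]]] _; rewrite ?addn0; split => //; rewrite -?e1 -?e2 -?e3.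
- have -> : u0 t = fun o => al *: v o + k *: ((gF (q2 o)).2 - tau *: y1 o - n1 o)
      + (a / 2) *: (y1 o - (sad (z o)).2).
    by apply/funext => o; rewrite q2E.
  have [_ sG] := psq_gradient sA2 pq2 (fun o => req_XY _ o).
  have [_ sS] := vsq_saddle sA2 sz.
  by vs.
Qed.

Let init_sq : state_sq (Fl 0%N) (st 0).
Proof.
have s0 := sFl (leq0n _); split; try exact: vsq_cst; exact: psq_cst.
Qed.

Lemma run_sq t : (t <= T)%N -> state_sq (Fl (3 * t)%N) (st t).
Proof.
elim: t => [|t IH] tT; first by rewrite muln0; exact: init_sq.
by have [] := step_sq tT (IH (ltnW tT)).
Qed.

Lemma request_sq j : (j < 3 * T)%N ->
  psq P (Fl j) (fun o => (req j o).1) /\ psq P (Fl j.+1) (fun o => (req j o).2).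
Proof.
move=> jT; have tT : (j %/ 3 < T)%N by rewrite ltn_divLR // mulnC.
have [_ H _] := step_sq tT (run_sq (ltnW tT)).
have := H (j %% 3)%N; rewrite ltn_mod (mulnC 3%N) -divn_eq; exact.
Qed.

(** The factor of the last error is known before that request is answered. *)
Lemma predictable_sq t : (t < T)%N -> vsq P (Fl (3 * t + 2)%N) (u0 t).
Proof. by move=> tT; have [_ _] := step_sq tT (run_sq (ltnW tT)). Qed.

End RandomRun.

(** * The energy balance in expectation *)

(** The weight of the last error of a block is the number of its later
    requests: this weighted sum grows by one variance at each request. *)
Lemma sum_blocks {R : realType} (E mv : nat -> R) (q M : nat) (s r : R) :
  (0 < q)%N -> 0 <= s -> 0 <= r -> (forall j, 0 <= mv j) ->
  (forall j, (j < M)%N -> E j <= if (q %| j)%N then s else E j.-1 + r * mv j.-1) ->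
  \sum_(j < M) E j <= M%:R * s + q%:R * r * \sum_(j < M) mv j.
Proof.
move=> q0 s0 r0 mv0 HE.
case: M HE => [|M] HE; first by rewrite !big_ord0 mul0r mulr0 addr0.
pose wt j := minn (q.-1 - j %% q) (M - j).
suff H j : (j <= M)%N -> \sum_(i < j.+1) E i + (wt j)%:R * E j <=
    (j.+1 + wt j)%:R * s + q%:R * r * \sum_(i < j) mv i.
  have := H M (leqnn M); rewrite /wt subnn minn0 mul0r addr0 addn0 => /le_trans; apply.
  rewrite lerD2l ler_wpM2l ?mulr_ge0// big_ord_recr /= lerDl.
  exact: mv0.
elim: j => [|j IH] jM.
  have E0 := HE 0%N isT; rewrite dvdn0 in E0.
  rewrite big_ord_recr !big_ord0 /= add0r mulr0 addr0 natrD mulrDl mul1r.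
  by rewrite lerD // ler_wpM2l.
have {}IH := IH (ltnW jM).
have Ej := HE j.+1 jM.
rewrite big_ord_recr /=; case: ifP Ej => qj Ej.
  have w0 : wt j = 0%N.
    have : (j %% q = q.-1)%N.
      have := divn_eq j q; have : (j %% q < q)%N by rewrite ltn_mod.
      move: qj; rewrite /dvdn -addn1 -modnDml => /eqP.
      move: (j %% q)%N => r'; case: (ltnP (r' + 1) q) => h.
        by rewrite modn_small // addn1.
      by move=> _ h2 _; lia.
    by rewrite /wt => ->; rewrite subnn min0n.
  rewrite w0 mul0r addr0 addn0 in IH.
  have S0 : 0 <= q%:R * r * mv j by rewrite !mulr_ge0.
  rewrite [in leRHS]big_ord_recr /= mulrDr.
  rewrite -addrA -{1}[E j.+1]mul1r -mulrDl.
  have w1 : (1 + (wt j.+1)%:R) * E j.+1 <= (1 + (wt j.+1)%:R) * s.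
    by rewrite ler_wpM2l // addr_ge0.
  apply: le_trans (lerD IH w1) _.
  rewrite [(j.+2 + _)%:R]natrD -[in leRHS]natr1 !mulrDl !mul1r.
  move: (j.+1%:R * s) ((wt j.+1)%:R * s) (q%:R * r * _) (q%:R * r * _) S0 => a1 a2 a3 a4.
  by clear; lra.
have w1 : wt j = (wt j.+1).+1.
  have e : (j.+1 %% q = (j %% q).+1)%N.
    have := ltn_mod j q; rewrite q0; move: qj; rewrite /dvdn -addn1 -modnDml => /negbT.
    move: (j %% q)%N => r' h1 h2; rewrite modn_small ?addn1//.
    rewrite ltn_neqAle h2 andbT; apply: contra h1 => /eqP e; rewrite addn1 e modnn //.
  have : (j.+1 %% q < q)%N by rewrite ltn_mod.
  by rewrite /wt e; move: (j %% q)%N => r' h; lia.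
rewrite w1 in IH; rewrite -addrA -{1}[E j.+1]mul1r -mulrDl.
have e : 1 + (wt j.+1)%:R = (wt j.+1).+1%:R :> R by rewrite -natr1 addrC.
have w2 : (1 + (wt j.+1)%:R) * E j.+1 <= (1 + (wt j.+1)%:R) * (E j + r * mv j).
  by rewrite ler_wpM2l // addr_ge0.
have w3 : (wt j.+1).+1%:R * (r * mv j) <= q%:R * (r * mv j).
  rewrite ler_wpM2r ?mulr_ge0// ler_nat -w1 /wt.
  by apply: leq_trans (geq_minl _ _) _; apply: leq_trans (leq_subr _ _) (leq_pred _).
rewrite e in w2 *.
rewrite [in leRHS]big_ord_recr /= mulrDr addSnnS -(mulrA q%:R r (mv j)).
rewrite mulrDr in w2; move: IH w2 w3.
move: (_ * E j.+1) (_ * E j) ((wt j.+1).+1%:R * (r * _)) (q%:R * (r * mv j)) => a1 a2 a3 a4.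
move: (q%:R * r * _) (_ * s) => a5 a6; move: (bigop _ _ _) => a7; clear; lra.
Qed.

Section MeanBounds.
Context {R : realType} {n p : nat}.
Notation pt := ('rV[R]_n * 'rV[R]_p)%type.
Context {X : set 'rV[R]_n} {Y : set 'rV[R]_p}.
Context {dS : measure_display} {S : measurableType dS} {D : probability S R}.
Context {f : pt -> S -> R^o} {gradf : pt -> S -> pt} {L : R}.
Hypothesis SA : standing_assumptions X Y D f gradf L.
Context {d : measure_display} {Omega : measurableType d} {P : probability Omega R}.
Context {tau h a al k be : R}.
Hypothesis SP : step_params L tau h a al k be.
Variables (x0 : 'rV[R]_n) (y0 : 'rV[R]_p).
Hypotheses (Xx0 : X x0) (Yy0 : Y y0).
Variables (T : nat) (Fl : nat -> set (set Omega)) (rq : Omega -> @estimator R n p).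
Hypothesis sFl : forall j, (j <= 3 * T)%N -> Defs.sub_sigma_algebra (Fl j).
Hypothesis iFl : forall j, (j < 3 * T)%N -> Fl j `<=` Fl j.+1.
Hypothesis rqFl : forall j u' g' u, (j < 3 * T)%N ->
  psq P (Fl j) u' -> psq P (Fl j) g' -> psq P (Fl j) u ->
  (forall o, (X `*` Y) (u o)) -> ((0 < j)%N -> forall o, (X `*` Y) (u' o)) ->
  psq P (Fl j.+1) (fun o => rq o j (u' o, g' o) (u o)).

Let gF := grad2 (objective D f).
Let c := Params tau h al k be.
Let B0 := initial_quantity X Y D f L x0 y0.
Let req j o := ask X Y L c (rq o) x0 y0 j.
Let err j o := req_err (X := X) (Y := Y) (D := D) (f := f) (L := L) (tau := tau) (h := h)
  (al := al) (k := k) (be := be) x0 y0 (rq o) j.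
Let move j o := req_move (X := X) (Y := Y) (L := L) (tau := tau) (h := h)
  (al := al) (k := k) (be := be) x0 y0 (rq o) j.
Let gap t o := center_gap (X := X) (Y := Y) (D := D) (f := f) (L := L) (tau := tau) (h := h)
  (al := al) (k := k) (be := be) x0 y0 (rq o) t.
Let u0 t o := mom0 (X := X) (Y := Y) (D := D) (f := f) (L := L) (tau := tau) (h := h)
  (a := a) (al := al) (k := k) (be := be) x0 y0 (rq o) t.

Let req_sq j := request_sq SA SP Xx0 Yy0 sFl iFl rqFl (j := j).

Lemma err_sq j : (j < 3 * T)%N -> psq P (Fl j.+1) (err j).
Proof.
move=> jT; have [pu pg] := req_sq jT; have sA := sFl jT.
apply: psqB => //; apply: psqS (iFl jT) _; apply: (psq_gradient SA (sFl (ltnW jT)) pu).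
by move=> o; exact: (req_in SA SP Xx0 Yy0 (rq o) j).
Qed.

Lemma gap_sq t : (t < T)%N -> vsq P (Fl (3 * t)%N)
  (fun o => z_of (at_run X Y L c (rq o) x0 y0 t)) /\ summable P (gap t) /\ measurable_wrt (Fl (3 * t)%N) (gap t).
Proof.
move=> tT; have sA : Defs.sub_sigma_algebra (Fl (3 * t)%N) by apply: sFl; rewrite leq_mul2l ltnW.
have pz := sq_z (run_sq SA SP Xx0 Yy0 sFl iFl rqFl (ltnW tT)).
have [ps _] := vsq_saddle SA SP sA pz; have pd := vsqB sA pz ps.
split => //; split; first exact: (vsq_dot sA pd pd).
by rewrite /gap /center_gap /dot; apply: wrt_sum sA.1 _ => i; apply: wrtM sA.1 (pd i).1 (pd i).1.
Qed.

Lemma move_sq j : (j < 3 * T)%N -> summable P (move j).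
Proof.
move=> jT; have [pu pg] := req_sq jT.
case: (ltnP (j + 1) (3 * T)) => hj.
  have [pu' _] := req_sq hj; have sA := sFl (ltnW hj).
  apply: (psq_sqn sA (psqB sA pu' (psqS _ pu))).
  by rewrite addn1; exact: iFl.
have -> : j = (3 * (T.-1) + 2)%N by lia.
rewrite (_ : move _ = fun=> 0); first exact: summable_cst.
by apply/funext => o; exact: req_stay.
Qed.

Let mean_sum_err : summable P (fun o => \sum_(j < 3 * T) sqn (err j o)) /\
  mean P (fun o => \sum_(j < 3 * T) sqn (err j o)) = \sum_(j < 3 * T) mean P (fun o => sqn (err j o)).
Proof.
have s (j : 'I_(3 * T)) : summable P (fun o => sqn (err j o)).
  exact: psq_sqn (sFl (ltn_ord j)) (err_sq (ltn_ord j)).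
by split; [exact: summable_sum|exact: mean_sum].
Qed.

(** The pairings with the momentum have mean zero, since their first factor is
    known before the centered second one. *)
Lemma mean_bound_unbiased (V : R) :
  (forall j, (j < 3 * T)%N -> pcentered P (Fl j) (err j)) ->
  (forall j, (j < 3 * T)%N -> mean P (fun o => sqn (err j o)) <= V) ->
  be * L ^+ 2 * \sum_(t < T) mean P (gap t) <= L * B0 + 7 * ((3 * T)%:R * V).
Proof.
move=> ce mV.
have sg (t : 'I_T) : summable P (gap t) by have [_ []] := gap_sq (ltn_ord t).
have j2 (t : 'I_T) : (3 * t + 2 < 3 * T)%N by have := ltn_ord t; lia.
have sd (t : 'I_T) i : summable P (fun o => u0 t o 0 i * (err (3 * t + 2)%N o).2 0 i).
  have sA := sFl (j2 t); have [_ e2] := err_sq (j2 t).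
  have pu := vsqS (iFl (j2 t)) (predictable_sq SA SP Xx0 Yy0 sFl iFl rqFl (ltn_ord t)).
  exact: (sqint_mul sA (pu i) (e2 i)).
have sc (t : 'I_T) : summable P (fun o => dot (u0 t o) (err (3 * t + 2)%N o).2).
  by apply: summable_sum => i; exact: sd.
have cross (t : 'I_T) : mean P (fun o => dot (u0 t o) (err (3 * t + 2)%N o).2) = 0.
  rewrite mean_sum //; apply: big1 => i _.
  have pu := predictable_sq SA SP Xx0 Yy0 sFl iFl rqFl (ltn_ord t).
  have /psq_crd/(_ (inr i)) se := err_sq (j2 t).
  apply: (mean_centered (sFl (ltnW (j2 t))) (pu i).1 _ (sd t i)).
    exact: sqint_summable (sFl (j2 t)) se.
  exact: ce (j2 t) (inr i).
have [se me] := mean_sum_err.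
have H := mean_le (P := P) (f := fun o => \sum_(t < T) (be * L ^+ 2 * gap t o))
  (g := fun o => L * B0 + \sum_(t < T) (3 / 2 * (h * (L / 2 - a)) * dot (u0 t o) (err (3 * t + 2)%N o).2)
      + 7 * \sum_(j < 3 * T) sqn (err j o)) _ _
  (fun o => run_bound_unbiased SA SP Xx0 Yy0 (rq o) T).
have s1 : summable P (fun o => \sum_(t < T) (be * L ^+ 2 * gap t o)).
  by apply: summable_sum => t; exact: summableZ.
have s2 : summable P (fun o => \sum_(t < T) (3 / 2 * (h * (L / 2 - a)) * dot (u0 t o) (err (3 * t + 2)%N o).2)).
  by apply: summable_sum => t; exact: summableZ.
have s3 := summableZ 7 se; have s4 := summableD (summable_cst P (L * B0)) s2.
have {}H := H s1 (summableD s4 s3).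
rewrite meanD // meanD // in H; last exact: summable_cst.
rewrite mean_cst meanZ // me in H.
rewrite mean_sum in H; last by move=> t; exact: summableZ.
rewrite mean_sum in H; last by move=> t; exact: summableZ.
have gE : \sum_(t < T) mean P (fun o => be * L ^+ 2 * gap t o) =
    be * L ^+ 2 * \sum_(t < T) mean P (gap t).
  by rewrite mulr_sumr; apply: eq_bigr => t _; rewrite meanZ.
rewrite gE in H; apply: le_trans H _.
rewrite [X in _ + X + _]big1 ?addr0; last by move=> t _; rewrite meanZ // cross mulr0.
rewrite lerD2l ler_wpM2l //; apply: le_trans (_ : \sum_(j < 3 * T) V <= _).
  by apply: ler_sum => j _; exact: mV.
by rewrite sumr_const card_ord mulr_natl.
Qed.

(** The displacement part of the accumulated errors is dominated by the displacement
    term on the left of the pathwise bound. *)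
Lemma mean_bound_recursive (V r : R) (q : nat) : (0 < q)%N -> 0 <= V -> 0 <= r ->
  (forall j, (j < 3 * T)%N -> mean P (fun o => sqn (err j o)) <=
     if (q %| j)%N then V else mean P (fun o => sqn (err j.-1 o)) + r * mean P (move j.-1)) ->
  (200 * be)^-1 * (q%:R * r) <= be * L ^+ 2 ->
  be * L ^+ 2 * \sum_(t < T) mean P (gap t) <= L * B0 + (200 * be)^-1 * ((3 * T)%:R * V).
Proof.
move=> q0 V0 r0 mV qr.
have sg (t : 'I_T) : summable P (gap t) by have [_ []] := gap_sq (ltn_ord t).
have sm (j : 'I_(3 * T)) : summable P (move j) by exact: move_sq.
have m0 j o : 0 <= move j o by exact: sqn_ge0.
have [se me] := mean_sum_err.
have H := mean_le (P := P) (f := fun o => \sum_(t < T) (be * L ^+ 2 * gap t o)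
     + be * L ^+ 2 * \sum_(j < 3 * T) move j o)
  (g := fun o => L * B0 + (200 * be)^-1 * \sum_(j < 3 * T) sqn (err j o)) _ _
  (fun o => run_bound_recursive SA SP Xx0 Yy0 (rq o) T).
have s1 : summable P (fun o => \sum_(t < T) (be * L ^+ 2 * gap t o)).
  by apply: summable_sum => t; exact: summableZ.
have s2 : summable P (fun o => \sum_(j < 3 * T) move j o) by exact: summable_sum.
have s3 := summableZ (be * L ^+ 2) s2; have s4 := summableZ (200 * be)^-1 se.
have {}H := H (summableD s1 s3) (summableD (summable_cst P (L * B0)) s4).
rewrite meanD // meanD // in H; last exact: summable_cst.
rewrite mean_cst !meanZ // me in H.
rewrite mean_sum in H; last by move=> t; exact: summableZ.
rewrite mean_sum in H => //.
have gE : \sum_(t < T) mean P (fun o => be * L ^+ 2 * gap t o) =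
    be * L ^+ 2 * \sum_(t < T) mean P (gap t).
  by rewrite mulr_sumr; apply: eq_bigr => t _; rewrite meanZ.
rewrite gE in H.
have HB := sum_blocks q0 V0 r0 (fun j => mean_ge0 P (m0 j)) mV.
have be0 : 0 < be.
  by rewrite (sp_be SP) divr_gt0 // mulr_gt0 ?(sp_h0 SP) ?(sp_a0 SP).
have i0 : 0 <= (200 * be)^-1 by rewrite invr_ge0; apply: mulr_ge0 (ltW be0); rewrite ler0n.
have S0 : 0 <= \sum_(j < 3 * T) mean P (move j) by apply: sumr_ge0 => j _; exact: mean_ge0.
have {}H : be * L ^+ 2 * \sum_(t < T) mean P (gap t)
    + be * L ^+ 2 * \sum_(j < 3 * T) mean P (move j) <=
  L * B0 + (200 * be)^-1 * \sum_(j < 3 * T) mean P (fun o => sqn (err j o)) by exact: H.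
have := ler_wpM2l i0 HB; have := ler_wpM2r S0 qr; rewrite mulrDr mulrA.
move: H; move: (\sum_(_ < 3 * T) mean P (move _)) (be * L ^+ 2 * _) => q1 q2.
by move: ((200 * be)^-1) (_%:R * V) (L * B0) (\sum_(_ < 3 * T) _) => q3 q4 q5 q6; lra.
Qed.

End MeanBounds.

(** * Batches of gradients *)

Lemma average_const {R : realType} (V : lmodType R) (m : nat) (v : V) :
  m%:R != 0 :> R -> m%:R^-1 *: (v *+ m) = v.
Proof. by move=> m0; rewrite -[v *+ m]scaler_nat scalerA mulVf // scale1r. Qed.

Section Batches.
Context {R : realType} {n p : nat}.
Notation pt := ('rV[R]_n * 'rV[R]_p)%type.
Context {X : set 'rV[R]_n} {Y : set 'rV[R]_p}.
Context {dS : measure_display} {S : measurableType dS} {D : probability S R}.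
Context {f : pt -> S -> R^o} {gradf : pt -> S -> pt} {L : R}.
Hypothesis SA : standing_assumptions X Y D f gradf L.
Context {d : measure_display} {Omega : measurableType d} {P : probability Omega R}.
Context {sigma : R}.
Hypothesis so : stochastic_oracle X Y D f gradf P sigma.
Variables (M : nat) (N : nat -> nat) (w : nat * nat -> Omega -> S).

Definition batch_indices : set (nat * nat) := [set a | (a.1 < M)%N /\ (a.2 < N a.1)%N].
(** Samples are drawn in lexicographic order of (request, index), so info j i is
    known just before the i-th sample of request j. *)
Definition drawn_before (j i : nat) : set (nat * nat) :=
  [set a | batch_indices a /\ ((a.1 < j)%N \/ a.1 = j /\ (a.2 < i)%N)].
Definition info (j i : nat) := sample_sigma (drawn_before j i) w.

Hypothesis iid : iid_samples P D batch_indices w.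
Let gF := grad2 (objective D f).

Lemma info_sub j i : Defs.sub_sigma_algebra (info j i).
Proof. by apply: sample_sigma_sub => a [Ia _]; have [] := iid.1 a Ia. Qed.

Lemma infoS j i j' i' : (j < j')%N \/ j = j' /\ (i <= i')%N -> info j i `<=` info j' i'.
Proof. by move=> h; apply: sample_sigmaS => a /= [Ia h']; split => //; lia. Qed.

Lemma info_all j i : info j i `<=` sample_sigma batch_indices w.
Proof. by apply: sample_sigmaS => a []. Qed.

Lemma info_next j : info j (N j) = info j.+1 0.
Proof.
rewrite /info; congr sample_sigma; apply/seteqP; split => -[a1 a2] /= [Ia h]; split => //.
  by lia.
case: h => h; last by lia.
move: h; rewrite ltnS leq_eqVlt => /predU1P[/= e|]; last by left.
by right; split => //; case: Ia => _ /=; rewrite e.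
Qed.

Lemma draw_fresh j i : (j < M)%N -> (i < N j)%N -> fresh_sample P D (info j i) (w (j, i)).
Proof.
move=> jM iN; apply: (iid_fresh iid); first by move=> a [].
  by split.
by move=> [_ /=]; lia.
Qed.

Lemma draw_wrt j i : (j < M)%N -> (i < N j)%N -> sample_wrt (info j i.+1) (w (j, i)).
Proof. by move=> jM iN; apply: sample_sigma_wrt; split; [split|right]. Qed.

Lemma info_start j i : info j 0 `<=` info j i.
Proof. by apply: infoS; right. Qed.

(** Averaging N j independent centered errors divides their variance by N j. *)
Lemma batch_mean j u : (j < M)%N -> (0 < N j)%N -> psq P (info j 0) u -> (forall o, (X `*` Y) (u o)) ->
  let e o := (N j)%:R^-1 *: \sum_(i < N j) gradf (u o) (w (j, val i) o) - gF (u o) in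
  [/\ psq P (info j.+1 0) e, pcentered P (info j 0) e &
      mean P (fun o => sqn (e o)) <= sigma ^+ 2 / (N j)%:R].
Proof.
move=> jM N0 pu uXY e.
have NR : (N j)%:R != 0 :> R by rewrite pnatr_eq0 -lt0n.
have eE : e = fun o => 0 + (N j)%:R^-1 *: \sum_(i < N j) (gradf (u o) (w (j, val i) o) - gF (u o)).
  apply/funext => o; rewrite add0r /e sumrB scalerBr sumr_const card_ord.
  by rewrite average_const.
have eE' : e = fun o => (N j)%:R^-1 *: \sum_(i < N j) (gradf (u o) (w (j, val i) o) - gF (u o)).
  by rewrite eE; apply/funext => o; rewrite add0r.
have [] := @batch_error R n p d Omega P (info j) (fun=> 0)
   (fun i o => gradf (u o) (w (j, i) o) - gF (u o)) (N j) (N j)%:R^-1 (sigma ^+ 2).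
- by move=> i _; exact: info_sub.
- by move=> i _; apply: infoS; right.
- exact: psq_cst (info_sub _ _).
- move=> i iN.
  have [h1 h2 h3] := sample_error SA so (info_sub j i) (info_sub j i.+1)
    (infoS (or_intror (conj erefl (leqnSn i)))) (psq_vec (psqS (@info_start j i) pu)) uXY
    (draw_fresh jM iN) (draw_wrt jM iN).
  by split.
rewrite info_next => h1 h2 h3; split; [by rewrite eE|by rewrite eE'|rewrite eE].
apply: le_trans h3 _.
have -> : mean P (fun=> sqn (0 : pt)) = 0 by rewrite mean_cst /sqn /= !dot0r addr0.
rewrite add0r expr2 mulrA mulrA divff // mul1r mulrC lexx //.
Qed.

(** Given the past, the average of paired differences has the difference of the
    gradients as its mean. Its centered part has at most the second
    moment of the paired difference, and is orthogonal to any earlier error E. *)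
Lemma batch_difference (ell : R) j u v : paired_oracle X Y D gradf P ell ->
  (j < M)%N -> (0 < N j)%N ->
  psq P (info j 0) u -> (forall o, (X `*` Y) (u o)) ->
  psq P (info j 0) v -> (forall o, (X `*` Y) (v o)) ->
  let e o := (N j)%:R^-1 *: \sum_(i < N j) (gradf (u o) (w (j, val i) o) - gradf (v o) (w (j, val i) o))
       - (gF (u o) - gF (v o)) in
  psq P (info j.+1 0) e /\ forall E, psq P (info j 0) E ->
      mean P (fun o => sqn (E o + e o)) <= mean P (fun o => sqn (E o)) +
         ell ^+ 2 / (N j)%:R * mean P (fun o => sqn (u o - v o)).
Proof.
move=> po jM N0 pu uXY pv vXY e.
have NR : (N j)%:R != 0 :> R by rewrite pnatr_eq0 -lt0n.
pose Z i o : pt := (gradf (u o) (w (j, i) o) - gradf (v o) (w (j, i) o)) - (gF (u o) - gF (v o)).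
have eE : e = fun o => (N j)%:R^-1 *: \sum_(i < N j) Z i o.
  apply/funext => o; rewrite /e /Z [in RHS]sumrB scalerBr; congr (_ - _).
  by rewrite sumr_const card_ord average_const.
have sA := info_sub j 0.
have pD := psqB sA (psq_gradient SA sA pu uXY) (psq_gradient SA sA pv vXY).
have HZ i : (i < N j)%N -> [/\ psq P (info j i.+1) (Z i), pcentered P (info j i) (Z i) &
    mean P (fun o => sqn (Z i o)) <= ell ^+ 2 * mean P (fun o => sqn (u o - v o))].
  move=> iN; have i1 : info j i `<=` info j i.+1 := infoS (or_intror (conj erefl (leqnSn i))).
  have s1 := info_sub j i; have s2 := info_sub j i.+1.
  have pu' := psqS (@info_start j i) pu; have pv' := psqS (@info_start j i) pv.
  have [u1 _ u3] := sample_error SA so s1 s2 i1 (psq_vec pu') uXY (draw_fresh jM iN) (draw_wrt jM iN).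
  have [v1 _ v3] := sample_error SA so s1 s2 i1 (psq_vec pv') vXY (draw_fresh jM iN) (draw_wrt jM iN).
  have [d1 d2] := sample_difference SA po s1 s2 i1 pu' uXY pv' vXY (draw_fresh jM iN) (draw_wrt jM iN).
  have pDi := psqS (@info_start j i) pD.
  have pZ : psq P (info j i.+1) (Z i) by apply: (psqB s2 d1); exact: psqS i1 pDi.
  have cZ : pcentered P (info j i) (Z i).
    have -> : Z i = fun o => (gradf (u o) (w (j, i) o) - gF (u o))
        + (-1) *: (gradf (v o) (w (j, i) o) - gF (v o)).
      apply/funext => o; rewrite /Z scaleN1r; move: (gradf _ _) (gradf _ _) (gF _) (gF _).
      by move=> a1 a2 a3 a4; rewrite !opprB addrACA [RHS]addrACA; congr (_ + _); exact: addrC.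
    exact: (pcenteredD s1 s2 u1 (psqZ (-1) s2 v1) u3 (pcenteredZ (-1) s1 s2 v1 v3)).
  split => //; apply: le_trans d2.
  have -> : (fun o => sqn (gradf (u o) (w (j, i) o) - gradf (v o) (w (j, i) o))) =
      fun o => sqn ((gF (u o) - gF (v o)) + Z i o).
    by apply/funext => o; rewrite /Z [X in _ = sqn X]addrC subrK.
  rewrite (mean_sqn_add s1 s2 i1 pDi pZ cZ) lerDr; apply: mean_ge0 => o; exact: sqn_ge0.
have BE E : psq P (info j 0) E -> _ := fun pE => @batch_error R n p d Omega P (info j) E Z (N j)
  (N j)%:R^-1 (ell ^+ 2 * mean P (fun o => sqn (u o - v o)))
  (fun i _ => info_sub j i) (fun i _ => infoS (or_intror (conj erefl (leqnSn i)))) pE HZ.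
split.
  have [h _ _] := BE (fun=> 0) (psq_cst P 0 sA); rewrite info_next in h; rewrite eE.
  suff -> : (fun o => (N j)%:R^-1 *: \sum_(i < N j) Z i o) =
     fun o => 0 + (N j)%:R^-1 *: \sum_(i < N j) Z i o by [].
  by apply/funext => o; rewrite add0r.
move=> E pE; have [_ _ h] := BE E pE; rewrite eE; apply: le_trans h _.
rewrite lerD2l le_eqVlt; apply/orP; left; apply/eqP; field; exact: NR.
Qed.

End Batches.

(** * The two methods *)

(** With g the previous estimate, G the increment, and a, b the gradients at the new
    and the previous query point, the new error is the previous one plus the error
    of the increment. *)
Lemma recursive_error (V : zmodType) (g G a b : V) : g + G - a = g - b + (G - (a - b)).
Proof. by rewrite opprB [RHS]addrACA addKr. Qed.

Section Estimators.
Context {R : realType} {n p : nat}.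
Notation pt := ('rV[R]_n * 'rV[R]_p)%type.
Context {X : set 'rV[R]_n} {Y : set 'rV[R]_p}.
Context {dS : measure_display} {S : measurableType dS} {D : probability S R}.
Context {f : pt -> S -> R^o} {gradf : pt -> S -> pt} {L : R}.
Hypothesis SA : standing_assumptions X Y D f gradf L.
Context {d : measure_display} {Omega : measurableType d} {P : probability Omega R}.
Context {sigma : R}.
Hypothesis so : stochastic_oracle X Y D f gradf P sigma.
Context {tau h a al k be : R}.
Hypothesis SP : step_params L tau h a al k be.
Variables (x0 : 'rV[R]_n) (y0 : 'rV[R]_p).
Hypotheses (Xx0 : X x0) (Yy0 : Y y0).
Variables (T : nat) (w : nat * nat -> Omega -> S).

Let gF := grad2 (objective D f).
Let c := Params tau h al k be.
Let B0 := initial_quantity X Y D f L x0 y0.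
Let gap rq t (o : Omega) := center_gap (X := X) (Y := Y) (D := D) (f := f) (L := L) (tau := tau) (h := h)
  (al := al) (k := k) (be := be) x0 y0 (rq o) t.
Let err rq j (o : Omega) := req_err (X := X) (Y := Y) (D := D) (f := f) (L := L) (tau := tau) (h := h)
  (al := al) (k := k) (be := be) x0 y0 (rq o) j.

Lemma ask_at (rq : @estimator R n p) j : exists last,
  (ask X Y L c rq x0 y0 j).2 = rq j last (ask X Y L c rq x0 y0 j).1.
Proof.
case: j => [|j]; last by exists (ask X Y L c rq x0 y0 j); rewrite ask_rec.
by exists (0, 0); rewrite -[0%N]/(3 * 0)%N ask_3t.
Qed.

Section Spde.
Variable m : nat.
Hypothesis m0 : (0 < m)%N.
Hypothesis iid : iid_samples P D (spde_indices T m) w.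
Let rq o := spde_req gradf m (fun a => w a o).
Let Fl j := info (3 * T) (fun=> m) w j 0.
Let sFl j : Defs.sub_sigma_algebra (Fl j) := info_sub iid j 0.
Let iFl j : Fl j `<=` Fl j.+1.
Proof. by apply: infoS; left. Qed.

Let rqFl j u' g' u : (j < 3 * T)%N ->
  psq P (Fl j) u' -> psq P (Fl j) g' -> psq P (Fl j) u ->
  (forall o, (X `*` Y) (u o)) -> ((0 < j)%N -> forall o, (X `*` Y) (u' o)) ->
  psq P (Fl j.+1) (fun o => rq o j (u' o, g' o) (u o)).
Proof.
move=> jT _ _ pu uXY _; have [pe _ _] := batch_mean SA so iid jT m0 pu uXY.
rewrite (_ : (fun o => _) = fun o => (rq o j (u' o, g' o) (u o) - gF (u o)) + gF (u o)).
  exact: (psqD (sFl j.+1) pe (psqS (@iFl j) (psq_gradient SA (sFl j) pu uXY))).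
by apply/funext => o; rewrite subrK.
Qed.

Lemma spde_bound : be * L ^+ 2 * \sum_(t < T) mean P (gap rq t) <=
  L * B0 + 7 * ((3 * T)%:R * (sigma ^+ 2 / m%:R)).
Proof.
have req_sq j := request_sq SA SP Xx0 Yy0 (fun j _ => sFl j) (fun j _ => @iFl j) rqFl (j := j).
have H j : (j < 3 * T)%N -> pcentered P (Fl j) (err rq j) /\ mean P (fun o => sqn (err rq j o)) <= sigma ^+ 2 / m%:R.
  move=> jT; have [pu _] := req_sq j jT.
  have uXY o := req_in SA SP Xx0 Yy0 (rq o) j.
  have [_ h1 h2] := batch_mean SA so iid jT m0 pu uXY.
  have e : err rq j = fun o => m%:R^-1 *: \sum_(i < m) gradf (ask X Y L c (rq o) x0 y0 j).1 (w (j, val i) o)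
     - gF (ask X Y L c (rq o) x0 y0 j).1.
    by apply/funext => o; rewrite /err /req_err; have [l ->] := ask_at (rq o) j.
  by rewrite e.
by apply: (mean_bound_unbiased SA SP Xx0 Yy0 (fun j _ => sFl j) (fun j _ => @iFl j) rqFl) => j /H[].
Qed.

Lemma spde_gap t : (t < T)%N -> summable P (gap rq t) /\
  measurable_wrt (sample_sigma (spde_indices T m) w) (gap rq t).
Proof.
move=> tT; have [_ [sg mg]] := gap_sq SA SP Xx0 Yy0 (fun j _ => sFl j) (fun j _ => @iFl j) rqFl tT.
have sub : Fl (3 * t)%N `<=` sample_sigma (spde_indices T m) w by exact: info_all.
split => //; exact: measurable_wrtS sub mg.
Qed.

End Spde.

Section Vr.
Variables (Br b q : nat) (ell : R).
Hypotheses (Br0 : (0 < Br)%N) (b0 : (0 < b)%N) (q0 : (0 < q)%N).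
Hypothesis po : paired_oracle X Y D gradf P ell.
Hypothesis iid : iid_samples P D (vr_indices T Br b q) w.
Let rq o := vr_req gradf Br b q (fun a => w a o).
Let N j := if (q %| j)%N then Br else b.
Let N0 j : (0 < N j)%N. Proof. by rewrite /N; case: ifP. Qed.
Let Fl j := info (3 * T) N w j 0.
Let sFl j : Defs.sub_sigma_algebra (Fl j) := info_sub iid j 0.
Let iFl j : Fl j `<=` Fl j.+1.
Proof. by apply: infoS; left. Qed.

Let refresh j u l o : (q %| j)%N -> rq o j l (u o) =
  (N j)%:R^-1 *: \sum_(i < N j) gradf (u o) (w (j, val i) o).
Proof. by move=> qj; rewrite /rq /vr_req /N qj. Qed.

Let recur j u l o : ~~ (q %| j)%N -> rq o j l (u o) =
  l.2 + (N j)%:R^-1 *: \sum_(i < N j) (gradf (u o) (w (j, val i) o) - gradf l.1 (w (j, val i) o)).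
Proof. by move=> qj; rewrite /rq /vr_req /N (negbTE qj). Qed.

Let rqFl j u' g' u : (j < 3 * T)%N ->
  psq P (Fl j) u' -> psq P (Fl j) g' -> psq P (Fl j) u ->
  (forall o, (X `*` Y) (u o)) -> ((0 < j)%N -> forall o, (X `*` Y) (u' o)) ->
  psq P (Fl j.+1) (fun o => rq o j (u' o, g' o) (u o)).
Proof.
move=> jT pu' pg' pu uXY u'XY.
have pG := psq_gradient SA (sFl j) pu uXY.
have [qj|qj] := boolP (q %| j)%N.
  have [pe _ _] := batch_mean SA so iid jT (N0 j) pu uXY.
  rewrite (_ : (fun o => _) = fun o => (rq o j (u' o, g' o) (u o) - gF (u o)) + gF (u o)).
    apply: psqD (sFl _) _ (psqS (@iFl j) pG).
    by under [X in psq _ _ X]funext do rewrite refresh //.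
  by apply/funext => o; rewrite subrK.
have j0 : (0 < j)%N by case: j qj {jT pu' pg' pu pG u'XY} => //; rewrite dvdn0.
have [pe _] := batch_difference SA so iid po jT (N0 j) pu uXY pu' (u'XY j0).
have pG' := psq_gradient SA (sFl j) pu' (u'XY j0).
pose e o := (N j)%:R^-1 *: \sum_(i < N j) (gradf (u o) (w (j, val i) o) - gradf (u' o) (w (j, val i) o))
       - (gF (u o) - gF (u' o)).
rewrite (_ : (fun o => _) = fun o => (g' o + (gF (u o) - gF (u' o))) + e o).
  apply: psqD (sFl _) _ pe; apply: psqS (@iFl j) _.
  exact: psqD (sFl j) pg' (psqB (sFl j) pG pG').
apply/funext => o; rewrite recur // /e -addrA; congr (_ + _).
by rewrite addrC subrK.
Qed.

Let mv j o := req_move (X := X) (Y := Y) (L := L) (tau := tau) (h := h)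
  (al := al) (k := k) (be := be) x0 y0 (rq o) j.

(** The hypothesis says that a block of q increments cannot accumulate more error
    than the displacements dissipated by the energy. *)
Lemma vr_bound : (200 * be)^-1 * (q%:R * (ell ^+ 2 / b%:R)) <= be * L ^+ 2 ->
  be * L ^+ 2 * \sum_(t < T) mean P (gap rq t) <=
  L * B0 + (200 * be)^-1 * ((3 * T)%:R * (sigma ^+ 2 / Br%:R)).
Proof.
move=> qb.
have req_sq j := request_sq SA SP Xx0 Yy0 (fun j _ => sFl j) (fun j _ => @iFl j) rqFl (j := j).
apply: (mean_bound_recursive SA SP Xx0 Yy0 (fun j _ => sFl j) (fun j _ => @iFl j) rqFl
  (r := ell ^+ 2 / b%:R) q0) => // [||j jT].
- by rewrite divr_ge0 ?sqr_ge0.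
- by rewrite divr_ge0 ?sqr_ge0.
have [pu _] := req_sq j jT; have uXY o := req_in SA SP Xx0 Yy0 (rq o) j.
case: ifPn => qj.
  have [_ _ h2] := batch_mean SA so iid jT (N0 j) pu uXY.
  have e : err rq j = fun o => (N j)%:R^-1 *: \sum_(i < N j) gradf (ask X Y L c (rq o) x0 y0 j).1 (w (j, val i) o)
     - gF (ask X Y L c (rq o) x0 y0 j).1.
    apply/funext => o; rewrite /err /req_err; have [l ->] := ask_at (rq o) j.
    by rewrite (refresh (fun o => (ask X Y L c (rq o) x0 y0 j).1)).
  rewrite -[X in mean P X]/(fun o => sqn (err rq j o)) e; apply: le_trans h2 _.
  by rewrite /N qj.
have j0 : (0 < j)%N by case: (j) qj => //; rewrite dvdn0.
have j1T : (j.-1 < 3 * T)%N by apply: leq_ltn_trans jT; exact: leq_pred.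
have [pu1 _] := req_sq j.-1 j1T.
have uXY1 o := req_in SA SP Xx0 Yy0 (rq o) j.-1.
have iF1 : Fl j.-1 `<=` Fl j by have := @iFl j.-1; rewrite prednK.
have [_ H] := batch_difference SA so iid po jT (N0 j) pu uXY (psqS iF1 pu1) uXY1.
have pE := err_sq SA SP Xx0 Yy0 (fun j _ => sFl j) (fun j _ => @iFl j) rqFl j1T.
rewrite prednK // in pE; have {}H := H _ pE.
apply: le_trans (_ : mean P _ <= mean P _) (le_trans H _).
  rewrite le_eqVlt; apply/orP; left; apply/eqP; congr mean; apply/funext => o; congr sqn.
  rewrite /err /req_err (ask_rec _ _ _ _ _ _ _ j0).
  rewrite (recur (fun o => (ask X Y L c (rq o) x0 y0 j).1)) //.
  exact: recursive_error.
rewrite lerD2l (_ : N j = b); last by rewrite /N (negbTE qj).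
apply: ler_wpM2l; first by rewrite divr_ge0 ?sqr_ge0.
rewrite le_eqVlt; apply/orP; left; apply/eqP; congr mean; apply/funext => o.
by rewrite /req_move addn1 prednK.
Qed.

Lemma vr_gap t : (t < T)%N -> summable P (gap rq t) /\
  measurable_wrt (sample_sigma (vr_indices T Br b q) w) (gap rq t).
Proof.
move=> tT; have [_ [sg mg]] := gap_sq SA SP Xx0 Yy0 (fun j _ => sFl j) (fun j _ => @iFl j) rqFl tT.
have sub : Fl (3 * t)%N `<=` sample_sigma (vr_indices T Br b q) w by exact: info_all.
split => //; exact: measurable_wrtS sub mg.
Qed.

End Vr.
End Estimators.

(** * The randomly chosen iterate *)

Section RandomIndex.
Context {R : realType} {d : measure_display} {Omega : measurableType d}.
Variable P : probability Omega R.

(** Monotonicity that asks no measurability of the smaller function: its integral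
    is a supremum over the simple functions below it. *)
Lemma le_integral_above (g g' : Omega -> \bar R) : (forall o, 0 <= g o)%E ->
  (forall o, g o <= g' o)%E -> (\int[P]_o g o <= \int[P]_o g' o)%E.
Proof.
move=> g0 gg'; have g'0 o : (0 <= g' o)%E by exact: le_trans (gg' o).
rewrite ge0_integralTE // [leRHS]ge0_integralTE //.
by apply: le_ereal_sup => _ [h hg <-]; exists h => // o; exact: le_trans (gg' o).
Qed.

Lemma summable_indic (G : set Omega) : measurable G -> summable P (\1_G : Omega -> R).
Proof.
move=> mG; apply: (summable_le _ (summable_cst P 1)); first exact: measurable_indic.
by move=> o; rewrite indicE; case: (o \in G); rewrite ?normr1 ?normr0.
Qed.

Lemma mean_indic (G : set Omega) : measurable G -> ((mean P (\1_G : Omega -> R))%:E = P G)%E.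
Proof.
move=> mG; rewrite EFin_mean; last exact: summable_indic.
by rewrite integral_indic // setIT.
Qed.

Context {T : nat} {A : set (set Omega)} {J : Omega -> nat}.
Hypothesis T0 : (0 < T)%N.
Hypothesis sA : Defs.sub_sigma_algebra A.
Hypothesis UJ : unif_index P T A J.

Let TR : T%:R != 0 :> R. Proof. by rewrite pnatr_eq0 -lt0n. Qed.

Let mJ (B : set nat) : measurable (J @^-1` B).
Proof. by have [m _ _] := UJ; rewrite -[X in measurable X]setTI; exact: m. Qed.

Let hit t : Omega -> R := \1_(J @^-1` [set t]).

Let shit t : summable P (hit t). Proof. by apply: summable_indic. Qed.

Let mean_hit t : (t < T)%N -> mean P (hit t) = T%:R^-1.
Proof.
move=> tT; have [_ h _] := UJ; apply/EFin_inj; rewrite mean_indic //; exact: h.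
Qed.

Let hit_centered t : (t < T)%N -> centered P A (fun o => hit t o - T%:R^-1).
Proof.
move=> tT G AG; have mG := sA.2 _ AG; have [_ h ind] := UJ.
rewrite (_ : (fun o => _) = fun o => ((EFin \o hit t) o - (EFin \o cst (T%:R^-1 : R)%R) o)%E) //.
rewrite integralB_EFin //; last 2 first.
- exact: summable_on.
- by apply: summable_on => //; exact: summable_cst.
have e1 : (\int[P]_(o in G) (hit t o)%:E = P (G `&` J @^-1` [set t]))%E.
  by rewrite setIC; apply: integral_indic.
have e2 : (\int[P]_(o in G) (cst (T%:R^-1 : R)%R o)%:E = (T%:R^-1 : R)%:E * P G)%E.
  by rewrite -(integral_cst P mG).
rewrite [X in (X - _)%E]e1 [X in (_ - X)%E]e2 ind // h // muleC subee //.
by rewrite fin_numM // fin_num_measure.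
Qed.

Lemma mean_at_hit t (Z : Omega -> R) : (t < T)%N -> measurable_wrt A Z -> summable P Z ->
  summable P (fun o => Z o * hit t o) /\ mean P (fun o => Z o * hit t o) = T%:R^-1 * mean P Z.
Proof.
move=> tT mZ sZ.
have s1 : summable P (fun o => Z o * hit t o).
  apply: (summable_le _ (summable_abs sZ)).
    by apply: measurable_funM; [exact: summable_meas sZ|exact: summable_meas (shit t)].
  move=> o; rewrite normrM /hit indicE; case: (o \in _); rewrite ?normr1 ?mulr1 //.
  by rewrite normr0 mulr0.
have s2 : summable P (fun o => T%:R^-1 * Z o) by exact: summableZ.
split => //; apply/eqP; rewrite -subr_eq0; apply/eqP; rewrite -meanZ // -meanB //.
have e : (fun o => Z o * hit t o - T%:R^-1 * Z o) = fun o => Z o * (hit t o - T%:R^-1).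
  by apply/funext => o; rewrite mulrBr [T%:R^-1 * _]mulrC.
rewrite e; apply: (mean_centered sA mZ) (hit_centered tT).
  exact: summableB (shit t) (summable_cst P _).
by rewrite -e; exact: summableB.
Qed.

(** J takes the values t < T with probability 1/T each and is independent of the
    Z t, so the mean of the Z t at J is the average of their means. G (J o) need not
    be measurable and is arbitrary on the null set where J >= T: it is
    bounded by a measurable function that is infinite there. *)
Lemma random_index_bound (G Z : nat -> Omega -> R) (k c : R) :
  (forall t o, 0 <= G t o) -> (forall t o, (t < T)%N -> G t o <= k * Z t o + c) ->
  (forall t, (t < T)%N -> measurable_wrt A (Z t) /\ summable P (Z t)) ->
  (\int[P]_o (G (J o) o)%:E <= (k * (T%:R^-1 * \sum_(t < T) mean P (Z t)) + c)%:E)%E.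
Proof.
move=> G0 GZ HZ.
pose gr o : R := \sum_(t < T) (k * (Z t o * hit t o) + c * hit t o).
have sgt (t : 'I_T) : summable P (fun o => k * (Z t o * hit t o) + c * hit t o).
  have [mZ sZ] := HZ _ (ltn_ord t).
  by apply: summableD; apply: summableZ => //; have [] := mean_at_hit (ltn_ord t) mZ sZ.
have sgr : summable P gr by exact: summable_sum.
have -> : k * (T%:R^-1 * \sum_(t < T) mean P (Z t)) + c = mean P gr.
  rewrite /gr mean_sum // mulr_sumr mulr_sumr.
  rewrite [X in _ + X = _](_ : c = \sum_(t < T) (c * T%:R^-1)); last by rewrite sumr_const card_ord -[RHS]mulr_natr mulfVK.
  rewrite -big_split /=; apply: eq_bigr => t _.
  have [mZ sZ] := HZ _ (ltn_ord t); have [s1 m1] := mean_at_hit (ltn_ord t) mZ sZ.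
  rewrite meanD; [|exact: summableZ|exact: summableZ].
  by rewrite !meanZ // m1 mean_hit.
pose N := J @^-1` [set j | (T <= j)%N]; have mN : measurable N by exact: mJ.
have sumhit o : \sum_(t < T) hit t o = 1 - \1_N o.
  rewrite indicE; have [oN|oN] := boolP (o \in N).
    rewrite subrr big1 // => t _; rewrite /hit indicE memNset //= => /eqP.
    by move=> /eqP e; move/set_mem: oN; rewrite /N /= e leqNgt ltn_ord.
  have JT : (J o < T)%N by rewrite ltnNge; apply: contra oN => h; exact: mem_set.
  rewrite subr0 (bigD1 (Ordinal JT)) //= /hit indicE mem_set //= big1 ?addr0 // => t tJ.
  rewrite indicE memNset //= => e; case/eqP: tJ; exact/val_inj.
have PN : P N = 0%E.
  rewrite -mean_indic //; congr EFin.
  have -> : (\1_N : Omega -> R) = fun o => 1 - \sum_(t < T) hit t o.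
    by apply/funext => o; rewrite sumhit opprB addrCA subrr addr0.
  rewrite meanB //; [|exact: summable_cst|by apply: summable_sum => t; exact: shit].
  rewrite mean_cst mean_sum // (eq_bigr (fun=> T%:R^-1)) => [|t _]; last by rewrite mean_hit.
  by rewrite sumr_const card_ord -[X in 1 - X]mulr_natr mulVf // subrr.
pose g' o : \bar R := if o \in N then +oo%E else (gr o)%:E.
have gr0 o : o \notin N -> G (J o) o <= gr o.
  move=> oN; have JT : (J o < T)%N by rewrite ltnNge; apply: contra oN => h; exact: mem_set.
  apply: le_trans (GZ _ _ JT) _; rewrite /gr (bigD1 (Ordinal JT)) //= /hit indicE mem_set //= !mulr1.
  rewrite big1 ?addr0 // => t tJ; rewrite indicE memNset ?mulr0 ?mulr0 ?addr0 // => e.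
  by case/eqP: tJ; exact/val_inj.
apply: le_trans (_ : _ <= \int[P]_o g' o)%E _.
  apply: le_integral_above => o; first by rewrite lee_fin.
  by rewrite /g'; case: ifPn => oN; rewrite ?leey // lee_fin gr0.
have g'0 o : (0 <= g' o)%E.
  by rewrite /g'; case: ifPn => // oN; rewrite lee_fin (le_trans (G0 _ _) (gr0 _ oN)).
have mg' : measurable_fun setT g'.
  apply: measurable_fun_ifT => //.
    by apply: (measurable_fun_bool true); rewrite setTI; rewrite (_ : _ @^-1` _ = N) //;
       apply/seteqP; split => o /=; [move/set_mem|move/mem_set].
  by apply/measurable_EFinP; exact: summable_meas sgr.
rewrite (@ge0_negligible_integral _ _ _ P setT N g') //.
rewrite (EFin_mean sgr) (@negligible_integral _ _ _ P setT N (EFin \o gr)) //.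
rewrite le_eqVlt; apply/orP; left; apply/eqP; apply: eq_integral => o.
by move=> /set_mem[_ oN]; rewrite /g' memNset.
Qed.

End RandomIndex.

(** * Rounding and step sizes *)

Section Rounding.
Context {R : realType}.
Implicit Types r : R.

Lemma ceil1_gt0 r : (0 < ceil1 r)%N.
Proof.
rewrite /ceil1 absz_gt0 gt_eqF //; apply: lt_le_trans (ltr01) _.
by rewrite le_max lexx.
Qed.

Lemma ceil1E r : (ceil1 r)%:R = (Num.max 1 (Num.ceil r))%:~R :> R.
Proof.
by rewrite pmulrn gez0_abs // le_max ler01.
Qed.

Lemma ceil1_ge r : r <= (ceil1 r)%:R.
Proof.
rewrite ceil1E; apply: le_trans (ceil_ge r) _.
by rewrite ler_int le_max lexx orbT.
Qed.

Lemma ceil1_le r : 0 <= r -> (ceil1 r)%:R <= 1 + r.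
Proof.
move=> r0; rewrite ceil1E; case: (lerP 1 (Num.ceil r)) => h; last by rewrite lerDl.
by have := ceilB1_lt r; rewrite rmorphB /= ltrBlDr addrC => /ltW.
Qed.

Lemma ceil1_0 : ceil1 (0 : R) = 1%N.
Proof. by rewrite /ceil1 ceil0. Qed.

Lemma floor1_gt0 r : (0 < floor1 r)%N.
Proof.
rewrite /floor1 absz_gt0 gt_eqF //; apply: lt_le_trans (ltr01) _.
by rewrite le_max lexx.
Qed.

Lemma floor1E r : (floor1 r)%:R = (Num.max 1 (Num.floor r))%:~R :> R.
Proof.
by rewrite pmulrn gez0_abs // le_max ler01.
Qed.

Lemma floor1_lt r : r < (floor1 r)%:R + 1.
Proof.
rewrite floor1E; apply: lt_le_trans (floorD1_gt r) _.
by rewrite intrD lerD2r ler_int le_max lexx orbT.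
Qed.

Lemma floor1_le r : (1 < floor1 r)%N -> (floor1 r)%:R <= r.
Proof.
rewrite -(ltr_nat R) floor1E => h; apply: le_trans (floor_le r).
move: h; case: (lerP 1 (Num.floor r)) => // _; by rewrite ltxx.
Qed.

End Rounding.

Section StepSizes.
Context {R : realType}.
Variables L DY : R.
Hypotheses (L0 : 0 < L) (D0 : 0 < DY).

(** The parameters s and 8 L - s become 16 a and 16 (L / 2 - a). *)
Lemma os_step_params (tau : R) : 0 < tau -> tau <= L ->
  step_params L tau (h_par L tau) (s_par L tau / 16) (alpha_par L tau) (k_par L tau) (beta_par L tau).
Proof.
move=> t0 tL; have s2 : s_par L tau ^+ 2 = 2 * L * tau by rewrite sqr_sqrtr // !mulr_ge0 // ltW.
have s0 : 0 < s_par L tau by rewrite sqrtr_gt0 !mulr_gt0.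
have q0 : 0 < 3 * L + tau by rewrite addr_gt0 // mulr_gt0.
have h0 : 0 < h_par L tau by rewrite invr_gt0 mulr_gt0.
split => //.
- by rewrite /h_par invfM mulfVK ?gt_eqF.
- by rewrite divr_gt0.
- have a0 : 0 <= 11 * (s_par L tau / 16) by rewrite mulr_ge0 // divr_ge0 // ltW.
  rewrite -(ler_pXn2r (ltn0Sn 1)) ?nnegrE ?(ltW L0)//.
  have Lt := mulr_ge0 (ltW L0) (ltW t0); have := ler_wpM2l (ltW L0) tL; rewrite !exprMn s2 => h; rewrite !expr2.
  by move: h Lt; clear -L0; lra.
- by rewrite exprMn s2; field.
- by rewrite /alpha_par mulrA mulVf // gt_eqF // ltr_pwDl // divr_ge0 // mulr_ge0 ?(ltW h0) ?(ltW s0).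
- rewrite /k_par /alpha_par; field.
  have hs : 0 < h_par L tau * s_par L tau by rewrite mulr_gt0.
  by move: hs; move: (_ * _) => hs hs0; rewrite !gt_eqF // addr_gt0.
- by rewrite /beta_par; field.
Qed.

Variable eps : R.
Hypothesis e0 : 0 < eps.

Let tau := tau_os L DY eps.
Let K := K_os L DY eps.
Let be := beta_os L DY eps.

Lemma tau_os_gt0 : 0 < tau.
Proof. by rewrite /tau /tau_os lt_min L0 divr_gt0 ?exprn_gt0// !mulr_gt0 // exprn_gt0. Qed.

Lemma tau_os_le : tau <= L. Proof. by rewrite /tau /tau_os ge_min lexx. Qed.

Lemma tau_os_bias : 4 * L * tau * DY ^+ 2 <= eps ^+ 2 / 4.
Proof.
have : tau <= eps ^+ 2 / (16 * L * DY ^+ 2) by rewrite /tau /tau_os ge_min lexx orbT.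
have p : 0 < 4 * L * DY ^+ 2 by rewrite !mulr_gt0 // exprn_gt0.
move/(ler_wpM2l (ltW p)); rewrite (_ : _ * (_ / _) = eps ^+ 2 / 4); last first.
  by field; rewrite !gt_eqF ?exprn_gt0 ?mulr_gt0.
by apply: le_trans; rewrite mulrAC.
Qed.

Let SP := os_step_params tau_os_gt0 tau_os_le.

Lemma beta_os_gt0 : 0 < be.
Proof. rewrite /be /beta_os (sp_be SP); by rewrite divr_gt0 // mulr_gt0 ?(sp_h0 SP) ?(sp_a0 SP). Qed.

Lemma beta_os_le1 : be <= 1.
Proof.
have := ha_le SP; have := mulr_gt0 (sp_h0 SP) (sp_a0 SP); rewrite -/be.
have -> : be = h_par L tau * (s_par L tau / 16) / 256 by exact: sp_be SP.
by move: (_ * _) => r; lra.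
Qed.

Lemma K_os_ge1 : 1 <= K. Proof. by rewrite /K /K_os le_max lexx. Qed.

Lemma K_os_le : eps <= 1 -> K <= (1 + 4 * L * DY) / eps.
Proof.
move=> e1; rewrite /K /K_os ge_max; apply/andP; split.
  by rewrite ler_pdivlMr // mul1r (le_trans e1) // lerDl !mulr_ge0 ?(ltW L0) ?(ltW D0).
by rewrite ler_wpM2r ?invr_ge0 ?(ltW e0) // lerDr.
Qed.

(** tau >= L / K^2, whence s >= L / K, while h >= 1 / (256 L). *)
Lemma inv_beta_le : be^-1 <= 256 * 4096 * K.
Proof.
have K0 : 0 < K := lt_le_trans ltr01 K_os_ge1.
have tK : L <= tau * K ^+ 2.
  have [->|->] : tau = L \/ tau = eps ^+ 2 / (16 * L * DY ^+ 2).
  - by rewrite /tau /tau_os; case: leP; [left|right].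
  - by rewrite ler_peMr ?(ltW L0)// exprn_ege1 // K_os_ge1.
  have -> : L = eps ^+ 2 / (16 * L * DY ^+ 2) * (4 * L * DY / eps) ^+ 2.
    by field; rewrite !gt_eqF.
  have -> : eps ^+ 2 / (16 * (eps ^+ 2 / (16 * L * DY ^+ 2) * (4 * L * DY / eps) ^+ 2) * DY ^+ 2)
     = eps ^+ 2 / (16 * L * DY ^+ 2) by field; rewrite !gt_eqF.
  apply: ler_wpM2l; first by rewrite divr_ge0 ?sqr_ge0 // !mulr_ge0 ?sqr_ge0 // ltW.
  have p : 0 <= 4 * L * DY / eps by rewrite divr_ge0 ?(ltW e0)// !mulr_ge0 // ltW.
  by rewrite ler_pXn2r ?nnegrE ?(ltW K0)// /K /K_os le_max lexx orbT.
have t0 := tau_os_gt0; rewrite -/tau in t0.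
have sK : L <= s_par L tau * K.
  rewrite -(ler_pXn2r (ltn0Sn 1)) ?nnegrE ?(ltW L0)// ?mulr_ge0 ?(ltW K0) ?sqrtr_ge0//.
  rewrite exprMn sqr_sqrtr; last by rewrite !mulr_ge0 // ltW.
  have h := ler_wpM2l (ltW L0) tK; have h2 := sqr_ge0 L.
  by rewrite -!mulrA; move: h h2; rewrite !expr2; move: (L * (tau * _)) (L * L) => x y; lra.
have hL : (256 * L)^-1 <= h_par L tau.
  rewrite /h_par lef_pV2 ?posrE ?mulr_gt0 ?addr_gt0 ?mulr_gt0//.
  by have := tau_os_le; rewrite -/tau; lra.
have b0 := beta_os_gt0; rewrite -/be in b0.
rewrite -div1r ler_pdivrMr //.
have -> : be = h_par L tau * s_par L tau / 4096 by [].
have -> : 256 * 4096 * K * (h_par L tau * s_par L tau / 4096) = 256 * h_par L tau * (s_par L tau * K).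
  by move: (h_par _ _) (s_par _ _) => a b; field.
apply: le_trans (_ : 256 * (256 * L)^-1 * L <= _); first by rewrite invfM mulrA divff // mul1r mulVf ?gt_eqF.
have p0 : 0 <= (256 * L)^-1 by rewrite invr_ge0; apply: mulr_ge0 (ltW L0); rewrite ler0n.
apply: ler_pM (mulr_ge0 (ler0n R 256) p0) (ltW L0) _ sK.
by apply: ler_wpM2l hL; rewrite ler0n.
Qed.

End StepSizes.

(** * Oracle calls and orders *)

Lemma sum_multiples (q M A B : nat) : (0 < q)%N ->
  (\sum_(j < M.+1) (if (q %| j)%N then A else B) <= (M %/ q).+1 * A + M.+1 * B)%N.
Proof.
move=> q0; elim: M => [|M IH]; first by rewrite big_ord_recr big_ord0 /= dvdn0 div0n; lia.
rewrite big_ord_recr /= divnS //; case: (q %| M.+1)%N; move: IH; move: (M %/ q)%N (bigop _ _ _) => r s; nia.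
Qed.

Section Counts.
Context {R : realType}.
Variables L DY Bb sigma ell : R.
Hypotheses (L0 : 0 < L) (D0 : 0 < DY) (B0 : 0 <= Bb).

Section Fixed.
Variable eps : R.
Hypothesis e0 : 0 < eps.
Let be := beta_os L DY eps.
Let K := K_os L DY eps.
Let be0 : 0 < be := beta_os_gt0 L0 D0 e0.

Lemma spde_calls_le : (N_spde L DY Bb sigma eps)%:R <= bound_spde L DY Bb sigma eps.
Proof.
rewrite /N_spde /spde_calls sum_nat_const card_ord natrM natrM /bound_spde.
have p : 0 <= (be * eps ^+ 2)^-1 by rewrite invr_ge0 mulr_ge0 ?sqr_ge0 ?(ltW be0).
rewrite -/be; apply: ler_pM; rewrite ?mulr_ge0 ?ler0n//.
  rewrite ler_wpM2l ?ler0n//; apply: ceil1_le.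
  by apply: mulr_ge0 p; apply: mulr_ge0 B0; apply: mulr_ge0 (ltW L0); rewrite ler0n.
apply: ceil1_le; apply: mulr_ge0 p; apply: mulr_ge0 (sqr_ge0 _); rewrite ler0n //.
Qed.

Let prod_le (p r x y : R) : 1 <= p -> 1 <= r -> 0 <= x -> 0 <= y ->
  (1 + p * x) * (1 + r * y) <= p * r * (1 + x + y + x * y).
Proof.
move=> p1 r1 x0 y0.
have -> : p * r * (1 + x + y + x * y) = (p * (1 + x)) * (r * (1 + y)) by ring.
have p0 : 0 <= p by exact: le_trans p1. have r0 : 0 <= r by exact: le_trans r1.
apply: ler_pM; rewrite ?addr_ge0 ?mulr_ge0 // mulrDr mulr1 lerD2r //.
Qed.

(** 64 and 19200 are the factors in T and m, 256 * 4096 bounds 1 / (be K). *)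
Definition spde_constant : R := 3 * (64 * (256 * 4096) * (19200 * (256 * 4096))).

Lemma bound_spde_le : bound_spde L DY Bb sigma eps <=
  spde_constant * (1 + (L * Bb + sigma ^+ 2) * K / eps ^+ 2 + L * Bb * sigma ^+ 2 * K ^+ 2 / eps ^+ 4).
Proof.
rewrite /spde_constant /bound_spde -/be.
have [c0 c0E] : exists c0 : R, c0 = 256 * 4096 by eexists.
have ib : be^-1 <= c0 * K by rewrite c0E; exact: inv_beta_le.
have c01 : 1 <= c0 by rewrite c0E -natrM ler1n.
rewrite -c0E.
have [u uE] : exists u : R, u = 64 * c0 by eexists.
have [v vE] : exists v : R, v = 19200 * c0 by eexists.
have u1 : 1 <= u by rewrite uE; apply: mulr_ege1; rewrite ?ler1n.
have v1 : 1 <= v by rewrite vE; apply: mulr_ege1; rewrite ?ler1n.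
have K0 : 0 <= K by apply: le_trans ler01 (K_os_ge1 L DY eps).
have i2 : 0 <= (eps ^+ 2)^-1 by rewrite invr_ge0 sqr_ge0.
have H1 : 64 * L * Bb / (be * eps ^+ 2) <= u * (L * Bb * K / eps ^+ 2).
  rewrite invfM uE.
  have -> : 64 * L * Bb * (be^-1 / eps ^+ 2) = be^-1 * (64 * (L * Bb / eps ^+ 2)) by ring.
  have -> : 64 * c0 * (L * Bb * K / eps ^+ 2) = c0 * K * (64 * (L * Bb / eps ^+ 2)) by ring.
  by rewrite ler_wpM2r // mulr_ge0 ?ler0n// mulr_ge0 // mulr_ge0 // ltW.
have H2 : 19200 * sigma ^+ 2 / (be * eps ^+ 2) <= v * (sigma ^+ 2 * K / eps ^+ 2).
  rewrite invfM vE; move: (19200 : R) (ler0n R 19200) => w w0.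
  have -> : w * sigma ^+ 2 * (be^-1 / eps ^+ 2) = be^-1 * (w * (sigma ^+ 2 / eps ^+ 2)) by ring.
  have -> : w * c0 * (sigma ^+ 2 * K / eps ^+ 2) = c0 * K * (w * (sigma ^+ 2 / eps ^+ 2)) by ring.
  by rewrite ler_wpM2r // mulr_ge0 // mulr_ge0 // sqr_ge0.
have x0 : 0 <= L * Bb * K / eps ^+ 2 by rewrite !mulr_ge0 // ltW.
have y0 : 0 <= sigma ^+ 2 * K / eps ^+ 2 := mulr_ge0 (mulr_ge0 (sqr_ge0 sigma) K0) i2.
have := prod_le u1 v1 x0 y0.
have -> : 1 + (L * Bb + sigma ^+ 2) * K / eps ^+ 2 + L * Bb * sigma ^+ 2 * K ^+ 2 / eps ^+ 4
   = 1 + L * Bb * K / eps ^+ 2 + sigma ^+ 2 * K / eps ^+ 2 + L * Bb * K / eps ^+ 2 * (sigma ^+ 2 * K / eps ^+ 2).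
  by field; rewrite gt_eqF.
rewrite -uE -vE => H; rewrite -(mulrA 3) -(mulrA 3); apply: (ler_wpM2l (ler0n R 3)).
apply: le_trans H.
have d0 : 0 <= (be * eps ^+ 2)^-1 by rewrite invr_ge0; exact: mulr_ge0 (ltW be0) (sqr_ge0 _).
have n1 : 0 <= 64 * L * Bb by apply: mulr_ge0 B0; apply: mulr_ge0 (ltW L0); rewrite ler0n.
have n2 : 0 <= 19200 * sigma ^+ 2 by apply: mulr_ge0 (sqr_ge0 _); rewrite ler0n.
apply: ler_pM.
- exact: addr_ge0 ler01 (mulr_ge0 n1 d0).
- exact: addr_ge0 ler01 (mulr_ge0 n2 d0).
- exact: lerD (lexx 1) H1.
- exact: lerD (lexx 1) H2.
Qed.

Hypothesis Ll : L <= ell.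
Let A := A_vr L DY ell eps.
Let Br := Br_vr L DY sigma eps.
Let q := q_vr L DY sigma ell eps.
Let b := b_vr L DY sigma ell eps.
Let T := T_vr L DY Bb eps.

Lemma A_vr_ge1 : 1 <= A.
Proof.
have x1 : 1 <= ell / L by rewrite ler_pdivlMr // mul1r.
have b1 := beta_os_le1 L0 D0 e0.
rewrite /A /A_vr -/be ler_pdivlMr ?exprn_gt0// mul1r.
apply: le_trans (_ : 1 <= _); first by rewrite expr_le1 // ltW.
have x2 : 1 <= (ell / L) ^+ 2 by rewrite exprn_ege1.
by rewrite /C_star; move: x2; move: (_ ^+ 2) => x; lra.
Qed.

Let A0 : 0 < A := lt_le_trans ltr01 A_vr_ge1.

Lemma b_vrE : A * q%:R <= b%:R /\ b%:R <= A * q%:R + 1.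
Proof.
have Aq : 0 <= A * q%:R by rewrite mulr_ge0 // ltW.
have c0 : (0 <= Num.ceil (A * q%:R)) by rewrite -(ler_int R) (le_trans Aq) // ceil_ge.
have bE : b%:R = (Num.ceil (A * q%:R))%:~R :> R by rewrite pmulrn gez0_abs.
rewrite bE; split; first exact: ceil_ge.
by have := ceilB1_lt (A * q%:R); rewrite rmorphB /= ltrBlDr => /ltW.
Qed.

Lemma q_vr_gt0 : (0 < q)%N. Proof. exact: floor1_gt0. Qed.

Lemma b_vr_gt0 : (0 < b)%N.
Proof.
have [h _] := b_vrE; rewrite -(ltr_nat R); apply: lt_le_trans h.
by rewrite mulr_gt0 // ltr0n q_vr_gt0.
Qed.

(** Let r = sqrt (Br / A), so that sqrt (A Br) = A r. If q = 1, every request is a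
    refresh and r < 2 makes Br at most 2 A r. Otherwise q <= r < 3 q / 2 and
    b <= 2 A q: the refreshes, one in q, cost at most Br + 9/2 T A r, and the other
    requests at most 12 T A r. *)
Lemma vr_calls_le : (N_vr L DY Bb sigma ell eps)%:R <= bound_vr L DY Bb sigma ell eps.
Proof.
rewrite /N_vr /vr_calls /bound_vr -/A -/Br -/T -/q -/b.
have Br1 : 1 <= Br%:R :> R by rewrite ler1n ceil1_gt0.
have Br0 : 0 <= Br%:R :> R by exact: le_trans ler01 Br1.
have T1 : 1 <= T%:R :> R by rewrite ler1n ceil1_gt0.
have T0 : 0 <= T%:R :> R by exact: le_trans ler01 T1.
have sq0 := sqrtr_ge0 (A * Br%:R).
have sqE : Num.sqrt (A * Br%:R) ^+ 2 = A * Br%:R by rewrite sqr_sqrtr // mulr_ge0 // ltW.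
have [r rE] : exists r : R, r = Num.sqrt (Br%:R / A) by eexists.
have r0 : 0 <= r by rewrite rE sqrtr_ge0.
have BrE : Br%:R = A * r ^+ 2.
  by rewrite rE sqr_sqrtr; [rewrite mulrCA divff ?mulr1 // gt_eqF|rewrite divr_ge0 // ltW].
have Ar0 : 0 <= A * r by rewrite mulr_ge0 // ltW.
have rA : Num.sqrt (A * Br%:R) = A * r.
  by rewrite -[RHS](ger0_norm Ar0) -sqrtr_sqr BrE exprMn mulrA -expr2.
have Tn : (3 * T)%N = (3 * T).-1.+1 by rewrite prednK // muln_gt0 /= ceil1_gt0.
have qr : r < q%:R + 1 by rewrite rE; exact: floor1_lt.
rewrite rA.
have [q1|q2] : q = 1%N \/ (1 < q)%N by have := q_vr_gt0; case: (q) => [//|[|?]] _; [left|right].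
  have mn : Br%:R / 2 <= Num.min Br%:R (A * r).
    rewrite le_min; apply/andP; split; first by move: (Br%:R) Br0 => z; lra.
    have r2 : r <= 2 by move: qr; rewrite q1 => /ltW; lra.
    have := ler_wpM2l Ar0 r2; rewrite BrE expr2 mulrA; move: (A * r * r) (A * r) => y z; lra.
  have := ler_wpM2l T0 mn.
  rewrite q1; under eq_bigr do rewrite dvd1n.
  rewrite sum_nat_const card_ord natrM natrM.
  by move: (Num.min _ _) Br0 (mulr_ge0 T0 Br0) => z; rewrite -!mulrA; move: (T%:R) (Br%:R) => t B; lra.
have qle : q%:R <= r by rewrite rE; exact: floor1_le.
have q2R : 2 <= q%:R :> R by rewrite ler_nat.
have r15 : r <= 3 / 2 * q%:R by move: qr q2R => /ltW; move: (q%:R) => z; lra.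
have -> : Num.min Br%:R (A * r) = A * r.
  apply/min_idPr; rewrite BrE expr2 mulrA ler_peMr //.
  by apply: le_trans qle; apply: le_trans q2R; lra.
have [_ bu] := b_vrE; have A1 := A_vr_ge1.
have b2 : b%:R <= 2 * (A * r).
  have h1 : A * q%:R <= A * r by rewrite ler_wpM2l // ltW.
  have h2 : 1 <= A * q%:R by apply: mulr_ege1 => //; apply: le_trans q2R; lra.
  by apply: le_trans bu _; move: h1 h2; move: (A * q%:R) (A * r) => x y; lra.
have := sum_multiples (3 * T).-1 Br (2 * b) (ltnW q2); rewrite -Tn -(ler_nat R).
set k := ((3 * T).-1 %/ q)%N.
have kq : k%:R * q%:R <= 3 * T%:R :> R.
  by rewrite -!natrM ler_nat; apply: leq_trans (leq_trunc_div _ _) _; rewrite leq_pred.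
have kr : k%:R * r <= 9 / 2 * T%:R.
  have := ler_wpM2l (ler0n R k) r15; move: kq; rewrite mulrCA.
  by move: (k%:R * q%:R) (k%:R * r) (T%:R) => x y z; lra.
have h1 := ler_wpM2l Ar0 kr.
have h2 := ler_wpM2l T0 b2.
have h3 := mulr_ge0 Ar0 T0.
move=> H; apply: le_trans H _.
rewrite natrD [in X in X <= _]natrM -addn1 natrD [(3 * T * (2 * b))%:R]natrM !natrM.
have -> : (k%:R + 1) * Br%:R + 3 * T%:R * (2 * b%:R) = A * r * (k%:R * r) + Br%:R + 6 * (T%:R * b%:R).
  by rewrite BrE; move: (k%:R) (b%:R) (T%:R) => x y z; ring.
have -> : Br%:R + 18 * T%:R * (A * r) = Br%:R + 18 * (A * r * T%:R) by ring.
move: h1 h2 h3; have -> : A * r * (9 / 2 * T%:R) = 9 / 2 * (A * r * T%:R) by ring.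
have -> : T%:R * (2 * (A * r)) = 2 * (A * r * T%:R) by ring.
move: (A * r * T%:R) (A * r * (k%:R * r)) (T%:R * b%:R) (Br%:R) => x y z t; lra.
Qed.

End Fixed.

Lemma bigO_right0_le (g h : R -> R^o) (C : R) :
  (forall eps : R, 0 < eps -> eps <= 1 -> `|g eps| <= C * `|h eps|) -> bigO_right0 g h.
Proof.
move=> H; rewrite /bigO_right0 /=; apply/eqOP; near=> k.
near=> eps.
have e0 : 0 < eps by near: eps; exact: nbhs_right_gt.
have e1 : eps <= 1 by near: eps; exact: nbhs_right_le.
apply: le_trans (H eps e0 e1) _.
by apply: ler_wpM2r => //; near: k; apply: nbhs_pinfty_ge; rewrite num_real.
Unshelve. all: by end_near.
Qed.

Lemma ler_inv_expr (eps : R) (i j : nat) : 0 < eps -> eps <= 1 -> (i <= j)%N ->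
  eps ^- i <= eps ^- j.
Proof.
move=> e0 e1 ij; rewrite lef_pV2 ?posrE ?exprn_gt0 //.
by rewrite -(subnK ij) exprD ler_piMl ?exprn_ile1 ?exprn_ge0 // ltW.
Qed.

(** 1 / be <= step_rate / eps for eps <= 1. Locked, since its numerals are too large
    to be unfolded by conversion. *)
Definition step_rate : R := locked (256 * 4096 * (1 + 4 * L * DY)).

Lemma step_rate_ge0 : 0 <= step_rate.
Proof.
rewrite /step_rate -lock.
apply: mulr_ge0; first by apply: mulr_ge0; rewrite ler0n.
by apply: addr_ge0 => //; apply: mulr_ge0 (ltW D0); apply: mulr_ge0 (ltW L0); rewrite ler0n.
Qed.

Section SmallAccuracy.
Variable eps : R.
Hypotheses (e0 : 0 < eps) (e1 : eps <= 1).
Let be := beta_os L DY eps.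
Let be0 : 0 < be := beta_os_gt0 L0 D0 e0.

Lemma inv_beta_rate : be^-1 <= step_rate * eps^-1.
Proof.
apply: le_trans (inv_beta_le L0 D0 e0) _; rewrite /step_rate -lock -(mulrA (256 * 4096)).
by apply: ler_wpM2l (K_os_le L0 D0 e0 e1); apply: mulr_ge0; rewrite ler0n.
Qed.

Lemma ceil1_rate (a : R) (i : nat) : 0 <= a ->
  (ceil1 (a / (be ^+ i * eps ^+ 2)))%:R <= (1 + a * step_rate ^+ i) * eps ^- (i + 2).
Proof.
move=> a0; have p : 0 <= a / (be ^+ i * eps ^+ 2) by rewrite divr_ge0 ?mulr_ge0 ?exprn_ge0 // ltW.
apply: le_trans (ceil1_le p) _; rewrite mulrDl mul1r; apply: lerD.
  by rewrite -[leLHS]invr1 -(expr0 eps) ler_inv_expr.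
have -> : eps ^- (i + 2) = eps^-1 ^+ i * eps ^- 2 by rewrite exprD invfM exprVn.
rewrite invfM -exprVn; have : 0 <= eps ^- 2 by rewrite invr_ge0 sqr_ge0.
move: (eps ^- 2) => z z0; rewrite -mulrA; apply: ler_wpM2l => //.
rewrite mulrA -exprMn; apply: ler_wpM2r => //.
have b0 : 0 <= be^-1 by rewrite invr_ge0 ltW.
have r0 : 0 <= step_rate * eps^-1 by apply: mulr_ge0 step_rate_ge0 _; rewrite invr_ge0 ltW.
by apply: lerXn2r inv_beta_rate; rewrite nnegrE.
Qed.

End SmallAccuracy.

Definition T_rate (a : R) : R := 1 + a * L * Bb * step_rate.

Lemma T_rate_ge0 (a : R) : 0 <= a -> 0 <= T_rate a.
Proof.
move=> a0; apply: addr_ge0 ler01 _; apply: mulr_ge0 step_rate_ge0; apply: mulr_ge0 B0.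
exact: mulr_ge0 a0 (ltW L0).
Qed.

Lemma T_spde_rate eps : 0 < eps -> eps <= 1 ->
  (T_spde L DY Bb eps)%:R <= T_rate 64 * eps ^- 3.
Proof.
move=> e0 e1; have a0 : 0 <= 64 * L * Bb := mulr_ge0 (mulr_ge0 (ler0n R 64) (ltW L0)) B0.
by have := ceil1_rate e0 e1 1 a0; rewrite !expr1.
Qed.

Lemma T_vr_rate eps : 0 < eps -> eps <= 1 ->
  (T_vr L DY Bb eps)%:R <= T_rate 128 * eps ^- 3.
Proof.
move=> e0 e1; have a0 : 0 <= 128 * L * Bb := mulr_ge0 (mulr_ge0 (ler0n R 128) (ltW L0)) B0.
by have := ceil1_rate e0 e1 1 a0; rewrite !expr1.
Qed.

Definition m_rate : R := 1 + 19200 * sigma ^+ 2 * step_rate.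

Lemma m_spde_rate eps : 0 < eps -> eps <= 1 ->
  (m_spde L DY sigma eps)%:R <= m_rate * eps ^- 3.
Proof.
move=> e0 e1; have a0 : 0 <= 19200 * sigma ^+ 2 := mulr_ge0 (ler0n R 19200) (sqr_ge0 _).
by have := ceil1_rate e0 e1 1 a0; rewrite !expr1.
Qed.

Definition Br_rate : R := 1 + 768 * C_star * sigma ^+ 2 * step_rate ^+ 2.

Lemma Br_vr_rate eps : 0 < eps -> eps <= 1 ->
  (Br_vr L DY sigma eps)%:R <= Br_rate * eps ^- 4.
Proof.
move=> e0 e1; have a0 : 0 <= 768 * C_star * sigma ^+ 2.
  exact: mulr_ge0 (mulr_ge0 (ler0n R 768) (ler0n R 140)) (sqr_ge0 _).
by have := ceil1_rate e0 e1 2 a0.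
Qed.

Lemma Br_rate_ge0 : 0 <= Br_rate.
Proof.
apply: addr_ge0 ler01 _; apply: mulr_ge0 (sqr_ge0 _); apply: mulr_ge0 (sqr_ge0 _).
exact: mulr_ge0 (ler0n R 768) (ler0n R 140).
Qed.

Definition root_rate : R := Num.sqrt (16 * C_star * step_rate ^+ 2 * Br_rate).

Lemma root_vr_rate eps : 0 < eps -> eps <= 1 -> L <= ell ->
  Num.sqrt (A_vr L DY ell eps * (Br_vr L DY sigma eps)%:R) <= ell / L * (root_rate * eps ^- 3).
Proof.
move=> e0 e1 Ll; set be := beta_os L DY eps.
have be0 : 0 < be := beta_os_gt0 L0 D0 e0.
have x0 : 0 <= ell / L by rewrite divr_ge0 ?(ltW L0)// (le_trans (ltW L0)).
have C0 : 0 <= 16 * C_star :> R := mulr_ge0 (ler0n R 16) (ler0n R 140).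
have r0 : 0 <= ell / L * (root_rate * eps ^- 3).
  by rewrite mulr_ge0 // mulr_ge0 ?sqrtr_ge0 // invr_ge0 exprn_ge0 // ltW.
rewrite -(ger0_norm r0) -sqrtr_sqr; apply: ler_wsqrtr.
rewrite exprMn [(root_rate * _) ^+ 2]exprMn sqr_sqrtr; last exact: mulr_ge0 (mulr_ge0 C0 (sqr_ge0 _)) Br_rate_ge0.
have h1 : be ^- 2 <= step_rate ^+ 2 * eps ^- 2.
  rewrite -!exprVn -exprMn; apply: lerXn2r; last exact: inv_beta_rate.
    by rewrite nnegrE invr_ge0 ltW.
  by rewrite nnegrE mulr_ge0 ?step_rate_ge0 // invr_ge0 ltW.
have h2 := Br_vr_rate e0 e1.
have -> : (ell / L) ^+ 2 * (16 * C_star * step_rate ^+ 2 * Br_rate * (eps ^- 3) ^+ 2)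
  = (16 * C_star * (ell / L) ^+ 2 * (step_rate ^+ 2 * eps ^- 2)) * (Br_rate * eps ^- 4).
  have -> : (eps ^- 3) ^+ 2 = eps ^- 2 * eps ^- 4 by rewrite exprVn -exprM -invfM -exprD.
  by move: (ell / L) (16 * C_star) (eps ^- 2) (eps ^- 4) => a b c d; ring.
have Ax : 0 <= 16 * C_star * (ell / L) ^+ 2 := mulr_ge0 C0 (sqr_ge0 _).
rewrite /A_vr; apply: ler_pM h2; rewrite ?ler0n //.
  by rewrite mulr_ge0 // invr_ge0 sqr_ge0.
by apply: ler_wpM2l.
Qed.

Definition vr_constant : R := Br_rate + 18 * T_rate 128 * root_rate.

Lemma bound_vr_rate eps : 0 < eps -> eps <= 1 -> L <= ell ->
  bound_vr L DY Bb sigma ell eps <= vr_constant * (eps ^- 4 + ell / L * eps ^- 6).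
Proof.
move=> e0 e1 Ll; rewrite /bound_vr /vr_constant.
have x0 : 0 <= ell / L by rewrite divr_ge0 ?(ltW L0)// (le_trans (ltW L0)).
have i4 : 0 <= eps ^- 4 by rewrite invr_ge0 exprn_ge0 // ltW.
have i6 : 0 <= eps ^- 6 by rewrite invr_ge0 exprn_ge0 // ltW.
have B0' := Br_rate_ge0.
have T0 : 0 <= T_rate 128 := T_rate_ge0 (ler0n R 128).
have R0 : 0 <= root_rate := sqrtr_ge0 _.
have h1 := Br_vr_rate e0 e1.
have h2 : (T_vr L DY Bb eps)%:R * Num.min (Br_vr L DY sigma eps)%:R
    (Num.sqrt (A_vr L DY ell eps * (Br_vr L DY sigma eps)%:R))
    <= T_rate 128 * root_rate * (ell / L * eps ^- 6).
  have -> : T_rate 128 * root_rate * (ell / L * eps ^- 6)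
     = (T_rate 128 * eps ^- 3) * (ell / L * (root_rate * eps ^- 3)).
    have -> : eps ^- 6 = eps ^- 3 * eps ^- 3 by rewrite -invfM -exprD.
    by move: (ell / L) (eps ^- 3) (T_rate 128) => a b c; ring.
  have m0 : 0 <= Num.min (Br_vr L DY sigma eps)%:R (Num.sqrt (A_vr L DY ell eps * (Br_vr L DY sigma eps)%:R)).
    by rewrite le_min ler0n sqrtr_ge0.
  apply: ler_pM (ler0n R _) m0 (T_vr_rate e0 e1) _.
  by apply: le_trans (root_vr_rate e0 e1 Ll); rewrite ge_min lexx orbT.
have p1 := mulr_ge0 B0' (mulr_ge0 x0 i6).
have p2 := mulr_ge0 (mulr_ge0 T0 R0) i4.
rewrite -(mulrA 18); move: h1 h2 p1 p2.
move: Br_rate (T_rate 128) root_rate (ell / L) (eps ^- 4) (eps ^- 6) (Br_vr _ _ _ _)%:R (_ * Num.min _ _).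
by move=> c t r x e4 e6 B m; lra.
Qed.

Lemma vr_constant_gt0 : 0 < vr_constant.
Proof.
rewrite /vr_constant /Br_rate; apply: ltr_pwDl; last first.
  apply: mulr_ge0 (sqrtr_ge0 _); apply: mulr_ge0 (ler0n R 18) _.
  exact: T_rate_ge0 (ler0n R 128).
apply: ltr_pwDl ltr01 _; apply: mulr_ge0 (sqr_ge0 _); apply: mulr_ge0 (sqr_ge0 _).
exact: mulr_ge0 (ler0n R 768) (ler0n R 140).
Qed.

Lemma T_spde_bigO : bigO_right0 (fun eps => (T_spde L DY Bb eps)%:R) (fun eps => eps ^- 3).
Proof.
apply: (@bigO_right0_le _ _ (T_rate 64)) => eps e0 e1.
by rewrite !ger0_norm ?ler0n ?invr_ge0 ?exprn_ge0 ?(ltW e0)// T_spde_rate.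
Qed.

Lemma m_spde_bigO : bigO_right0 (fun eps => (m_spde L DY sigma eps)%:R) (fun eps => eps ^- 3).
Proof.
apply: (@bigO_right0_le _ _ m_rate) => eps e0 e1.
by rewrite !ger0_norm ?ler0n ?invr_ge0 ?exprn_ge0 ?(ltW e0)// m_spde_rate.
Qed.

Lemma N_spde_bigO : bigO_right0 (fun eps => (N_spde L DY Bb sigma eps)%:R) (fun eps => eps ^- 6).
Proof.
apply: (@bigO_right0_le _ _ (3 * (T_rate 64 * m_rate))) => eps e0 e1.
rewrite !ger0_norm ?ler0n ?invr_ge0 ?exprn_ge0 ?(ltW e0)//.
rewrite /N_spde /spde_calls sum_nat_const card_ord !natrM -!mulrA; apply: ler_wpM2l; rewrite ?ler0n//.
have -> : T_rate 64 * (m_rate * eps ^- 6) = (T_rate 64 * eps ^- 3) * (m_rate * eps ^- 3).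
  have -> : eps ^- 6 = eps ^- 3 * eps ^- 3 by rewrite -invfM -exprD.
  by move: (eps ^- 3) => z; ring.
by apply: ler_pM; rewrite ?ler0n ?T_spde_rate ?m_spde_rate.
Qed.

Lemma bound_vr_bigO : L <= ell ->
  bigO_right0 (fun eps => bound_vr L DY Bb sigma ell eps) (fun eps => eps ^- 6).
Proof.
move=> Ll; apply: (@bigO_right0_le _ _ (vr_constant * (1 + ell / L))) => eps e0 e1.
have i6 : 0 <= eps ^- 6 by rewrite invr_ge0 exprn_ge0 // ltW.
rewrite (ger0_norm i6) ger0_norm; last first.
  by rewrite addr_ge0 ?ler0n // mulr_ge0 ?mulr_ge0 ?ler0n // le_min ler0n sqrtr_ge0.
apply: le_trans (bound_vr_rate e0 e1 Ll) _; rewrite -[leRHS]mulrA.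
rewrite ler_wpM2l ?(ltW vr_constant_gt0) // mulrDl mul1r lerD2r.
exact: ler_inv_expr.
Qed.

Hypothesis s0 : sigma = 0.

Lemma N_spde_exact_bigO :
  bigO_right0 (fun eps => (N_spde L DY Bb sigma eps)%:R) (fun eps => eps ^- 3).
Proof.
apply: (@bigO_right0_le _ _ (3 * T_rate 64)) => eps e0 e1.
rewrite !ger0_norm ?ler0n ?invr_ge0 ?exprn_ge0 ?(ltW e0)//.
rewrite /N_spde /m_spde s0 expr0n mulr0 mul0r ceil1_0 /spde_calls sum_nat_const card_ord muln1 natrM.
by rewrite -mulrA ler_wpM2l ?ler0n ?T_spde_rate.
Qed.

Lemma N_vr_exact_bigO : L <= ell ->
  bigO_right0 (fun eps => (N_vr L DY Bb sigma ell eps)%:R) (fun eps => eps ^- 3).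
Proof.
move=> Ll; apply: (@bigO_right0_le _ _ (19 * T_rate 128)) => eps e0 e1.
rewrite !ger0_norm ?ler0n ?invr_ge0 ?exprn_ge0 ?(ltW e0)//.
apply: le_trans (vr_calls_le e0 Ll) _; rewrite /bound_vr.
have -> : Br_vr L DY sigma eps = 1%N by rewrite /Br_vr s0 expr0n mulr0 mul0r ceil1_0.
have := T_vr_rate e0 e1; have : 1 <= (T_vr L DY Bb eps)%:R :> R by rewrite ler1n ceil1_gt0.
set T := (T_vr L DY Bb eps)%:R => T1 Tr.
have T0 : 0 <= T by exact: le_trans ler01 T1.
have : T * Num.min 1 (Num.sqrt (A_vr L DY ell eps * 1)) <= T * 1.
  by apply: ler_wpM2l => //; rewrite ge_min lexx.
rewrite mulr1 -(mulrA 18) -(mulrA 19); move: (T * Num.min _ _) (T_rate 128 * _) Tr => x y; lra.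
Qed.

End Counts.

(** * Accuracy of the output *)

Section Accuracy.
Context {R : realType} {n p : nat}.
Notation pt := ('rV[R]_n * 'rV[R]_p)%type.
Context {X : set 'rV[R]_n} {Y : set 'rV[R]_p}.
Context {dS : measure_display} {S : measurableType dS} {D : probability S R}.
Context {f : pt -> S -> R^o} {gradf : pt -> S -> pt} {L : R}.
Hypothesis SA : standing_assumptions X Y D f gradf L.
Context {d : measure_display} {Omega : measurableType d} {P : probability Omega R}.
Context {sigma : R}.
Hypothesis so : stochastic_oracle X Y D f gradf P sigma.
Variables (x0 : 'rV[R]_n) (y0 : 'rV[R]_p).
Hypotheses (Xx0 : X x0) (Yy0 : Y y0).
Let B0 := initial_quantity X Y D f L x0 y0.
Let DY := max_norm Y.
Let L0 : 0 < L := L_gt0 SA.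
Let D0 : 0 < DY := max_norm_gt0 SA.

Lemma initial_quantity_ge0 : 0 <= B0.
Proof.
have h : 0 <= phi Y D f x0 - phi_inf X Y D f by rewrite subr_ge0 (phi_inf_le SA).
rewrite /B0 /initial_quantity; cbv zeta; apply: addr_ge0; last first.
  by apply: mulr_ge0 (sqr_ge0 _); apply: mulr_ge0 _ (ltW L0); rewrite addr_ge0 ?invr_ge0.
apply: addr_ge0.
  by apply: addr_ge0 h _; apply: mulr_ge0 (sqrtr_ge0 _); apply: mulr_ge0 (ler0n R 2) (ltW D0).
apply: mulr_ge0; last by rewrite invr_ge0 ltW.
exact: addr_ge0 (sqr_ge0 _) (mulr_ge0 (ler0n R 2) (sqr_ge0 _)).
Qed.

Variable Bb : R.
Hypothesis B0b : B0 <= Bb.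
Variable eps : R.
Hypothesis e0 : 0 < eps.
Let tau := tau_os L DY eps.
Let be := beta_os L DY eps.
Let tau0 : 0 < tau := tau_os_gt0 L0 D0 e0.
Let SP := os_step_params L0 tau0 (tau_os_le L DY eps).
Let be0 : 0 < be := beta_os_gt0 L0 D0 e0.

Let gap (rq : Omega -> @estimator R n p) t o := center_gap (X := X) (Y := Y) (D := D) (f := f) (L := L) (tau := tau)
  (h := h_par L tau) (al := alpha_par L tau) (k := k_par L tau) (be := be) x0 y0 (rq o) t.

(** The bias of the regularization takes eps^2 / 4, the rest must fit into
    3 eps^2 / 4. *)
Lemma random_iterate_accuracy (T : nat) (A : set (set Omega)) (J : Omega -> nat)
    (rq : Omega -> @estimator R n p) (M : R) :
  (0 < T)%N -> Defs.sub_sigma_algebra A -> unif_index P T A J ->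
  (forall t, (t < T)%N -> measurable_wrt A (gap rq t) /\ summable P (gap rq t)) ->
  be * L ^+ 2 * \sum_(t < T) mean P (gap rq t) <= M ->
  8 * M <= 3 / 4 * (be * T%:R * eps ^+ 2) ->
  ('E_P[fun o => (S_OS X Y D f L (z_of (run X Y L (os_params L DY eps) (rq o) x0 y0 (J o))) ^+ 2)%R]
    <= (eps ^+ 2)%:E)%E.
Proof.
move=> T0 sA UJ HZ HM Me; rewrite unlock.
pose G t o := S_OS X Y D f L (z_of (run X Y L (os_params L DY eps) (rq o) x0 y0 t)) ^+ 2.
have TR : 0 < T%:R :> R by rewrite ltr0n.
apply: le_trans (random_index_bound T0 sA UJ (G := G) (Z := gap rq) (k := 8 * L ^+ 2) (c := eps ^+ 2 / 4) _ _ HZ) _.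
- by move=> t o; exact: sqr_ge0.
- move=> t o _; apply: le_trans (S_OS_le SA (ltW tau0) (saddleP SA SP _)) _.
  have bias := tau_os_bias L0 D0 eps; rewrite -/tau in bias.
  apply: lerD; last exact: bias.
  by apply: le_refl.
rewrite lee_fin; move: HM Me; set s := \sum_(t < T) _.
move: be be0 (T%:R) TR (L ^+ 2) (eps ^+ 2) => c c0 N N0 l e HM Me.
have -> : 8 * l * (N^-1 * s) = 8 * (c * l * s) / (c * N) by field; rewrite !gt_eqF.
have cN : 0 < c * N by exact: mulr_gt0.
have : 8 * (c * l * s) / (c * N) <= 3 / 4 * e.
  rewrite ler_pdivrMr //; apply: le_trans (ler_wpM2l (ler0n R 8) HM) _.
  by apply: le_trans Me _; rewrite le_eqVlt; apply/orP; left; apply/eqP; ring.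
by move=> h; apply: le_trans (lerD h (lexx _)) _; lra.
Qed.

Let Bb0 : 0 <= Bb := le_trans initial_quantity_ge0 B0b.

(** With T and m as chosen, 8 L B0 <= be T eps^2 / 8 and the noise term
    168 T sigma^2 / m is below be T eps^2 / 100. *)
Lemma spde_accuracy (w : nat * nat -> Omega -> S) (J : Omega -> nat) :
  let T := T_spde L DY Bb eps in let m := m_spde L DY sigma eps in
  iid_samples P D (spde_indices T m) w ->
  unif_index P T (sample_sigma (spde_indices T m) w) J ->
  ('E_P[fun o => (S_OS X Y D f L (z_of (run X Y L (os_params L DY eps)
      (spde_req gradf m (fun a => w a o)) x0 y0 (J o))) ^+ 2)%R] <= (eps ^+ 2)%:E)%E.
Proof.
move=> T m iid UJ.
have T0 : (0 < T)%N by exact: ceil1_gt0. have m0 : (0 < m)%N by exact: ceil1_gt0.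
have TR : 0 < T%:R :> R by rewrite ltr0n. have mR : 0 < m%:R :> R by rewrite ltr0n.
apply: (random_iterate_accuracy (rq := fun o => spde_req gradf m (fun a => w a o)) T0 _ UJ _
  (spde_bound SA so SP Xx0 Yy0 m0 iid)).
- by apply: sample_sigma_sub => a Ia; case: (iid.1 a Ia).
- by move=> t /(spde_gap SA so SP Xx0 Yy0 m0 iid)[s1 s2].
have : 64 * L * Bb / (be * eps ^+ 2) <= T%:R by exact: ceil1_ge.
have : 19200 * sigma ^+ 2 / (be * eps ^+ 2) <= m%:R by exact: ceil1_ge.
have LB := ler_wpM2l (ltW L0) B0b.
rewrite natrM -/B0 -(mulrA 64).
have i2 : 0 < eps ^+ 2 by exact: exprn_gt0.
move: be be0 (T%:R) TR (m%:R) mR (eps ^+ 2) i2 (sigma ^+ 2) (L * Bb) (L * B0) LB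
  => c c0 N N0 M M0 e i2 v LBb LB LBB.
have ce : 0 < c * e by exact: mulr_gt0.
rewrite !ler_pdivrMr // => h1 h2.
have {}h1 : 19200 * (v / M) <= c * e by rewrite mulrA ler_pdivrMr // [leRHS]mulrC.
have := ler_wpM2l (ltW N0) h1; have := mulr_ge0 (ltW N0) (ltW ce).
have -> : N * (19200 * (v / M)) = 19200 * (N * (v / M)) by rewrite mulrCA.
have -> : c * N * e = N * (c * e) by ring.
rewrite -(mulrA 3); move: h2; move: (N * (c * e)) (N * (v / M)) => x y; lra.
Qed.

(** The choice b >= A q with A = 2240 (ell / L)^2 / be^2 is far above what the
    accumulated increments require; the refresh error is controlled by Br. *)
Lemma vr_accuracy (ell : R) (w : nat * nat -> Omega -> S) (J : Omega -> nat) :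
  L <= ell -> paired_oracle X Y D gradf P ell ->
  let T := T_vr L DY Bb eps in let Br := Br_vr L DY sigma eps in
  let q := q_vr L DY sigma ell eps in let b := b_vr L DY sigma ell eps in
  iid_samples P D (vr_indices T Br b q) w ->
  unif_index P T (sample_sigma (vr_indices T Br b q) w) J ->
  ('E_P[fun o => (S_OS X Y D f L (z_of (run X Y L (os_params L DY eps)
      (vr_req gradf Br b q (fun a => w a o)) x0 y0 (J o))) ^+ 2)%R] <= (eps ^+ 2)%:E)%E.
Proof.
move=> Ll po T Br q b iid UJ.
have T0 : (0 < T)%N by exact: ceil1_gt0. have r0 : (0 < Br)%N by exact: ceil1_gt0.
have q0 : (0 < q)%N by exact: q_vr_gt0. have b0 : (0 < b)%N by exact: b_vr_gt0.
have TR : 0 < T%:R :> R by rewrite ltr0n. have rR : 0 < Br%:R :> R by rewrite ltr0n.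
have bR : 0 < b%:R :> R by rewrite ltr0n.
have cond : (200 * be)^-1 * (q%:R * (ell ^+ 2 / b%:R)) <= be * L ^+ 2.
  have [Aq _] := b_vrE (DY := DY) sigma L0 D0 e0 Ll; move: Aq; rewrite -/b -/q /A_vr -/be.
  rewrite -[C_star]/(140 : R); move: be be0 (q%:R) (ler0n R q) (b%:R) bR => c c0 Q Q0 B B_gt0.
  have ell0 : 0 < ell by exact: lt_le_trans L0 Ll.
  have -> : 16 * 140 * (ell / L) ^+ 2 / c ^+ 2 * Q = 2240 * (Q * ell ^+ 2) / (c ^+ 2 * L ^+ 2).
    by field; rewrite !gt_eqF.
  have cL : 0 < c ^+ 2 * L ^+ 2 by rewrite mulr_gt0 ?exprn_gt0.
  rewrite ler_pdivrMr // => Aq.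
  have -> : (200 * c)^-1 * (Q * (ell ^+ 2 / B)) = Q * ell ^+ 2 / (200 * c * B).
    by field; rewrite !gt_eqF.
  have cB : 0 < 200 * c * B := mulr_gt0 (mulr_gt0 (ltr0Sn R 199) c0) B_gt0.
  rewrite ler_pdivrMr //.
  have -> : c * L ^+ 2 * (200 * c * B) = 200 * (B * (c ^+ 2 * L ^+ 2)) by ring.
  have := mulr_ge0 (ltW B_gt0) (ltW cL); move: Aq.
  by move: (B * (c ^+ 2 * L ^+ 2)) (Q * ell ^+ 2) => x y; lra.
apply: (random_iterate_accuracy (rq := fun o => vr_req gradf Br b q (fun a => w a o)) T0 _ UJ _
  (vr_bound SA so SP Xx0 Yy0 r0 b0 q0 po iid cond)).
- by apply: sample_sigma_sub => a Ia; case: (iid.1 a Ia).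
- by move=> t /(vr_gap SA so SP Xx0 Yy0 r0 b0 po iid)[s1 s2].
have : 128 * L * Bb / (be * eps ^+ 2) <= T%:R by exact: ceil1_ge.
have : 768 * C_star * sigma ^+ 2 / (be ^+ 2 * eps ^+ 2) <= Br%:R by exact: ceil1_ge.
have LB := ler_wpM2l (ltW L0) B0b.
rewrite natrM -/B0 -[beta_par L tau]/be -(mulrA 128) -[C_star]/(140 : R).
have i2 : 0 < eps ^+ 2 by exact: exprn_gt0.
move: be be0 (T%:R) TR (Br%:R) rR (eps ^+ 2) i2 (sigma ^+ 2) (L * Bb) (L * B0) LB
  => c c0 N N0 M M0 e i2 v LBb LB LBB.
have ce : 0 < c * e by exact: mulr_gt0.
have cce : 0 < c ^+ 2 * e by rewrite mulr_gt0 ?exprn_gt0.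
rewrite !ler_pdivrMr // => h1 h2.
have h3 : 768 * 140 * ((200 * c)^-1 * (3 * N * (v / M))) <= 3 / 200 * (N * (c * e)).
  have -> : 768 * 140 * ((200 * c)^-1 * (3 * N * (v / M))) = 3 / 200 * (N * (768 * 140 * v / (c * M))).
    by move: (768 * 140) => z; field; rewrite !gt_eqF.
  apply: ler_wpM2l; first by rewrite divr_ge0 ?ler0n.
  apply: (ler_wpM2l (ltW N0)); rewrite ler_pdivrMr ?mulr_gt0 //.
  by apply: le_trans h1 _; rewrite le_eqVlt; apply/orP; left; apply/eqP; ring.
have := mulr_ge0 (ltW N0) (ltW ce).
have -> : c * N * e = N * (c * e) by ring.
move: h2 h3; move: (N * (c * e)) ((200 * c)^-1 * _) => x y; lra.
Qed.

End Accuracy.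

Theorem theorem7 (R : realType) :
  exists2 C : R, 0 < C &
  forall (n p : nat) (X : set 'rV[R]_n) (Y : set 'rV[R]_p)
    (dS : measure_display) (S : measurableType dS) (D : probability S R)
    (f : 'rV[R]_n * 'rV[R]_p -> S -> R^o)
    (gradf : 'rV[R]_n * 'rV[R]_p -> S -> 'rV[R]_n * 'rV[R]_p)
    (L sigma : R)
    (d : measure_display) (Omega : measurableType d) (P : probability Omega R)
    (x0 : 'rV[R]_n) (y0 : 'rV[R]_p) (Bb : R),
  standing_assumptions X Y D f gradf L ->
  0 <= sigma -> stochastic_oracle X Y D f gradf P sigma ->
  X x0 -> Y y0 -> initial_quantity X Y D f L x0 y0 <= Bb ->
  let DY := max_norm Y in
  let stationarity z := S_OS X Y D f L z in
  (* (a) *)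
  ((forall eps : R, 0 < eps ->
      let T := T_spde L DY Bb eps in
      let m := m_spde L DY sigma eps in
      (forall (w : nat * nat -> Omega -> S) (J : Omega -> nat),
         iid_samples P D (spde_indices T m) w ->
         unif_index P T (sample_sigma (spde_indices T m) w) J ->
         let z_out o := z_of (run X Y L (os_params L DY eps)
                                (spde_req gradf m (fun a => w a o)) x0 y0 (J o)) in
         ('E_P[(fun o => stationarity (z_out o) ^+ 2)%R] <= ((eps ^+ 2)%R)%:E)%E) /\
      (N_spde L DY Bb sigma eps)%:R <= bound_spde L DY Bb sigma eps /\
      bound_spde L DY Bb sigma eps <=
        C * (1 + (L * Bb + sigma ^+ 2) * K_os L DY eps / eps ^+ 2
             + L * Bb * sigma ^+ 2 * K_os L DY eps ^+ 2 / eps ^+ 4)) /\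
   (0 < sigma ->
      [/\ bigO_right0 (fun eps => (T_spde L DY Bb eps)%:R) (fun eps => eps ^- 3),
          bigO_right0 (fun eps => (m_spde L DY sigma eps)%:R) (fun eps => eps ^- 3) &
          bigO_right0 (fun eps => (N_spde L DY Bb sigma eps)%:R) (fun eps => eps ^- 6)])) /\
  (* (b) *)
  ((forall ell : R, L <= ell -> paired_oracle X Y D gradf P ell ->
      forall eps : R, 0 < eps ->
      let T := T_vr L DY Bb eps in
      let Br := Br_vr L DY sigma eps in
      let q := q_vr L DY sigma ell eps in
      let b := b_vr L DY sigma ell eps in
      (forall (w : nat * nat -> Omega -> S) (J : Omega -> nat),
         iid_samples P D (vr_indices T Br b q) w ->
         unif_index P T (sample_sigma (vr_indices T Br b q) w) J ->
         let z_out o := z_of (run X Y L (os_params L DY eps)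
                                (vr_req gradf Br b q (fun a => w a o)) x0 y0 (J o)) in
         ('E_P[(fun o => stationarity (z_out o) ^+ 2)%R] <= ((eps ^+ 2)%R)%:E)%E) /\
      (N_vr L DY Bb sigma ell eps)%:R <= bound_vr L DY Bb sigma ell eps) /\
   (* the constant C' does not depend on ell / L *)
   (0 < sigma ->
      exists2 C' : R, 0 < C' & forall ell : R, L <= ell ->
        (\forall eps \near 0^'+, bound_vr L DY Bb sigma ell eps <=
           C' * (eps ^- 4 + ell / L * eps ^- 6)) /\
        bigO_right0 (fun eps => bound_vr L DY Bb sigma ell eps) (fun eps => eps ^- 6))) /\
  (* (c) *)
  (sigma = 0 ->
     bigO_right0 (fun eps => (N_spde L DY Bb sigma eps)%:R) (fun eps => eps ^- 3) /\
     forall ell : R, L <= ell -> paired_oracle X Y D gradf P ell ->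
       bigO_right0 (fun eps => (N_vr L DY Bb sigma ell eps)%:R) (fun eps => eps ^- 3)).
Proof.
have n0 := ler0n R.
exists (@spde_constant R); first by rewrite /spde_constant; repeat apply: mulr_gt0; rewrite ltr0n.
move=> n p X Y dS S D f gradf L sigma d Omega P x0 y0 Bb SA _ so Xx0 Yy0 B0b DY st.
have L0 := L_gt0 SA; have D0 : 0 < DY := max_norm_gt0 SA.
have Bb0 : 0 <= Bb := le_trans (initial_quantity_ge0 SA y0 Xx0) B0b.
split; [split|split; [split|]].
- move=> eps e0 T m; split; first by move=> w J iid UJ; exact: (spde_accuracy SA so Xx0 Yy0 B0b e0 iid UJ).
  by split; [exact: spde_calls_le|exact: bound_spde_le].
- by move=> _; split; [exact: T_spde_bigO|exact: m_spde_bigO|exact: N_spde_bigO].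
- move=> ell Ll po eps e0 T Br q b; split; last exact: vr_calls_le.
  by move=> w J iid UJ; exact: (vr_accuracy SA so Xx0 Yy0 B0b e0 Ll po iid UJ).
- move=> _; exists (vr_constant L DY Bb sigma); first exact: vr_constant_gt0.
  move=> ell Ll; split; last exact: bound_vr_bigO.
  near=> eps; have e0 : 0 < eps by near: eps; exact: nbhs_right_gt.
  have e1 : eps <= 1 by near: eps; exact: nbhs_right_le.
  exact: bound_vr_rate.
- by move=> s0; split; [exact: N_spde_exact_bigO|move=> ell Ll _; exact: N_vr_exact_bigO].
Unshelve. all: by end_near.
Qed.
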